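(* Let $2^{**}=\frac{2n}{n-4}$. For every integer $n\ge 5$ and every $\lambda<0$ there exists $q_{\lambda,n}\in(2,2^{**})$ such that if $q\in(q_{\lambda,n},2^{**}]$ then $$S_{q}(\lambda)<S_{q}^{\mathrm{rad}}(\lambda).$$ In particular, if $q\in(q_{\lambda,n},2^{**})$ and $\beta=n-\frac{q(n-4)}{2}$, then every ground state of the problem $$\Delta^{2}u+\lambda\,\mathrm{div}(|x|^{-2}\nabla u)=|x|^{-\beta}|u|^{q-2}u\ \text{ on }\mathbb{R}^{n},\qquad \int_{\mathbb{R}^{n}}|\Delta u|^{2}\,dx<\infty$$ is non radial.
   Context: All functions are real-valued. $D^{2,2}(\mathbb{R}^{n})$ is the completion of $C^{\infty}_{c}(\mathbb{R}^{n})$ with respect to the norm $\|u\|_{D^{2,2}}^{2}=\sum_{i,j=1}^{n}\int_{\mathbb{R}^{n}}\left|\frac{\partial^{2}u}{\partial x_{i}\partial x_{j}}\right|^{2}dx$, and $D^{2,2}_{\mathrm{rad}}(\mathbb{R}^{n})$ is the space of radial functions belonging to $D^{2,2}(\mathbb{R}^{n})$. For $q\in(2,2^{**}]$, $\beta=n-\frac{q(n-4)}{2}$ and $\lambda\in\mathbb{R}$, $$S_{q}(\lambda):=\inf_{u\in D^{2,2}(\mathbb{R}^{n}),\,u\ne 0}\frac{\int_{\mathbb{R}^{n}}|\Delta u|^{2}\,dx-\lambda\int_{\mathbb{R}^{n}}|x|^{-2}|\nabla u|^{2}\,dx}{\left(\int_{\mathbb{R}^{n}}|x|^{-\beta}|u|^{q}\,dx\right)^{2/q}},$$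 and $S_{q}^{\mathrm{rad}}(\lambda)$ is the infimum of the same quotient over $u\in D^{2,2}_{\mathrm{rad}}(\mathbb{R}^{n})$, $u\neq 0$. A weak solution of the problem is a function $u\in D^{2,2}(\mathbb{R}^{n})$ such that $\int\Delta u\,\Delta v\,dx-\lambda\int|x|^{-2}\nabla u\cdot\nabla v\,dx=\int|x|^{-\beta}|u|^{q-2}uv\,dx$ for all $v\in C^{\infty}_{c}(\mathbb{R}^{n})$. A ground state is a weak nontrivial solution $u\in D^{2,2}(\mathbb{R}^{n})$ that attains the infimum $S_{q}(\lambda)$. *)

(* Defs.v *)
From HB Require Import structures.
From mathcomp Require Import all_boot all_order all_algebra.
From mathcomp Require Import all_classical all_reals all_analysis.

Set Implicit Arguments.
Unset Strict Implicit.
Unset Printing Implicit Defensive.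

Import Order.TTheory GRing.Theory Num.Theory.
Import numFieldNormedType.Exports.

Local Open Scope classical_set_scope.
Local Open Scope ring_scope.

Definition rV_display : measure_display. Proof. by []. Qed.

(** The product sigma-algebra on 'rV[R]_n, i.e. the Borel sets of R^n. *)
Section measurable_rV.
Context (R : realType) (n : nat).

Let coord (i : 'I_n) (x : 'rV[R]_n) : measurableTypeR R := x ord0 i.

Let rV_set0 : g_sigma_preimage coord set0.
Proof. exact: sigma_algebra0. Qed.

Let rV_setC A : g_sigma_preimage coord A -> g_sigma_preimage coord (~` A).
Proof. exact: sigma_algebraC. Qed.

Let rV_bigcup (F : _^nat) : (forall i, g_sigma_preimage coord (F i)) ->
  g_sigma_preimage coord (\bigcup_i (F i)).
Proof. exact: sigma_algebra_bigcup. Qed.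

HB.instance Definition _ := @isMeasurable.Build rV_display
  'rV[R]_n (g_sigma_preimage coord) rV_set0 rV_setC rV_bigcup.

End measurable_rV.

Lemma measurable_rV_coord (R : realType) (n : nat) (i : 'I_n) :
  measurable_fun [set: 'rV[R]_n] (fun x => x ord0 i : measurableTypeR R).
Proof.
move=> _ Y mY; rewrite setTI; apply: sub_sigma_algebra => /=.
rewrite -bigcup_seq/=; exists i => /=; first by rewrite mem_index_enum.
by exists Y => //; rewrite setTI.
Qed.

Lemma measurable_fun_rVP d (T : measurableType d) (R : realType) (n : nat)
    (f : T -> 'rV[R]_n) :
  (forall i, measurable_fun [set: T] (fun t => f t ord0 i : measurableTypeR R)) ->
  measurable_fun [set: T] f.
Proof.
move=> mf _ Y mY; rewrite setTI; move: Y mY.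
apply: smallest_sub.
  split; first by rewrite /= preimage_set0.
    by move=> A mA; rewrite setTD preimage_setC; exact: measurableC.
  by move=> F mF; rewrite preimage_bigcup; exact: bigcup_measurable.
rewrite -bigcup_seq/=; apply: bigcup_sub => i _ A [B mB <-] /=.
by rewrite -[X in measurable X]setTI setTI; exact: mf.
Qed.

Definition rV_cons (R : realType) (n : nat)
    (p : measurableTypeR R * 'rV[R]_n) : 'rV[R]_n.+1 :=
  \row_i (if unlift ord0 i is Some j then p.2 ord0 j else p.1).

Lemma measurable_rV_cons (R : realType) (n : nat) :
  measurable_fun setT (@rV_cons R n).
Proof.
apply: measurable_fun_rVP => i; rewrite /rV_cons.
case: (unliftP ord0 i) => [j ->|->].
  rewrite (_ : (fun _ => _) =
      (fun x : 'rV[R]_n => x ord0 j : measurableTypeR R) \o snd).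
    by apply: measurableT_comp => //; exact: measurable_rV_coord.
  by apply/funext => t; rewrite mxE liftK.
rewrite (_ : (fun _ => _) = fst) //.
by apply/funext => t; rewrite mxE unlift_none.
Qed.

Section lebesgueS.
Context (R : realType) (n : nat).
Variable m : {sigma_finite_measure set 'rV[R]_n -> \bar R}.

Definition lebesgueS : set 'rV[R]_n.+1 -> \bar R :=
  pushforward (@lebesgue_measure R \x m)%E (@rV_cons R n).

Let cons_preimage (A : set 'rV[R]_n.+1) :
  measurable A -> measurable (@rV_cons R n @^-1` A).
Proof.
by move=> mA; rewrite -[X in measurable X]setTI; exact: measurable_rV_cons.
Qed.

Let lebesgueS0 : lebesgueS set0 = 0%E.
Proof. by rewrite /lebesgueS /pushforward preimage_set0 measure0. Qed.

Let lebesgueS_ge0 A : (0 <= lebesgueS A)%E.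
Proof. by rewrite /lebesgueS /pushforward; exact: measure_ge0. Qed.

Let lebesgueS_sigma_additive : semi_sigma_additive lebesgueS.
Proof.
move=> F mF tF mUF; rewrite /lebesgueS /pushforward preimage_bigcup.
apply: measure_semi_sigma_additive.
- by move=> k; exact: cons_preimage.
- apply/trivIsetP => /= i j _ _ ij; rewrite -preimage_setI.
  by move/trivIsetP : tF => /(_ _ _ _ _ ij) ->//; rewrite preimage_set0.
- by rewrite -preimage_bigcup; exact: cons_preimage.
Qed.

HB.instance Definition _ := isMeasure.Build _ _ _ lebesgueS
  lebesgueS0 lebesgueS_ge0 lebesgueS_sigma_additive.

Let lebesgueS_sigma_finite : sigma_finite setT lebesgueS.
Proof.
pose uncons (x : 'rV[R]_n.+1) : measurableTypeR R * 'rV[R]_n :=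
  (x ord0 ord0, \row_j x ord0 (lift ord0 j)).
have unconsK : cancel (@rV_cons R n) uncons.
  move=> [a x]; rewrite /uncons /rV_cons; congr pair.
    by rewrite mxE unlift_none.
  by apply/rowP => j; rewrite !mxE liftK.
have muncons : measurable_fun setT uncons.
  apply/measurable_fun_pairP; split; first exact: measurable_rV_coord.
  apply: measurable_fun_rVP => j.
  rewrite (_ : (fun _ => _) =
      fun x : 'rV[R]_n.+1 => x ord0 (lift ord0 j) : measurableTypeR R).
    exact: measurable_rV_coord.
  by apply/funext => x; rewrite /uncons /= mxE.
have /sigma_finiteP[F [TF ndF Foo]] := sigma_finiteT (@lebesgue_measure R).
have /sigma_finiteP[G [TG ndG Goo]] := sigma_finiteT m.
exists (fun k => uncons @^-1` (F k `*` G k)).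
  apply/esym/seteqP; split => // x _.
  have [i _ Fi] : (\bigcup_i F i) (uncons x).1 by rewrite -TF.
  have [j _ Gj] : (\bigcup_i G i) (uncons x).2 by rewrite -TG.
  exists (maxn i j) => //; split.
    by move: Fi; exact/subsetPset/ndF/leq_maxl.
  by move: Gj; exact/subsetPset/ndG/leq_maxr.
move=> k; have [mF Fk] := Foo k; have [mG Gk] := Goo k; split.
  by rewrite -[X in measurable X]setTI; apply: muncons => //; exact: measurableX.
rewrite /lebesgueS /pushforward -comp_preimage.
rewrite (_ : uncons \o _ = id); last by apply/funext => x; exact: unconsK.
by rewrite preimage_id product_measure1E// lte_mul_pinfty// ge0_fin_numE.
Qed.

HB.instance Definition _ := Measure_isSigmaFinite.Build _ _ _ lebesgueS
  lebesgueS_sigma_finite.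

End lebesgueS.

(** R^0 is a point, and on R^{n+1} = R x R^n one takes the product measure. *)
Fixpoint lebesgue_rV (R : realType) (n : nat) :
    {sigma_finite_measure set 'rV[R]_n -> \bar R} :=
  if n is n'.+1 then lebesgueS (lebesgue_rV R n') else \d_(0 : 'rV[R]_0).

Lemma lebesgue_rV_box (R : realType) (n : nat)
    (A : 'I_n -> set (measurableTypeR R)) :
  (forall i, measurable (A i)) ->
  lebesgue_rV R n [set x | forall i, A i (x ord0 i)] =
    (\prod_(i < n) lebesgue_measure (A i))%E.
Proof.
elim: n A => [|n IH] A mA.
  rewrite big_ord0 /= diracE mem_set //=; by case.
rewrite big_ord_recl -IH // /= /lebesgueS /pushforward.
rewrite -product_measure1E //; last first.
  rewrite [X in measurable X](_ : _ = \bigcap_(i in [set: 'I_n])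
      [set x : 'rV[R]_n | A (lift ord0 i) (x ord0 i)]); last first.
    by apply/seteqP; split => x /= xA i; [move=> _|]; exact: xA.
  apply: fin_bigcap_measurable => // i _.
  by rewrite -[X in measurable X]setTI; exact: measurable_rV_coord.
congr (_ _); apply/seteqP; split => -[a x] /=; rewrite /rV_cons.
  move=> xA; split => [|i].
    by have := xA ord0; rewrite mxE unlift_none.
  by have := xA (lift ord0 i); rewrite mxE liftK.
move=> [aA xA] i; rewrite mxE.
by case: (unliftP ord0 i) => [j ->|->] //=.
Qed.

(** 2** = 2n / (n - 4) *)
Definition crit_exp (R : realType) (n : nat) : R := 2 * n%:R / (n%:R - 4).

Section calculus.
Context {R : realType} {n : nat}.
Implicit Types (x : 'rV[R]_n) (u v f phi : 'rV[R]_n -> R).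

(** The Euclidean norm; the norm [`|x|] of the library is the sup norm. *)
Definition enorm x : R := Num.sqrt (\sum_(i < n) x ord0 i ^+ 2).

Definition pderiv (i : 'I_n) f : 'rV[R]_n -> R :=
  fun x => 'D_(delta_mx ord0 i) f x.

(** [pderivs [:: i1; ...; ik] f] is the iterated partial derivative
    d_i1 ( ... (d_ik f)). *)
Definition pderivs (s : seq 'I_n) f : 'rV[R]_n -> R := foldr pderiv f s.

Definition smooth f : Prop := forall s : seq 'I_n,
  continuous (pderivs s f) /\
  forall (i : 'I_n) x, derivable (pderivs s f) x (delta_mx ord0 i).

Definition test_function f : Prop :=
  smooth f /\ compact (closure [set x | f x != 0]).

Definition laplacian f : 'rV[R]_n -> R :=
  fun x => \sum_(i < n) pderivs [:: i; i] f x.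

Local Notation mu := (lebesgue_rV R n).

Definition loc_integrable f : Prop :=
  measurable_fun setT f /\
  forall K : set 'rV[R]_n, compact K ->
    (\int[mu]_(x in K) `|(f x)%:E| < +oo)%E.

Definition is_weak_deriv (s : seq 'I_n) u (g : 'rV[R]_n -> R) : Prop :=
  [/\ loc_integrable u, loc_integrable g &
    forall phi, test_function phi ->
      \int[mu]_x (u x * pderivs s phi x) =
      (-1) ^+ size s * \int[mu]_x (g x * phi x)].

Definition is_weak_grad u (g : 'I_n -> 'rV[R]_n -> R) : Prop :=
  forall i, is_weak_deriv [:: i] u (g i).

Definition is_weak_laplacian u (l : 'rV[R]_n -> R) : Prop :=
  exists2 h : 'I_n -> 'rV[R]_n -> R,
    (forall i, is_weak_deriv [:: i; i] u (h i)) &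
    l = (fun x => \sum_(i < n) h i x).

Definition D22_norm2 f : R :=
  \sum_(i < n) \sum_(j < n) \int[mu]_x (pderivs [:: i; j] f x ^+ 2).

Definition D22_cauchy (phi : nat -> 'rV[R]_n -> R) : Prop :=
  forall e : R, 0 < e -> exists N : nat, forall k m : nat,
    (N <= k)%N -> (N <= m)%N -> D22_norm2 (phi k \- phi m) < e.

(** The completion of the test functions, realised as a space of functions:
    for n >= 5 the Sobolev inequality ||phi||_{2**} <= C ||phi||_{D^{2,2}}
    makes every Cauchy sequence converge in L^{2**}, and the class of the
    sequence is identified with its limit. As usual, functions that agree
    almost everywhere represent the same element. *)
Definition D22 u : Prop :=
  measurable_fun setT u /\
  exists phi : nat -> 'rV[R]_n -> R,
    [/\ forall k, test_function (phi k),
        D22_cauchy phi &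
        (\int[mu]_x (`|phi k x - u x| `^ crit_exp R n)%:E)%E @[k --> \oo] --> 0%E].

Definition nonzero u : Prop := ~ {ae mu, forall x, u x = 0}.

Definition radial u : Prop :=
  exists f : R -> R, {ae mu, forall x, u x = f (enorm x)}.

Definition hardy_exp (q : R) : R := n%:R - q * (n%:R - 4) / 2.

(** The quotient, where [g] and [l] are the gradient and the Laplacian of [u]. *)
Definition quotient (q lambda : R) u (g : 'I_n -> 'rV[R]_n -> R)
    (l : 'rV[R]_n -> R) : \bar R :=
  ((\int[mu]_x (l x ^+ 2)%:E -
    lambda%:E * \int[mu]_x (enorm x ^- 2 * \sum_(i < n) g i x ^+ 2)%:E) /
   (\int[mu]_x (enorm x `^ (- hardy_exp q) * `|u x| `^ q)%:E) `^ (2 / q))%E.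

(** The weak gradient and Laplacian of an element of D^{2,2} exist and are
    unique up to null sets. *)
Definition quotients (P : ('rV[R]_n -> R) -> Prop) (q lambda : R) :
    set (\bar R) :=
  [set t | exists u g l,
    [/\ D22 u, nonzero u, P u, is_weak_grad u g & is_weak_laplacian u l] /\
    t = quotient q lambda u g l].

Definition is_weak_solution (q lambda : R) u : Prop :=
  D22 u /\
  exists g l, [/\ is_weak_grad u g, is_weak_laplacian u l &
    forall v, test_function v ->
      \int[mu]_x (l x * laplacian v x) -
      lambda * \int[mu]_x (enorm x ^- 2 * \sum_(i < n) g i x * pderiv i v x) =
      \int[mu]_x (enorm x `^ (- hardy_exp q) * `|u x| `^ (q - 2) * u x * v x)].

End calculus.

Section minimisation.
Context (R : realType) (n : nat).

Definition Sq (q lambda : R) : \bar R :=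
  ereal_inf (@quotients R n (fun=> True) q lambda).

Definition Sq_rad (q lambda : R) : \bar R :=
  ereal_inf (@quotients R n radial q lambda).

Definition is_ground_state (q lambda : R) (u : 'rV[R]_n -> R) : Prop :=
  [/\ is_weak_solution q lambda u, nonzero u &
    exists g l, [/\ is_weak_grad u g, is_weak_laplacian u l &
      quotient q lambda u g l = Sq q lambda]].

End minimisation.

(* Main.v *)
(** Let [p = 2**] and let [S] be the infimum of [int |Lap f|^2 / (int |f|^p)^(2/p)] over test
    functions. At [q = p] the quotient is translation invariant except for the Hardy term,
    and this term tends to [0] when a test function is translated to infinity. Hence the
    unrestricted infimum is at most [S], and for [q] near [p] a fixed far translate of an
    almost optimal [f] gives an upper bound that is continuous in [q].

    A radial function cannot escape to infinity. Write [G] for [int |x|^-2 |grad u|^2].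
    Integration along rays and Hardy's inequality give the pointwise bound
    [|u x| <= C G^(1/2) |x|^(-(n-4)/2)], and interpolation with the Hardy bound
    [int |x|^-4 u^2 <= C G] yields [(int |u|^p)^(2/p) <= C' G]. So for [lambda < 0] the
    radial quotient at [q = p] is at least [S + |lambda| / C']. For [q < p], Hoelder's
    inequality between [int |x|^-4 u^2] and [int |u|^p] gives a lower bound that is
    continuous in [q] with this same value at [q = p]. The two bounds stay separated for
    [q] close to [p].

    The two estimates pass from test functions to [D22] by weak lower semicontinuity (against
    the test functions of the approximating sequence) and Fatou's lemma. *)

From HB Require Import structures.
Require Import Defs.
From mathcomp Require Import all_boot all_order all_algebra.
From mathcomp Require Import all_classical all_reals all_analysis.
From mathcomp Require Import measurable_realfun.
From mathcomp Require Import ring lra.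
Import Order.TTheory GRing.Theory Num.Theory.
Import numFieldNormedType.Exports.
Local Open Scope classical_set_scope.
Local Open Scope ring_scope.

Set Implicit Arguments.
Unset Strict Implicit.
Unset Printing Implicit Defensive.

(** * Lebesgue measure on row vectors *)

(** The approximants of a radial element of [D22] are arbitrary test functions, so no radial
    argument applies to them. The ray estimate is therefore averaged over a sphere, a form in which
    it holds for every test function. Radiality of the limit is used only after Fatou's lemma, on
    those spheres where the approximants converge almost everywhere. This calls for polar
    coordinates compatible with the recursively defined product measure; the sphere measure is
    obtained by pushing the unit ball forward.

    The energies of the approximants must be bounded by that of the limit, the direction opposite to
    plain semicontinuity. The Cauchy property provides this: pairing the weak derivatives of the
    limit with those of a late approximant bounds the energy of the approximant by that of the limit
    plus e. The singular weight |x|^-2 is replaced by [regw], so that only smooth fields are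
    integrated by parts, and the energy bounds are uniform in the regularisation parameter. *)

Lemma ler_coord_norm (R : realType) (n : nat) (x : 'rV[R]_n) (i : 'I_n) :
  `|x ord0 i| <= `|x|.
Proof.
rewrite [leRHS]/Num.norm /= mx_normrE.
exact: (le_bigmax _ (fun ij : 'I_1 * 'I_n => `|x ij.1 ij.2|) (ord0, i)).
Qed.

Section borel_rV.
Context {R : realType} {n : nat}.
Implicit Types (A : set 'rV[R]_n) (f : 'rV[R]_n -> R).

Lemma measurable_box (B : 'I_n -> set (measurableTypeR R)) :
  (forall i, measurable (B i)) ->
  measurable [set x : 'rV[R]_n | forall i, B i (x ord0 i)].
Proof.
move=> mB; rewrite [X in measurable X](_ : _ = \bigcap_(i in [set: 'I_n])
    [set x : 'rV[R]_n | B i (x ord0 i)]); last first.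
  by apply/seteqP; split => x /= xB i; [move=> _|]; exact: xB.
apply: fin_bigcap_measurable => // i _.
by rewrite -[X in measurable X]setTI; exact: measurable_rV_coord.
Qed.

(** Cubes with rational centres and radii 1/(k+1) form a countable base: inside a ball of radius e
    around x, take such a cube of radius below e/2 centred at a rational point close to x. *)
Lemma open_measurable_rV A : open A -> measurable A.
Proof.
move=> oA.
pose Q (p : 'rV[rat]_n * nat) : set 'rV[R]_n :=
  [set x | forall i, ball (ratr (p.1 ord0 i) : R) p.2.+1%:R^-1 (x ord0 i)].
have AE : A = \bigcup_(p in [set p | Q p `<=` A]) Q p.
  apply/seteqP; split => [x Ax|x [p pA]]; last exact: pA.
  have /nbhs_ballP[e /= e0 eA] : nbhs x A by exact: open_nbhs_nbhs.
  have [k ke] : exists k : nat, k.+1%:R^-1 < e / 2.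
    have e20 : 0 < e / 2 by rewrite divr_gt0.
    have [k _ /(_ k (leqnn k))] := near_infty_natSinv_lt (PosNum e20).
    by exists k.
  have /choice[q qx] : forall i : 'I_n, exists r : rat, ball (x ord0 i) k.+1%:R^-1 (ratr r).
    move=> i; have : x ord0 i - k.+1%:R^-1 < x ord0 i + k.+1%:R^-1.
      by rewrite ltrD2l (@lt_trans _ _ 0)// ?oppr_lt0 ?invr_gt0.
    by move=> /rat_in_itvoo[r]; rewrite in_itv/= => xr; exists r;
      rewrite ball_itv/= in_itv.
  exists (\row_i q i, k).
    move=> y yQ; apply: eA; split => // i j; rewrite ord1.
    have := yQ j; rewrite /= mxE => /(le_ball (ltW ke)) bq.
    by have := ball_triangle (le_ball (ltW ke) (qx j)) bq; rewrite -splitr.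
  by move=> i /=; rewrite mxE; apply/ball_sym/qx.
rewrite AE bigcup_mkcond; apply: countable_bigcupT_measurable => // p.
case: ifPn => // _; 
apply: (@measurable_box (fun i => ball (ratr (p.1 ord0 i) : R) p.2.+1%:R^-1)) => i.
by rewrite ball_itv; exact: measurable_itv.
Qed.

Lemma continuous_measurable_rV f : continuous f -> measurable_fun setT f.
Proof.
move=> cf; apply: (measurability (@RGenOpens.G R)).
  exact: RGenOpens.measurableE.
move=> _ [_ [a [b ->]] <-]; rewrite setTI; apply: open_measurable_rV.
by apply: open_comp => //= ? _; exact: cf.
Qed.

(** Boxes form a pi-system generating the product sigma-algebra, and the cubes exhaust the space
    with finite measure. Identities between measures thus reduce to products of one-dimensional
    sets. *)
Lemma rV_measure_unique (m1 m2 : {measure set 'rV[R]_n -> \bar R}) :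
  (forall B : 'I_n -> set (measurableTypeR R), (forall i, measurable (B i)) ->
    m1 [set x : 'rV[R]_n | forall i, B i (x ord0 i)] = m2 [set x : 'rV[R]_n | forall i, B i (x ord0 i)]) ->
  (forall k : nat, (m1 [set x : 'rV[R]_n | forall i : 'I_n, (`|x ord0 i| <= k%:R)%R] < +oo)%E) ->
  forall A, measurable A -> m1 A = m2 A.
Proof.
move=> m12 m1oo A mA.
pose G : set (set 'rV[R]_n) := [set X | exists2 B : 'I_n -> set (measurableTypeR R),
  (forall i, measurable (B i)) & X = [set x : 'rV[R]_n | forall i, B i (x ord0 i)]].
apply: (measure_unique G (fun k => [set x : 'rV[R]_n | forall i : 'I_n, `|x ord0 i| <= k%:R])) => //.
- apply/seteqP; split => X.
    apply: smallest_sub => //.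
    rewrite -bigcup_seq/=; apply: bigcup_sub => i _ Y [B mB <-] /=.
    apply: sub_sigma_algebra; rewrite setTI.
    (* A generating cylinder is a box whose other sides are the whole line. *)
    exists (fun j => if j == i then B else setT).
      by move=> j; case: ifPn.
    apply/seteqP; split => x /=.
      by move=> Bx j; case: eqP => // ->.
    by move/(_ i); rewrite eqxx.
  apply: smallest_sub; first exact: sigma_algebra_measurable.
  by move=> _ [B mB ->]; exact: measurable_box.
- move=> _ _ [B mB ->] [C mC ->]; exists (fun i => B i `&` C i).
    by move=> i; exact: measurableI.
  apply/seteqP; split => x /=; first by move=> [xB xC] i; split.
  by move=> xBC; split => i; have [] := xBC i.
- move=> k; exists (fun=> [set t : R | `|t| <= k%:R]) => // _.
  rewrite (_ : mkset _ = `[-k%:R, k%:R]%classic)//.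
  by apply/seteqP; split => t/=; rewrite in_itv/= ler_norml.
- apply/seteqP; split => // x _.
  have [k kx] : exists k : nat, `|x| <= k%:R.
    by exists (Num.truncn `|x|).+1; rewrite ltW// truncnS_gt.
  exists k => //= i; apply: le_trans kx.
  exact: ler_coord_norm.
- by move=> _ [B mB ->]; exact: m12.
Qed.
End borel_rV.

Definition image_measure d d' (T1 : measurableType d) (T2 : measurableType d')
    (R : realType) (m : {measure set T1 -> \bar R}) (f : T1 -> T2)
    (mf : measurable_fun setT f) : {measure set T2 -> \bar R} :=
  measure_function_pushforward__canonical__measure_function_Measure m mf.

Section affine_lebesgue.
Context {R : realType}.

(** The scaled pushforward agrees with Lebesgue measure on the intervals []c, d]], which determine
    it. *)
Lemma lebesgue_measure_affine (s a : R) (A : set (measurableTypeR R)) :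
  0 < s -> measurable A ->
  (s%:E * lebesgue_measure ((fun x => s * x + a)%R @^-1` A) = lebesgue_measure A)%E.
Proof.
move=> s0 mA.
have mT : measurable_fun setT (fun x : measurableTypeR R => s * x + a : measurableTypeR R).
  apply: continuous_measurable_fun => x.
  by apply: cvgD; [apply: cvgM => //; exact: cvg_cst|exact: cvg_cst].
pose T : measurableTypeR R -> measurableTypeR R := fun x => s * x + a.
pose m := mscale (NngNum (ltW s0)) (image_measure (@lebesgue_measure R) (mT : measurable_fun setT T)).
have s_neq0 : s != 0 by rewrite gt_eqF.
apply/esym; rewrite (@lebesgue_measure_unique _ m)// => _ [[c d] _ <-] /=.
rewrite -[RHS]/(s%:E * lebesgue_measure (T @^-1` `]c, d]%classic))%E.
rewrite (_ : T @^-1` _ = `](c - a) / s, (d - a) / s]%classic); last first.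
  apply/seteqP; split => x; rewrite /T /= !in_itv/= ltr_pdivrMr// ler_pdivlMr//;
    by rewrite ltrBlDr lerBrDr (mulrC x).
rewrite !lebesgue_measure_itv/= !lte_fin ltr_pM2r ?invr_gt0// ltrD2r.
case: ifPn => _; last by rewrite mule0.
by rewrite -!EFinB -EFinM; congr EFin; field.
Qed.

Variable n : nat.
Local Notation mu := (lebesgue_rV R n).

Lemma measurable_affine_rV (s : R) (a : 'rV[R]_n) :
  measurable_fun setT (fun x : 'rV[R]_n => s *: x + a).
Proof.
apply: measurable_fun_rVP => i; rewrite [X in measurable_fun _ X](_ : _ =
  (fun t : measurableTypeR R => s * t + a ord0 i : measurableTypeR R) \o
  (fun x : 'rV[R]_n => x ord0 i : measurableTypeR R)); last first.
  by apply/funext => x; rewrite /= !mxE.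
apply: measurableT_comp; last exact: measurable_rV_coord.
apply: continuous_measurable_fun => x.
by apply: cvgD; [apply: cvgM => //; exact: cvg_cst|exact: cvg_cst].
Qed.

Lemma lebesgue_rV_cube_fin (k : R) :
  (mu [set x : 'rV[R]_n | forall i : 'I_n, (`|x ord0 i| <= k)%R] < +oo)%E.
Proof.
have -> : [set x : 'rV[R]_n | forall i : 'I_n, (`|x ord0 i| <= k)%R] =
  [set x | forall i, `[- k, k]%classic (x ord0 i)].
  by apply/seteqP; split => x /= xk i; have := xk i; rewrite in_itv/= ler_norml.
rewrite (lebesgue_rV_box (A := fun=> `[- k, k]%classic)) => [|i]; last exact: measurable_itv.
have [c ->] : exists c : R, lebesgue_measure (`[- k, k]%classic : set R) = c%:E.
  rewrite lebesgue_measure_itv/=; case: ifPn => _; last by exists 0.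
  by exists (k - (-k)); rewrite EFinB.
by rewrite prodEFin ltry.
Qed.

(** The preimage of a box is again a box, and each of its n sides absorbs one power of [s]. *)
Lemma lebesgue_rV_affine (s : R) (a : 'rV[R]_n) (A : set 'rV[R]_n) :
  0 < s -> measurable A ->
  ((s ^+ n)%:E * mu ((fun x => s *: x + a)%R @^-1` A) = mu A)%E.
Proof.
move=> s0 mA.
pose T (x : 'rV[R]_n) := s *: x + a.
have mT : measurable_fun setT T := measurable_affine_rV s a.
have sn0 : 0 <= s ^+ n by rewrite exprn_ge0// ltW.
pose m := mscale (NngNum sn0) (image_measure mu mT).
apply/esym; rewrite (@rV_measure_unique _ _ mu m)//; last first.
  by move=> k; exact: lebesgue_rV_cube_fin.
move=> B mB; rewrite -[RHS]/((s ^+ n)%:E * mu (T @^-1` [set x | forall i, B i (x ord0 i)]))%E.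
have -> : T @^-1` [set x | forall i, B i (x ord0 i)] =
    [set x | forall i, ((fun t => s * t + a ord0 i) @^-1` B i) (x ord0 i)].
  by apply/seteqP; split => x /= xB i; have := xB i; rewrite !mxE.
transitivity (\prod_(i < n) lebesgue_measure (B i))%E; first exact: lebesgue_rV_box.
transitivity ((s ^+ n)%:E *
    \prod_(i < n) lebesgue_measure ((fun t => s * t + a ord0 i)%R @^-1` B i))%E; last first.
  congr (_ * _)%E; apply/esym.
  apply: (lebesgue_rV_box (A := fun i => (fun t => s * t + a ord0 i) @^-1` B i)).
  move=> i; rewrite -[X in measurable X]setTI; move: (mB i).
  apply: continuous_measurable_fun => // x.
  by apply: cvgD; [apply: cvgM => //; exact: cvg_cst|exact: cvg_cst].
rewrite -[X in (s ^+ X)%:E](card_ord n) -prodr_const -prodEFin -big_split/=.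
by apply: eq_bigr => i _; rewrite lebesgue_measure_affine.
Qed.

Lemma lebesgue_rV_translate (a : 'rV[R]_n) (A : set 'rV[R]_n) :
  measurable A -> mu ((fun x => x + a) @^-1` A) = mu A.
Proof.
move=> mA; rewrite -(lebesgue_rV_affine a ltr01 mA) expr1n mul1e.
by congr (mu _); apply/seteqP; split => x /=; rewrite scale1r.
Qed.

Lemma ge0_integral_rV_translate (a : 'rV[R]_n) (f : 'rV[R]_n -> \bar R) :
  measurable_fun setT f -> (forall x, 0 <= f x)%E ->
  (\int[mu]_x f (x + a)%R = \int[mu]_x f x)%E.
Proof.
move=> mf f0.
have mT : measurable_fun setT (fun x : 'rV[R]_n => x + a).
  rewrite (_ : (fun _ => _) = (fun x => 1 *: x + a)); first exact: measurable_affine_rV.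
  by apply/funext => x; rewrite scale1r.
transitivity (\int[image_measure mu mT]_x f x)%E.
  by rewrite (ge0_integral_pushforward mT).
apply: eq_measure_integral => A mA _; exact: lebesgue_rV_translate.
Qed.

Lemma compact_measurable_rV (K : set 'rV[R]_n) : compact K -> measurable K.
Proof.
move=> cK; rewrite -(setCK K); apply: measurableC; apply: open_measurable_rV.
by apply: closed_openC; apply: compact_closed => //; exact: norm_hausdorff.
Qed.

Lemma compact_lebesgue_rV_fin (K : set 'rV[R]_n) : compact K -> (mu K < +oo)%E.
Proof.
move=> cK; have [M [Mreal KM]] := compact_bounded cK.
apply: le_lt_trans (lebesgue_rV_cube_fin (M + 1)).
apply: le_measure; rewrite ?inE.
- exact: compact_measurable_rV.
- apply: (@measurable_box _ _ (fun=> [set t | `|t| <= M + 1])) => i.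
  rewrite (_ : mkset _ = `[- (M + 1), M + 1]%classic); first exact: measurable_itv.
  by apply/seteqP; split => t /=; rewrite in_itv/= ler_norml.
- move=> x Kx i; apply: le_trans (ler_coord_norm x i) _.
  by apply: KM => //; rewrite ltrDl.
Qed.

End affine_lebesgue.

(** One factor of the product vanishes. The dimension is positive here; on R^0 the measure is a
    Dirac mass. *)
Lemma lebesgue_rV_set1 (R : realType) (n : nat) (a : 'rV[R]_n.+1) :
  lebesgue_rV R n.+1 [set a] = 0%E.
Proof.
have -> : [set a] = [set x | forall i, [set a ord0 i] (x ord0 i)].
  apply/seteqP; split => x /=; first by move=> -> i.
  by move=> xa; apply/rowP => i; rewrite xa.
rewrite (lebesgue_rV_box (A := fun i => [set a ord0 i]))//.
by rewrite big_ord_recl lebesgue_measure_set1 mul0e.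
Qed.

(** * Limits and directional derivatives *)

Lemma cvg_rV (R : realType) (n : nat) (T : Type) (F : set_system T) {FF : Filter F}
    (g : T -> 'rV[R]_n) (l : 'rV[R]_n) :
  (forall i, g t ord0 i @[t --> F] --> l ord0 i) -> g @ F --> l.
Proof.
move=> gl A [P lP PA].
have : \forall t \near F, forall i : 'I_n, P ord0 i (g t ord0 i).
  by apply: filter_forall => i; apply: gl; exact: lP.
by apply: filterS => t Pt; apply: PA => i j; rewrite ord1.
Qed.

Lemma continuous_coord (R : realType) (n : nat) (i : 'I_n) :
  continuous (fun x : 'rV[R]_n => x ord0 i).
Proof. exact: (@coord_continuous R 1 n ord0 i). Qed.

(** Turns directional derivatives into derivatives in one real variable, where the chain rule is at
    hand. *)
Lemma is_derive_line (R : realType) (V : normedModType R) (f : V -> R) (x v : V) (d : R) :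
  is_derive x v f d <-> is_derive (0 : R) (1 : R) (fun h => f (h *: v + x)) d.
Proof.
have E : 'D_v f x = 'D_1 (fun h : R => f (h *: v + x)) 0.
  rewrite /derive; set g1 := fun h => h^-1 *: _; set g2 := fun h => h^-1 *: _.
  suff -> : g1 = g2 by [].
  by apply/funext => h; rewrite /g1 /g2 /= addr0 scale0r add0r [_%:A]mulr1.
have [fg gf] := derivable1P f x v.
split => -[df <-].
  by rewrite E; apply: DeriveDef; [exact: fg|reflexivity].
by rewrite -E; apply: DeriveDef; [exact: gf|reflexivity].
Qed.

Lemma is_derive_comp1 (R : realType) (V : normedModType R) (f : V -> R) (g : R -> R)
    (x v : V) (a b : R) :
  is_derive (f x) 1 g a -> is_derive x v f b ->
  is_derive x v (fun y => g (f y)) (a * b).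
Proof.
move=> ga /is_derive_line fb; apply/is_derive_line.
apply: (is_derive1_comp (f := g) (g := fun h => f (h *: v + x))).
by rewrite scale0r add0r.
Qed.

(* At [t <= 0] the value is [0]; for [k = 0] this is the flat function [exp (- 1 / t)],
   and [flat k]' = [flat k.+2 - k * flat k.+1]. *)
Definition flat (R : realType) (k : nat) (t : R) : R :=
  if 0 < t then t ^- k * expR (- t^-1) else 0.

Section flat_function.
Context {R : realType}.
Implicit Types (k : nat) (t : R).

Lemma flat_ge0 k t : 0 <= flat k t.
Proof.
rewrite /flat; case: ifPn => // t0.
by rewrite mulr_ge0 ?expR_ge0// invr_ge0 exprn_ge0// ltW.
Qed.

Lemma flat_gt0 k t : 0 < t -> 0 < flat k t.
Proof.
by move=> t0; rewrite /flat t0 mulr_gt0 ?expR_gt0// invr_gt0 exprn_gt0.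
Qed.

(** The term of order k + 2 in the series of exp (1 / t) gives exp (-1 / t) <= (k + 2)! t^(k + 2).
    The factor t^2 left over makes the derivative at 0 vanish. *)
Lemma flat_le k t : flat k t <= (k.+2)`!%:R * t ^+ 2.
Proof.
rewrite /flat; case: ifPn => [t0|_]; last by rewrite mulr_ge0// sqr_ge0.
have ti0 : 0 < t^-1 by rewrite invr_gt0.
have f0 : 0 < (k.+2)`!%:R :> R by rewrite ltr0n fact_gt0.
have : t^-1 ^+ k.+2 / (k.+2)`!%:R <= expR t^-1.
  by apply: le_trans (expR_ge1Dxn k.+1 (ltW ti0)); rewrite lerDr.
rewrite expRN => h; rewrite ler_pdivrMr ?expR_gt0//.
apply: le_trans (ler_wpM2l _ h); last by rewrite mulr_ge0 ?sqr_ge0.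
rewrite le_eqVlt; apply/orP; left; apply/eqP.
rewrite exprVn !exprS; have t_neq0 := lt0r_neq0 t0.
by field; rewrite expf_neq0 ?t_neq0 ?(lt0r_neq0 f0).
Qed.

Lemma is_derive_flat k t :
  is_derive t 1 (flat k) (flat k.+2 t - k%:R * flat k.+1 t).
Proof.
have [t0|t0|->] := ltgtP t 0.
- rewrite /flat !(lt_gtF t0) mulr0 subr0.
  apply: (@near_eq_is_derive _ _ _ (cst 0)).
  near=> s; have s0 : s < 0 by near: s; exact: lt_nbhsl.
  by rewrite (lt_gtF s0).
- have t_neq0 := lt0r_neq0 t0.
  have e1 : is_derive t 1 (fun s : R => s^-1) (- t ^- 2).
    have := @is_deriveV _ id t 1 1 t_neq0 (is_derive_id t 1).
    by rewrite /= [_ *: _]mulr1; apply.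
  have e2 : is_derive t 1 (fun s : R => expR (- s^-1)) (expR (- t^-1) * - - t ^- 2).
    exact: (is_derive_comp1 (is_derive_expR _) (is_deriveN e1)).
  have tk0 : t ^+ k != 0 by rewrite expf_neq0.
  have e3 : is_derive t 1 (fun s : R => (s ^+ k)^-1)
      (- (t ^+ k) ^- 2 * (k%:R * t ^+ k.-1)).
    have d2 : is_derive t 1 (fun s : R => s ^+ k) (k%:R * t ^+ k.-1).
      apply: DeriveDef; first exact: exprn_derivable.
      by rewrite exp_derive [_ *: _]mulr1.
    exact: (@is_deriveV _ (fun s => s ^+ k) t _ 1 tk0).
  have [h1 h2] := is_deriveM e3 e2.
  have nr : \forall s \near t, (s ^+ k)^-1 * expR (- s^-1) = flat k s.
    near=> s; have s0 : 0 < s by near: s; exact: lt_nbhsr.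
    by rewrite /flat s0.
  apply: (near_eq_is_derive nr); apply: DeriveDef => //; rewrite h2 /flat t0.
  rewrite ![_ *: _]mulrC /=.
  case: k tk0 {e3 h1 h2 nr} => [|k] tk0.
    by rewrite !mul0r !expr0; field.
  rewrite /= !exprS; field.
  by rewrite t_neq0 expf_neq0.
(* At 0 the bound [flat_le] makes the difference quotient at most a constant times |h|. *)
- have -> : flat k.+2 (0 : R) - k%:R * flat k.+1 0 = 0.
    by rewrite /flat ltxx mulr0 subr0.
  have : (fun h : R => h^-1 *: (flat k (h *: 1 + 0) - flat k 0)) @ 0^' --> (0 : R).
    apply/cvgrPdist_le => e e0; near=> h.
    have h0 : h != 0 by near: h; exact: nbhs_dnbhs_neq.
    rewrite sub0r normrN addr0 {2}/flat ltxx subr0 [_ *: 1]mulr1 normrM normfV.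
    rewrite (ger0_norm (flat_ge0 _ _)) mulrC ler_pdivrMr ?normr_gt0//.
    apply: le_trans (flat_le _ _) _.
    rewrite -real_normK ?num_real// expr2 mulrA.
    rewrite ler_wpM2r// mulrC -ler_pdivlMr ?ltr0n ?fact_gt0//.
    near: h; apply: dnbhs0_le; by rewrite divr_gt0// ltr0n fact_gt0.
  move=> h; apply: DeriveDef; first by apply/cvg_ex; exists 0.
  exact: cvg_lim h.
Unshelve. all: by end_near. Qed.

End flat_function.

(** * Smooth functions and test functions *)

Section smooth_functions.
Context {R : realType} {n : nat}.
Implicit Types (f g u v : 'rV[R]_n -> R) (i : 'I_n) (x : 'rV[R]_n).
Local Notation e_ i := (delta_mx ord0 i : 'rV[R]_n).

(* [smooth] speaks of all iterated derivatives at once, so its closure under products,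
   inverses, etc. is obtained from the larger class below, which [pderiv] preserves. *)
Inductive smooth_alg : ('rV[R]_n -> R) -> Prop :=
| smooth_alg_cst c : smooth_alg (fun=> c)
| smooth_alg_coord i : smooth_alg (fun x => x ord0 i)
| smooth_alg_smooth f : smooth f -> smooth_alg f
| smooth_alg_add f g : smooth_alg f -> smooth_alg g -> smooth_alg (fun x => f x + g x)
| smooth_alg_mul f g : smooth_alg f -> smooth_alg g -> smooth_alg (fun x => f x * g x)
| smooth_alg_inv f : smooth_alg f -> (forall x, f x != 0) -> smooth_alg (fun x => (f x)^-1)
| smooth_alg_flat k f : smooth_alg f -> smooth_alg (fun x => flat k (f x)).

Lemma is_derive_coord i (x v : 'rV[R]_n) :
  is_derive x v (fun y : 'rV[R]_n => y ord0 i) (v ord0 i).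
Proof.
apply/is_derive_line.
rewrite (_ : (fun _ => _) = (fun h : R => h * v ord0 i + x ord0 i)); last first.
  by apply/funext => h; rewrite !mxE.
have h1 : is_derive (0 : R) (1 : R) (fun h : R => h * v ord0 i) (v ord0 i).
  have := is_deriveM (is_derive_id (0 : R) 1) (is_derive_cst (v ord0 i) (0 : R) (1 : R)).
  by move=> [d1 d2]; apply: DeriveDef => //; rewrite d2 scale0r add0r [_ *: _]mulr1.
have [d1 d2] := is_deriveD h1 (is_derive_cst (x ord0 i) (0 : R) (1 : R)).
by apply: DeriveDef => //; rewrite d2 addr0.
Qed.

Lemma smooth_alg_derive f : smooth_alg f -> forall i,
  exists2 f', smooth_alg f' & forall x, is_derive x (e_ i) f (f' x).
Proof.
move=> Af i; elim: Af => {f}.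
- move=> c; exists (fun=> 0); first exact: smooth_alg_cst.
  by move=> x; exact: is_derive_cst.
- move=> j; exists (fun=> (e_ i) ord0 j); first exact: smooth_alg_cst.
  by move=> x; exact: is_derive_coord.
- move=> f sf; exists (pderiv i f).
    apply: smooth_alg_smooth => s.
    by have := sf (rcons s i); rewrite /pderivs foldr_rcons.
  by move=> x; apply: DeriveDef => //; have [_ /(_ i x)] := sf [::].
- move=> f g _ [f' Af' df] _ [g' Ag' dg]; exists (fun x => f' x + g' x).
    exact: smooth_alg_add.
  by move=> x; exact: is_deriveD.
- move=> f g Af [f' Af' df] Ag [g' Ag' dg]; exists (fun x => f x * g' x + g x * f' x).
    by apply: smooth_alg_add; exact: smooth_alg_mul.
  by move=> x; exact: is_deriveM.
- move=> f Af [f' Af' df] f0; exists (fun x => (- 1 * ((f x)^-1 * (f x)^-1)) * f' x).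
    apply: smooth_alg_mul => //; apply: smooth_alg_mul; first exact: smooth_alg_cst.
    by apply: smooth_alg_mul; exact: smooth_alg_inv.
  move=> x; apply: (is_derive_comp1 (g := @GRing.inv R) _ (df x)).
  have [d1 d2] := @is_deriveV _ id (f x) 1 1 (f0 x) (is_derive_id (f x) 1).
  apply: DeriveDef => //; rewrite d2 [_ *: _]mulr1 mulN1r; congr (- _).
  by rewrite -expr2 -exprVn.
- move=> k f Af [f' Af' df].
  exists (fun x => (flat k.+2 (f x) + (- k%:R) * flat k.+1 (f x)) * f' x).
    apply: smooth_alg_mul => //; apply: smooth_alg_add; first exact: smooth_alg_flat.
    apply: smooth_alg_mul; first exact: smooth_alg_cst.
    exact: smooth_alg_flat.
  move=> x; apply: (is_derive_comp1 (g := flat k) _ (df x)).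
  by rewrite mulNr; exact: is_derive_flat.
Qed.

Lemma derivable_continuous1 (g : R -> R) t : derivable g t 1 -> {for t, continuous g}.
Proof. by move=> /derivable1_diffP; exact: differentiable_continuous. Qed.

Lemma smooth_alg_continuous f : smooth_alg f -> continuous f.
Proof.
elim=> {f}.
- by move=> c; exact: cst_continuous.
- by move=> i; exact: continuous_coord.
- by move=> f sf; have [] := sf [::].
- by move=> f g _ cf _ cg x; exact: (continuousD (cf x) (cg x)).
- by move=> f g _ cf _ cg x; exact: (continuousM (cf x) (cg x)).
- by move=> f _ cf f0 x; exact: (continuousV (f0 x) (cf x)).
- move=> k f _ cf x; apply: (@continuous_comp _ _ _ f (flat k)); first exact: cf.
  by apply: derivable_continuous1; have [] := is_derive_flat k (f x).
Qed.

Lemma smooth_algP f : smooth_alg f -> smooth f.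
Proof.
move=> Af.
have Ap s : smooth_alg (pderivs s f).
  elim: s => //= i s; move: (pderivs s f) => g Ag.
  have [g' Ag' dg] := smooth_alg_derive Ag i.
  suff -> : pderiv i g = g' by [].
  by apply/funext => x; have [_ <-] := dg x.
move=> s; split; first exact: smooth_alg_continuous.
by move=> i x; have [f' _ /(_ x)[]] := smooth_alg_derive (Ap s) i.
Qed.

Lemma smooth_continuous f : smooth f -> continuous f.
Proof. by move=> sf; have [] := sf [::]. Qed.

Lemma smooth_derivable f i x : smooth f -> derivable f x (e_ i).
Proof. by move=> sf; have [_ ] := sf [::]; exact. Qed.

Lemma smooth_pderivs s f : smooth f -> smooth (pderivs s f).
Proof. by move=> sf t; have := sf (t ++ s); rewrite /pderivs foldr_cat. Qed.

Lemma smooth_pderiv i f : smooth f -> smooth (pderiv i f).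
Proof. exact: (@smooth_pderivs [:: i]). Qed.

Lemma smooth_cst (c : R) : smooth (fun _ : 'rV[R]_n => c).
Proof. exact/smooth_algP/smooth_alg_cst. Qed.

Lemma smooth_coord i : smooth (fun x : 'rV[R]_n => x ord0 i).
Proof. exact/smooth_algP/smooth_alg_coord. Qed.

Lemma smoothD f g : smooth f -> smooth g -> smooth (fun x => f x + g x).
Proof. by move=> sf sg; apply/smooth_algP/smooth_alg_add; exact: smooth_alg_smooth. Qed.

Lemma smoothM f g : smooth f -> smooth g -> smooth (fun x => f x * g x).
Proof. by move=> sf sg; apply/smooth_algP/smooth_alg_mul; exact: smooth_alg_smooth. Qed.

Lemma smoothV f : smooth f -> (forall x, f x != 0) -> smooth (fun x => (f x)^-1).
Proof. by move=> sf f0; apply/smooth_algP/smooth_alg_inv => //; exact: smooth_alg_smooth. Qed.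

Lemma smooth_flat k f : smooth f -> smooth (fun x => flat k (f x)).
Proof. by move=> sf; apply/smooth_algP/smooth_alg_flat; exact: smooth_alg_smooth. Qed.

Lemma smoothB f g : smooth f -> smooth g -> smooth (fun x => f x - g x).
Proof.
move=> sf sg; rewrite (_ : (fun _ => _) = fun x => f x + -1 * g x).
  exact: smoothD sf (smoothM (smooth_cst (-1)) sg).
by apply/funext => x; rewrite mulN1r.
Qed.

Lemma smooth_sum (I : Type) (r : seq I) (F : I -> 'rV[R]_n -> R) :
  (forall j, smooth (F j)) -> smooth (fun x => \sum_(j <- r) F j x).
Proof.
move=> sF; elim: r => [|j r IH].
  rewrite (_ : (fun _ => _) = fun=> 0); first exact: smooth_cst.
  by apply/funext => x; rewrite big_nil.
rewrite (_ : (fun _ => _) = fun x => F j x + \sum_(j <- r) F j x).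
  exact: smoothD (sF j) IH.
by apply/funext => x; rewrite big_cons.
Qed.

Lemma pderivD i f g x : smooth f -> smooth g ->
  pderiv i (fun x => f x + g x) x = pderiv i f x + pderiv i g x.
Proof. by move=> sf sg; rewrite /pderiv deriveD//; exact: smooth_derivable. Qed.

Lemma pderivB i f g x : smooth f -> smooth g ->
  pderiv i (fun x => f x - g x) x = pderiv i f x - pderiv i g x.
Proof. by move=> sf sg; rewrite /pderiv deriveB//; exact: smooth_derivable. Qed.

Lemma pderivM i f g x : smooth f -> smooth g ->
  pderiv i (fun x => f x * g x) x = f x * pderiv i g x + g x * pderiv i f x.
Proof. by move=> sf sg; rewrite /pderiv deriveM//; exact: smooth_derivable. Qed.

Lemma pderivs_subr s f g : smooth f -> smooth g ->
  pderivs s (f \- g) = pderivs s f \- pderivs s g.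
Proof.
move=> sf sg; elim: s => //= i s ->; apply/funext => x /=.
exact: pderivB (smooth_pderivs s sf) (smooth_pderivs s sg).
Qed.

(** Heine-Borel in both directions; supports are handled below through a radius in the sup norm. *)
Lemma test_functionP f : test_function f <->
  smooth f /\ exists M : R, forall x, M < `|x| -> f x = 0.
Proof.
split=> -[sf].
  move=> cf; split => //; have [M [_ fM]] := compact_bounded cf.
  exists (M + 1) => x Mx; apply/eqP; apply: contraT => fx.
  have : `|x| <= M + 1 by apply: fM; [rewrite ltrDl|exact: subset_closure].
  by rewrite leNgt Mx.
move=> [M fM]; split => //; apply: bounded_closed_compact; last exact: closed_closure.
exists M; split; first exact: num_real.
move=> N MN x.
have : closed [set x : 'rV[R]_n | `|x| <= N].
  apply: (@closed_comp _ _ (fun x : 'rV[R]_n => `|x|) [set t | t <= N]).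
    by move=> y _; exact: norm_continuous.
  exact: closed_le.
move=> /closure_id; rewrite -/(mkset _ x) => E cx.
suff : [set x : 'rV[R]_n | `|x| <= N] x by [].
rewrite E; move: cx; apply: closure_subset => y /= fy.
rewrite leNgt; apply/negP => Ny; move: fy; rewrite fM ?eqxx//.
exact: lt_trans Ny.
Qed.

Lemma test_smooth f : test_function f -> smooth f.
Proof. by case. Qed.

Lemma test_vanish f : test_function f -> exists2 M : R, 0 < M & forall x, M < `|x| -> f x = 0.
Proof.
move=> /test_functionP[_ [M fM]]; exists (Num.max M 1); first by rewrite lt_max ltr01 orbT.
by move=> x; rewrite gt_max => /andP[+ _]; exact: fM.
Qed.

Lemma test_pderiv i f : test_function f -> test_function (pderiv i f).
Proof.
move=> /test_functionP[sf [M fM]]; apply/test_functionP; split.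
  exact: smooth_pderiv.
exists M => x Mx; rewrite /pderiv -[RHS](@derive_cst R _ _ (0 : R) x (e_ i)).
apply: near_eq_derive; near=> y; apply: fM; near: y.
have : open [set y : 'rV[R]_n | M < `|y|].
  apply: (@open_comp _ _ (fun x : 'rV[R]_n => `|x|) [set t | M < t]).
    by move=> y _; exact: norm_continuous.
  exact: open_gt.
by move=> oM; exact: open_nbhs_nbhs.
Unshelve. all: by end_near. Qed.

Lemma test_pderivs s f : test_function f -> test_function (pderivs s f).
Proof. by move=> tf; elim: s => //= i s; exact: test_pderiv. Qed.

Lemma testMl f g : smooth f -> test_function g -> test_function (fun x => f x * g x).
Proof.
move=> sf /test_functionP[sg [M gM]]; apply/test_functionP; split; first exact: smoothM.
by exists M => x /gM ->; rewrite mulr0.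
Qed.

Lemma testD f g : test_function f -> test_function g -> test_function (fun x => f x + g x).
Proof.
move=> tf tg; apply/test_functionP.
split; first by apply: smoothD; exact: test_smooth.
have [M M0 fM] := test_vanish tf; have [N N0 gN] := test_vanish tg.
exists (Num.max M N) => x; rewrite gt_max => /andP[/fM -> /gN ->].
by rewrite addr0.
Qed.

Lemma testB f g : test_function f -> test_function g -> test_function (f \- g).
Proof.
move=> tf tg; rewrite (_ : _ \- _ = fun x => f x + -1 * g x).
  exact: testD tf (testMl (smooth_cst (-1)) tg).
by apply/funext => x /=; rewrite mulN1r.
Qed.

Lemma test0 : test_function (fun _ : 'rV[R]_n => 0 : R).
Proof. by apply/test_functionP; split; [exact: smooth_cst|exists 0]. Qed.

Lemma test_sum (I : Type) (r : seq I) (F : I -> 'rV[R]_n -> R) :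
  (forall j, test_function (F j)) -> test_function (fun x => \sum_(j <- r) F j x).
Proof.
move=> tF; elim: r => [|j r IH].
  rewrite (_ : (fun _ => _) = fun=> 0); first exact: test0.
  by apply/funext => x; rewrite big_nil.
rewrite (_ : (fun _ => _) = fun x => F j x + \sum_(j <- r) F j x).
  exact: testD.
by apply/funext => x; rewrite big_cons.
Qed.

Lemma test_laplacian f : test_function f -> test_function (laplacian f).
Proof. by move=> tf; apply: (@test_sum _ _ (fun i => pderivs [:: i; i] f)) => i; exact: test_pderivs. Qed.

Lemma test_bounded f : test_function f -> exists2 C : R, 0 < C & forall x, `|f x| <= C.
Proof.
move=> tf; have [M M0 fM] := test_vanish tf.
have cB : compact [set x : 'rV[R]_n | `|x| <= M].
  apply: bounded_closed_compact.
    by exists M; split; [exact: num_real|move=> N MN x /= xM; exact: le_trans (ltW MN)].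
  apply: (@closed_comp _ _ (fun x : 'rV[R]_n => `|x|) [set t | t <= M]).
    by move=> y _; exact: norm_continuous.
  exact: closed_le.
have B0 : [set x : 'rV[R]_n | `|x| <= M] !=set0 by exists 0; rewrite /= normr0 ltW.
have cf : continuous (fun x => `|f x|).
  move=> x; apply: (@continuous_comp _ _ _ f (fun t : R => `|t|)).
    exact: smooth_continuous (test_smooth tf) x.
  exact: norm_continuous.
have [c _ fc] := EVT_max_rV B0 cB (continuous_subspaceT cf).
exists (`|f c| + 1); first by rewrite ltr_wpDl.
move=> x; have [xM|Mx] := leP `|x| M.
  by apply: le_trans (fc x _) _; rewrite ?inE// lerDl.
by rewrite fM// normr0 addr_ge0.
Qed.

Lemma smooth_sqr_sum : smooth (fun x : 'rV[R]_n => \sum_(i < n) x ord0 i ^+ 2).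
Proof.
apply: smooth_sum => i.
rewrite (_ : (fun _ => _) = fun x : 'rV[R]_n => x ord0 i * x ord0 i).
  by apply: smoothM; exact: smooth_coord.
by apply/funext => x; rewrite expr2.
Qed.

(** The function exp (-1 / (1 - |x|^2)) extended by 0. It later shows that the set of Sobolev
    quotients is nonempty. *)
Lemma test_bump : test_function (fun x : 'rV[R]_n => flat 0 (1 - \sum_(i < n) x ord0 i ^+ 2)).
Proof.
apply/test_functionP; split.
  by apply/smooth_flat/smoothB; [exact: smooth_cst|exact: smooth_sqr_sum].
exists 1 => x x1; rewrite /flat ifF//; apply/negbTE; rewrite -leNgt subr_le0.
(* A sup norm above 1 comes from a single coordinate, which alone makes the sum of squares at least
   1. *)
have [i xi] : exists i : 'I_n, 1 < `|x ord0 i|.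
  apply: contrapT => /forallNP xi; move: x1; apply/negP; rewrite -leNgt.
  rewrite [X in X <= _]/Num.norm /= mx_normrE.
  apply: bigmax_le => // -[a i] _ /=; rewrite ord1 leNgt; exact/negP.
rewrite (bigD1 i)//= -[leLHS]addr0 lerD//; last by apply: sumr_ge0 => j _; exact: sqr_ge0.
by rewrite -real_normK ?num_real// exprn_ege1// ltW.
Qed.

End smooth_functions.

(** * Integration by parts *)

Section test_integrals.
Context {R : realType} {n : nat}.
Local Notation mu := (lebesgue_rV R n).
Implicit Types (f g u : 'rV[R]_n -> R).

Lemma compact_sup_ball (M : R) : compact [set x : 'rV[R]_n | `|x| <= M].
Proof.
apply: bounded_closed_compact.
  by exists M; split; [exact: num_real|move=> N MN x /= xM; exact: le_trans (ltW MN)].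
apply: (@closed_comp _ _ (fun x : 'rV[R]_n => `|x|) [set t | t <= M]).
  by move=> y _; exact: norm_continuous.
exact: closed_le.
Qed.

Lemma measurable_sup_ball (M : R) : measurable [set x : 'rV[R]_n | `|x| <= M].
Proof. exact: (compact_measurable_rV (@compact_sup_ball M)). Qed.

Lemma continuous_compact_bounded f (M : R) : continuous f ->
  exists2 C : R, 0 < C & forall x, `|x| <= M -> `|f x| <= C.
Proof.
move=> cf; have [M0|M0] := ltP M 0.
  by exists 1 => // x xM; have := lt_le_trans (le_lt_trans xM M0) (normr_ge0 x); rewrite ltxx.
have cB := @compact_sup_ball M.
have B0 : [set x : 'rV[R]_n | `|x| <= M] !=set0 by exists 0; rewrite /= normr0.
have cnf : continuous (fun x => `|f x|).
  move=> x; apply: (@continuous_comp _ _ _ f (fun t : R => `|t|)); first exact: cf.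
  exact: norm_continuous.
have [c _ fc] := EVT_max_rV B0 cB (continuous_subspaceT cnf).
exists (`|f c| + 1); first by rewrite ltr_wpDl.
by move=> x xM; apply: le_trans (fc x _) _; rewrite ?inE// lerDl.
Qed.

(** On the cube outside which [f] vanishes, [f] is bounded, so the product is dominated by a
    multiple of [u] restricted to a compact set. *)
Lemma loc_integrable_mul u f (M : R) : loc_integrable u -> continuous f ->
  (forall x, M < `|x| -> f x = 0) -> mu.-integrable setT (fun x => (u x * f x)%:E).
Proof.
move=> [mu_ iu] cf fM; have [C C0 fC] := continuous_compact_bounded M cf.
apply/integrableP; split.
  by apply/measurable_EFinP; apply: measurable_funM => //; exact: continuous_measurable_rV.
set B := [set x : 'rV[R]_n | `|x| <= M].
have mB : measurable B := measurable_sup_ball M.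
apply: (@le_lt_trans _ _ (\int[mu]_(x in B) (C%:E * `|(u x)%:E|))%E).
  rewrite [leRHS]integral_mkcond; apply: ge0_le_integral => //.
  - by apply: measurableT_comp => //; apply/measurable_EFinP; apply: measurable_funM => //;
      exact: continuous_measurable_rV.
  - apply/(measurable_restrictT _ mB); apply: measurable_funTS.
    apply: emeasurable_funM; first exact: measurable_cst.
    by apply: measurableT_comp => //; exact/measurable_EFinP.
  - move=> x _; rewrite patchE; case: ifPn => [|/negP xB].
      rewrite inE => /fC fx; rewrite abse_EFin -EFinM lee_fin normrM mulrC.
      by rewrite ler_wpM2r.
    by rewrite fM ?mulr0 ?normr0//= ?normr0// ltNge; apply/negP => xM; apply: xB; rewrite inE.
rewrite ge0_integralZl//; last 2 first.
- by apply: measurable_funTS; apply: measurableT_comp => //; exact/measurable_EFinP.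
- by rewrite lee_fin ltW.
by rewrite lte_mul_pinfty// ?lee_fin ?(ltW C0)//; apply: iu; exact: compact_sup_ball.
Qed.

Lemma continuous_loc_integrable f : continuous f -> loc_integrable f.
Proof.
move=> cf; split; first exact: continuous_measurable_rV.
move=> K cK; have [M [_ KM]] := compact_bounded cK.
have [C C0 fC] := continuous_compact_bounded (M + 1) cf.
apply: le_lt_trans (integral_le_bound C%:E _ _ _ _) _.
- exact: compact_measurable_rV.
- by apply: measurable_funTS; apply/measurable_EFinP; exact: continuous_measurable_rV.
- by rewrite lee_fin ltW.
- apply: aeW => x Kx; rewrite lee_fin; apply: fC; apply: KM => //.
  by rewrite ltrDl.
- by rewrite lte_mul_pinfty// ?lee_fin ?(ltW C0)//; exact: compact_lebesgue_rV_fin.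
Qed.

Lemma continuous_integrable f (M : R) : continuous f ->
  (forall x, M < `|x| -> f x = 0) -> mu.-integrable setT (EFin \o f).
Proof.
move=> cf fM.
have := loc_integrable_mul (continuous_loc_integrable (@cst_continuous _ _ (1 : R))) cf fM.
by apply: eq_integrable => // x _ /=; rewrite mul1r.
Qed.

Lemma test_integrable f : test_function f -> mu.-integrable setT (EFin \o f).
Proof.
move=> tf; have [M _ fM] := test_vanish tf.
by apply: continuous_integrable fM; exact/smooth_continuous/test_smooth.
Qed.

Lemma pderiv_vanish (i : 'I_n) f (M : R) : (forall x, M < `|x| -> f x = 0) ->
  forall x, M < `|x| -> pderiv i f x = 0.
Proof.
move=> fM x Mx; rewrite /pderiv -[RHS](@derive_cst R _ _ (0 : R) x (delta_mx ord0 i)).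
apply: near_eq_derive; near=> y; apply: fM; near: y.
have : open [set y : 'rV[R]_n | M < `|y|].
  apply: (@open_comp _ _ (fun x : 'rV[R]_n => `|x|) [set t | M < t]).
    by move=> y _; exact: norm_continuous.
  exact: open_gt.
by move=> oM; exact: open_nbhs_nbhs.
Unshelve. all: by end_near. Qed.

End test_integrals.

(** * Slices in the first coordinate *)

Section slices.
Context {R : realType} {n : nat}.
Local Notation cons_ a y := (rV_cons ((a : measurableTypeR R), (y : 'rV[R]_n))).

Lemma rV_cons0 a y : (cons_ a y) ord0 ord0 = a.
Proof. by rewrite mxE unlift_none. Qed.

Lemma rV_consS a y j : (cons_ a y) ord0 (lift ord0 j) = y ord0 j.
Proof. by rewrite mxE liftK. Qed.

Lemma rV_cons_line0 (h a : R) y :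
  cons_ (h *: 1 + a) y = h *: delta_mx ord0 ord0 + cons_ a y.
Proof.
apply/rowP => i; rewrite [RHS]mxE; case: (unliftP ord0 i) => [j ->|->].
  by rewrite !rV_consS !mxE eqxx/= mulr0 add0r.
by rewrite !rV_cons0 !mxE !eqxx.
Qed.

Lemma rV_cons_lineS (h a : R) y (j : 'I_n) :
  cons_ a (h *: delta_mx ord0 j + y) = h *: delta_mx ord0 (lift ord0 j) + cons_ a y.
Proof.
apply/rowP => i; rewrite [RHS]mxE; case: (unliftP ord0 i) => [k ->|->].
  by rewrite !rV_consS !mxE (inj_eq lift_inj).
by rewrite !rV_cons0 !mxE eqxx (negbTE (neq_lift _ _)) mulr0 add0r.
Qed.

Lemma is_derive_slice0 (f : 'rV[R]_n.+1 -> R) (a : R) y (d : R) :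
  is_derive (cons_ a y) (delta_mx ord0 ord0) f d ->
  is_derive a 1 (fun b : R => f (cons_ b y)) d.
Proof.
move=> /is_derive_line; under eq_fun do rewrite -rV_cons_line0.
by move=> /(is_derive_line (fun b : R => f (cons_ b y))).
Qed.

Lemma is_derive_sliceS (f : 'rV[R]_n.+1 -> R) (a : R) y (j : 'I_n) (d : R) :
  is_derive (cons_ a y) (delta_mx ord0 (lift ord0 j)) f d ->
  is_derive y (delta_mx ord0 j) (fun z => f (cons_ a z)) d.
Proof.
move=> /is_derive_line; under eq_fun do rewrite -rV_cons_lineS.
by move=> /(is_derive_line (fun z => f (cons_ a z))).
Qed.

Lemma continuous_rV_cons1 y : continuous (fun a : R => cons_ a y).
Proof.
move=> a; apply: (@cvg_rV _ _ _ (nbhs a)) => i; case: (unliftP ord0 i) => [k ->|->].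
  by rewrite rV_consS; under eq_fun do rewrite rV_consS; exact: cvg_cst.
by rewrite rV_cons0; under eq_fun do rewrite rV_cons0; exact: cvg_id.
Qed.

Lemma continuous_rV_cons2 (a : R) : continuous (fun y => cons_ a y).
Proof.
move=> y; apply: (@cvg_rV _ _ _ (nbhs y)) => i; case: (unliftP ord0 i) => [k ->|->].
  rewrite rV_consS; under eq_fun do rewrite rV_consS; exact: continuous_coord.
by rewrite rV_cons0; under eq_fun do rewrite rV_cons0; exact: cvg_cst.
Qed.

Lemma rV_cons_norm1 (a : R) y : `|a| <= `|cons_ a y|.
Proof. by rewrite -{1}[a](rV_cons0 a y) ler_coord_norm. Qed.

Lemma rV_cons_norm2 (a : R) y : `|y| <= `|cons_ a y|.
Proof.
rewrite [X in X <= _]/Num.norm /= mx_normrE.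
apply: bigmax_le => // -[k i] _ /=; rewrite ord1 -(rV_consS a y).
exact: ler_coord_norm.
Qed.

(** [lebesgueS] is a pushforward along [rV_cons], so this is a change of variables. It makes
    Fubini's theorem available to inductions on the dimension. *)
Lemma integral_lebesgueS (f : 'rV[R]_n.+1 -> R) :
  (lebesgue_rV R n.+1).-integrable setT (EFin \o f) ->
  ((lebesgue_measure : set (measurableTypeR R) -> \bar R) \x lebesgue_rV R n)%E.-integrable
     setT (fun p => (f (rV_cons p))%:E) /\
  (\int[lebesgue_rV R n.+1]_x (f x)%:E =
   \int[(lebesgue_measure \x lebesgue_rV R n)%E]_p (f (rV_cons p))%:E)%E.
Proof.
move=> /[dup] fi /integrableP[mf foo].
have fi' : ((lebesgue_measure : set (measurableTypeR R) -> \bar R) \x lebesgue_rV R n)%E.-integrable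
     setT (fun p => (f (rV_cons p))%:E).
  apply/integrableP; split.
    exact: (measurableT_comp mf (@measurable_rV_cons R n)).
  move: foo; rewrite /= /lebesgueS (ge0_integral_pushforward (@measurable_rV_cons R n))//.
  by apply/measurable_EFinP; apply: measurableT_comp => //; exact/measurable_EFinP.
split => //.
by rewrite /= /lebesgueS (integral_pushforward (@measurable_rV_cons R n)).
Qed.

End slices.

Section integration_by_parts_1d.
Context {R : realType}.

Lemma integral_derive1_0 (F f : R -> R) (M : R) :
  (forall t : R, is_derive t 1 F (f t)) -> continuous f ->
  (forall t : R, M < `|t| -> F t = 0) ->
  (\int[lebesgue_measure]_(t in [set: measurableTypeR R]) (f t)%:E = 0)%E.
Proof.
(* The interval [-N, N] is nondegenerate and [F] vanishes at both ends. *)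
move=> dF cf FM; pose N : R := `|M| + 1.
have N0 : 0 < N by rewrite ltr_wpDl.
have MN : M < N by rewrite (le_lt_trans (ler_norm M))// ltrDl.
have fM t : N < `|t| -> f t = 0.
  move=> Nt; have [_ <-] := dF t.
  rewrite -(@derive1_cst R R (0 : R) t) derive1E.
  apply: near_eq_derive; near=> y; apply: FM; near: y.
  have : open [set y : R | M < `|y|].
    apply: (@open_comp _ _ (fun x : R => `|x|) [set t | M < t]).
      by move=> y _; exact: norm_continuous.
    exact: open_gt.
  by move=> oM; apply: open_nbhs_nbhs; split => //=; exact: lt_trans Nt.
have cF : continuous F.
  by move=> t; apply: derivable_continuous1; have [] := dF t.
transitivity (\int[lebesgue_measure]_(t in `[(- N)%R, N%R]) (f t)%:E)%E.
  rewrite [RHS]integral_mkcond; apply: eq_integral => t _.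
  rewrite patchE; case: ifPn => // /negP; rewrite inE/= in_itv/= -ler_norml => tN.
  by rewrite fM// ltNge; exact/negP.
rewrite (@continuous_FTC2 _ f F).
- by rewrite !FM ?subee// ?normrN gtr0_norm.
- by rewrite gtrN.
- exact: continuous_subspaceT.
- split.
  + by move=> t _; have [] := dF t.
  + exact/cvg_at_right_filter/cF.
  + exact/cvg_at_left_filter/cF.
- by move=> t _; rewrite derive1E; have [_ ->] := dF t.
Unshelve. all: by end_near. Qed.

End integration_by_parts_1d.

(** Induction on the dimension by Fubini. For the first coordinate the inner integral is
    one-dimensional; for any other one the slice in the remaining variables falls under the
    induction hypothesis. The assumptions on derivatives concern the direction [i] alone, so that
    slices inherit them. *)
Lemma integral_pderiv0 (R : realType) (n : nat) (i : 'I_n) (f : 'rV[R]_n -> R) (M : R) :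
  (forall x, derivable f x (delta_mx ord0 i)) -> continuous (pderiv i f) ->
  (forall x, M < `|x| -> f x = 0) ->
  (\int[lebesgue_rV R n]_x (pderiv i f x)%:E = 0)%E.
Proof.
elim: n i f => [[]//|n IH] i f df cf fM.
have iP : (lebesgue_rV R n.+1).-integrable setT (EFin \o pderiv i f).
  by apply: (@continuous_integrable _ _ _ M cf); exact: pderiv_vanish.
have [iP2 ->] := integral_lebesgueS iP.
case: (unliftP ord0 i) => [j ij|i0]; subst i.
  have dj a y : is_derive y (delta_mx ord0 j)
      (fun z => f (rV_cons (a : measurableTypeR R, z)))
      (pderiv (lift ord0 j) f (rV_cons (a : measurableTypeR R, y))).
    by apply: is_derive_sliceS; exact/derivableP.
  rewrite -integral12_prod_meas1//=; apply: integral0_eq => a _.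
  transitivity (\int[lebesgue_rV R n]_y
      (pderiv j (fun y => f (rV_cons (a : measurableTypeR R, y))) y)%:E)%E.
    by apply: eq_integral => y _; congr EFin; have [_ <-] := dj a y.
  apply: IH => [y||y My].
  - by have [] := dj a y.
  - rewrite (_ : pderiv j _ = pderiv (lift ord0 j) f \o
        (fun y => rV_cons (a : measurableTypeR R, y))).
      by move=> y; apply: continuous_comp; [exact: continuous_rV_cons2|exact: cf].
    by apply/funext => y /=; have [_ <-] := dj a y.
  - by apply: fM; exact: lt_le_trans My (rV_cons_norm2 _ _).
rewrite -integral21_prod_meas1//=; apply: integral0_eq => y _.
apply: (@integral_derive1_0 _ (fun a => f (rV_cons (a : measurableTypeR R, y))) _ M).
- by move=> a; apply: is_derive_slice0; exact/derivableP.
- move=> a; apply: (@continuous_comp _ _ _ (fun a : R => rV_cons (a : measurableTypeR R, y))).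
    exact: continuous_rV_cons1.
  exact: cf.
- by move=> a aM; apply: fM; exact: lt_le_trans aM (rV_cons_norm1 _ _).
Qed.

Section weak_derivatives_of_test_functions.
Context {R : realType} {n : nat}.
Local Notation mu := (lebesgue_rV R n).
Implicit Types (f g u : 'rV[R]_n -> R) (a : 'rV[R]_n).

Lemma bounded_vanish_integrable f (C M : R) : measurable_fun setT f ->
  (forall x, `|f x| <= C) -> (forall x, M < `|x| -> f x = 0) ->
  mu.-integrable setT (EFin \o f).
Proof.
move=> mf fC fM.
have mB : measurable [set x : 'rV[R]_n | `|x| <= M] := measurable_sup_ball M.
have : mu.-integrable [set x : 'rV[R]_n | `|x| <= M] (EFin \o f).
  apply: measurable_bounded_integrable => //.
  - exact/compact_lebesgue_rV_fin/compact_sup_ball.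
  - exact: measurable_funTS.
  - exists C; split; first exact: num_real.
    by move=> N CN x _; apply: le_trans (fC x) (ltW CN).
move=> /(integrable_mkcond _ mB); apply: eq_integrable => // x _.
rewrite patchE; case: ifPn => // /negP; rewrite inE/= => xM.
by rewrite /= fM// ltNge; exact/negP.
Qed.

Lemma test_mul_integrable f g : smooth f -> test_function g ->
  mu.-integrable setT (EFin \o (fun x => f x * g x)).
Proof. by move=> sf tg; apply: test_integrable; exact: testMl. Qed.

Lemma integral_by_parts i f g : smooth f -> test_function g ->
  \int[mu]_x (f x * pderiv i g x) = - \int[mu]_x (pderiv i f x * g x).
Proof.
move=> sf tg; have [M _ gM] := test_vanish tg.
have tfg := testMl sf tg.
have : \int[mu]_x (f x * pderiv i g x + pderiv i f x * g x) = 0.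
  rewrite /Rintegral; transitivity (fine (\int[mu]_x (pderiv i (fun x => f x * g x) x)%:E)%E).
    congr fine; apply: eq_integral => x _; rewrite (pderivM i x sf (test_smooth tg)).
    by rewrite (mulrC (g x)).
  rewrite (@integral_pderiv0 _ _ _ _ M)//.
  - by move=> x; apply: smooth_derivable; exact: test_smooth.
  - by apply: smooth_continuous; apply: smooth_pderiv; exact: test_smooth.
  - by move=> x /gM ->; rewrite mulr0.
rewrite RintegralD//.
- by move=> /eqP; rewrite addr_eq0 => /eqP.
- exact: test_mul_integrable sf (test_pderiv i tg).
- exact: test_mul_integrable (smooth_pderiv i sf) tg.
Qed.

Lemma test_weak_deriv1 i f : test_function f -> is_weak_deriv [:: i] f (pderiv i f).
Proof.
move=> tf; split.
- exact/continuous_loc_integrable/smooth_continuous/test_smooth.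
- exact/continuous_loc_integrable/smooth_continuous/test_smooth/test_pderiv.
- by move=> g tg; rewrite integral_by_parts//= ?expr1 ?mulN1r//; exact: test_smooth.
Qed.

Lemma test_weak_deriv2 i f : test_function f ->
  is_weak_deriv [:: i; i] f (pderivs [:: i; i] f).
Proof.
move=> tf; split.
- exact/continuous_loc_integrable/smooth_continuous/test_smooth.
- exact/continuous_loc_integrable/smooth_continuous/test_smooth/test_pderivs.
- move=> g tg; rewrite integral_by_parts//=; [|exact: test_smooth|exact: test_pderiv].
  rewrite integral_by_parts//; last exact/test_smooth/test_pderiv.
  by rewrite opprK sqrrN expr1n mul1r.
Qed.

Lemma test_weak_grad f : test_function f -> is_weak_grad f (fun i => pderiv i f).
Proof. by move=> tf i; exact: test_weak_deriv1. Qed.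

Lemma test_weak_laplacian f : test_function f -> is_weak_laplacian f (laplacian f).
Proof.
move=> tf; exists (fun i => pderivs [:: i; i] f) => // i; exact: test_weak_deriv2.
Qed.

Lemma pderiv_translate i f a : pderiv i (fun x => f (x + a)) = (fun x => pderiv i f (x + a)).
Proof.
apply/funext => x; rewrite /pderiv /derive.
by under eq_fun do rewrite /= -addrA.
Qed.

Lemma pderivs_translate s f a :
  pderivs s (fun x => f (x + a)) = (fun x => pderivs s f (x + a)).
Proof. by elim: s => //= i s ->; rewrite pderiv_translate. Qed.

Lemma test_translate f a : test_function f -> test_function (fun x => f (x + a)).
Proof.
move=> /test_functionP[sf [M fM]]; apply/test_functionP; split.
  move=> s; rewrite pderivs_translate; have [cf df] := sf s; split.
    move=> x; apply: (@continuous_comp 'rV[R]_n 'rV[R]_n R (fun x => x + a)).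
      by apply: (@continuousD R 'rV[R]_n 'rV[R]_n id (cst a)); [exact: cvg_id|exact: cst_continuous].
    exact: cf.
  move=> i x; have := df i (x + a); rewrite /derivable.
  by under eq_fun do rewrite /= addrA.
exists (M + `|a|) => x Mx; apply: fM.
have : `|x| <= `|x + a| + `|a|.
  by rewrite -{1}[x](addrK a) (le_trans (ler_normB _ _)).
by move/(lt_le_trans Mx); rewrite ltrD2r.
Qed.

Lemma laplacian_translate f a :
  laplacian (fun x => f (x + a)) = (fun x => laplacian f (x + a)).
Proof.
apply/funext => x; rewrite /laplacian; apply: eq_bigr => i _.
by rewrite pderivs_translate.
Qed.

Lemma test_D22 f : (5 <= n)%N -> test_function f -> D22 f.
Proof.
move=> n5 tf; split.
  by apply: continuous_measurable_rV; apply: smooth_continuous; exact: test_smooth.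
exists (fun=> f); split => //.
  move=> e e0; exists 0%N => k m _ _.
  rewrite /D22_norm2 big1// => i _; rewrite big1// => j _.
  have sf := test_smooth tf.
  rewrite pderivs_subr//= -[RHS](mul0r (fine (mu setT))) -Rintegral_cst//.
  by apply: eq_Rintegral => x _; rewrite subrr expr0n.
apply: cvg_near_cst; apply: nearW => k; apply: integral0_eq => x _.
rewrite subrr normr0 powR0//.
(* The power 0 to the 0 is 1, so the integrand vanishes only if the critical exponent is nonzero; n
   > 4 ensures this. *)
have n4 : (4 : R) < n%:R by rewrite ltr_nat.
by rewrite mulf_neq0 ?invr_neq0 ?mulf_neq0// ?gt_eqF// ?subr_gt0// (lt_trans _ n4).
Qed.

End weak_derivatives_of_test_functions.

(** * Hardy and Rellich inequalities *)

Section hardy.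
Context {R : realType} {n : nat}.
Local Notation mu := (lebesgue_rV R n).
Implicit Types (f : 'rV[R]_n -> R) (x : 'rV[R]_n).

(* A smooth substitute for [|x|^-2], to which it increases as [e] decreases to [0]. *)
Definition regw (e : R) x : R := (\sum_(i < n) x ord0 i ^+ 2 + e)^-1.

Definition grad2 f x : R := \sum_(i < n) pderiv i f x ^+ 2.

Lemma sqr_sum_ge0 x : 0 <= \sum_(i < n) x ord0 i ^+ 2.
Proof. by apply: sumr_ge0 => i _; exact: sqr_ge0. Qed.

Lemma grad2_ge0 f x : 0 <= grad2 f x.
Proof. by apply: sumr_ge0 => i _; exact: sqr_ge0. Qed.

Lemma enorm_ge0 x : 0 <= enorm x.
Proof. exact: sqrtr_ge0. Qed.

Lemma sqr_enorm x : enorm x ^+ 2 = \sum_(i < n) x ord0 i ^+ 2.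
Proof. by rewrite sqr_sqrtr// sqr_sum_ge0. Qed.

Lemma regw_den_gt0 e x : 0 < e -> 0 < \sum_(i < n) x ord0 i ^+ 2 + e.
Proof. by move=> e0; rewrite ltr_wpDl// sqr_sum_ge0. Qed.

Lemma regw_gt0 e x : 0 < e -> 0 < regw e x.
Proof. by move=> e0; rewrite invr_gt0 regw_den_gt0. Qed.

Lemma smooth_regw e : 0 < e -> smooth (regw e).
Proof.
move=> e0; apply: smoothV; last by move=> x; rewrite gt_eqF// regw_den_gt0.
by apply: smoothD; [exact: smooth_sqr_sum|exact: smooth_cst].
Qed.

Lemma smoothX f k : smooth f -> smooth (fun x => f x ^+ k).
Proof.
move=> sf; elim: k => [|k IH].
  by rewrite (_ : (fun _ => _) = fun=> 1); [exact: smooth_cst|apply/funext => x; rewrite expr0].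
rewrite (_ : (fun _ => _) = fun x => f x * f x ^+ k); first exact: smoothM.
by apply/funext => x; rewrite exprS.
Qed.

Lemma pderiv_sqr_sum i x : pderiv i (fun y : 'rV[R]_n => \sum_(j < n) y ord0 j ^+ 2) x = 2 * x ord0 i.
Proof.
have h (j : 'I_n) : is_derive x (delta_mx ord0 i : 'rV[R]_n)
    (fun y : 'rV[R]_n => y ord0 j ^+ 2) (2 * x ord0 j * (i == j)%:R).
  have := is_derive_coord j x (delta_mx ord0 i).
  rewrite mxE eqxx /= eq_sym => dj.
  apply: (is_derive_comp1 (g := fun t : R => t ^+ 2) _ dj).
  apply: DeriveDef; first exact: exprn_derivable.
  by rewrite exp_derive [_ *: _]mulr1 expr1.
pose F (j : 'I_n) (y : 'rV[R]_n) := y ord0 j ^+ 2.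
have -> : (fun y : 'rV[R]_n => \sum_(j < n) y ord0 j ^+ 2) = \sum_(j < n) F j.
  by rewrite fct_sumE.
rewrite /pderiv (derive_sum (h := F)) => [|j]; last by have [] := h j.
rewrite (bigD1 i)//= big1 => [|j ji].
  by have [_ ->] := h i; rewrite eqxx mulr1 addr0.
by have [_ ->] := h j; rewrite eq_sym (negbTE ji) mulr0.
Qed.

Lemma pderiv_regw i e x : 0 < e -> pderiv i (regw e) x = - 2 * x ord0 i * regw e x ^+ 2.
Proof.
move=> e0; have sq : smooth (fun y : 'rV[R]_n => \sum_(j < n) y ord0 j ^+ 2 + e).
  by apply: smoothD; [exact: smooth_sqr_sum|exact: smooth_cst].
have := @smooth_derivable _ _ _ i x sq => /derivableP dsq.
have dn0 : \sum_(j < n) x ord0 j ^+ 2 + e != 0 by rewrite gt_eqF// regw_den_gt0.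
pose den (y : 'rV[R]_n) := \sum_(j < n) y ord0 j ^+ 2 + e.
have inv' : is_derive (den x) 1 (@GRing.inv R) (- den x ^- 2).
  have [d1 d2] := @is_deriveV _ id (den x) 1 1 dn0 (is_derive_id (den x) 1).
  by apply: DeriveDef => //; rewrite d2 [_ *: _]mulr1.
have [_] := is_derive_comp1 inv' dsq.
rewrite /pderiv => ->; rewrite -/(pderiv i den x) /den.
rewrite pderivD; [|exact: smooth_sqr_sum|exact: smooth_cst].
by rewrite pderiv_sqr_sum /pderiv derive_cst addr0 /regw exprVn; ring.
Qed.

Lemma pderivX i f k x : smooth f ->
  pderiv i (fun y => f y ^+ k) x = k%:R * f x ^+ k.-1 * pderiv i f x.
Proof.
move=> sf; have /derivableP df := @smooth_derivable _ _ _ i x sf.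
have dk : is_derive (f x) 1 (fun t : R => t ^+ k) (k%:R * f x ^+ k.-1).
  apply: DeriveDef; first exact: exprn_derivable.
  by rewrite exp_derive [_ *: _]mulr1.
by have [_] := is_derive_comp1 dk df.
Qed.

(** The divergence of x w^(b+1) f^2, with w = [regw e], has integral 0, and completing a square
    trades its mixed term for the gradient. The case b = 0 is applied to first derivatives of test
    functions, the case b = 1 to the weight |x|^-4. *)
Lemma hardy (b : nat) (e : R) f : 0 < e -> (2 * b.+1 < n)%N -> test_function f ->
  \int[mu]_x (f x ^+ 2 * regw e x ^+ b.+1) <=
  (2 / (n%:R - 2 * b.+1%:R)) ^+ 2 * \int[mu]_x (grad2 f x * regw e x ^+ b).
Proof.
move=> e0 bn tf; set c : R := n%:R - 2 * b.+1%:R.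
have c0 : 0 < c by rewrite subr_gt0 -natrM ltr_nat.
have sf := test_smooth tf.
have sw := smooth_regw e0.
pose V (i : 'I_n) (x : 'rV[R]_n) := (x ord0 i * regw e x ^+ b.+1) * (f x * f x).
have tV i : test_function (V i).
  apply: testMl; first by apply: smoothM; [exact: smooth_coord|exact: smoothX].
  exact: testMl.
have tG : test_function (fun x => grad2 f x * regw e x ^+ b).
  rewrite (_ : (fun _ => _) = fun x => regw e x ^+ b * grad2 f x); last first.
    by apply/funext => x; rewrite mulrC.
  apply: testMl; first exact: smoothX.
  apply: test_sum => i; rewrite (_ : (fun _ => _) = fun x => pderiv i f x * pderiv i f x).
    by apply: testMl; [exact: smooth_pderiv|exact: test_pderiv].
  by apply/funext => x; rewrite expr2.
have tZ : test_function (fun x => f x ^+ 2 * regw e x ^+ b.+1).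
  rewrite (_ : (fun _ => _) = fun x => (f x * regw e x ^+ b.+1) * f x).
    exact: testMl (smoothM sf (smoothX _ sw)) tf.
  by apply/funext => x; ring.
have VE i x : pderiv i (V i) x = regw e x ^+ b.+1 * f x ^+ 2 -
    2 * b.+1%:R * (x ord0 i ^+ 2 * regw e x * regw e x ^+ b.+1 * f x ^+ 2) +
    2 * x ord0 i * regw e x ^+ b.+1 * f x * pderiv i f x.
  rewrite /V pderivM; [|by apply: smoothM; [exact: smooth_coord|exact: smoothX]|exact: smoothM].
  rewrite pderivM// pderivM; [|exact: smooth_coord|exact: smoothX].
  rewrite pderivX// pderiv_regw//=.
  have -> : pderiv i (fun y : 'rV[R]_n => y ord0 i) x = 1.
    by have [_ ] := is_derive_coord i x (delta_mx ord0 i); rewrite mxE !eqxx.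
  by rewrite !exprS; ring.
have int0 : \int[mu]_x (\sum_(i < n) pderiv i (V i) x) = 0.
  rewrite /Rintegral; under eq_integral do rewrite -sumEFin.
  rewrite integral_sum//=; last by move=> i; apply: test_integrable; exact: test_pderiv.
  rewrite big1// => i _; have [M _ VM] := test_vanish (tV i).
  apply: (integral_pderiv0 _ _ VM).
    by move=> x; apply: smooth_derivable; exact: test_smooth.
  by apply: smooth_continuous; apply: smooth_pderiv; exact: test_smooth.
have tS : test_function (fun x => \sum_(i < n) pderiv i (V i) x).
  by apply: test_sum => i; exact: test_pderiv.
(* The factors c / 2 and 2 / c are such that this integrand lies pointwise below the divergence of
   [V]. *)
have key : \int[mu]_x (c / 2 * (f x ^+ 2 * regw e x ^+ b.+1) -
    2 / c * (grad2 f x * regw e x ^+ b)) <= 0.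
  rewrite -[leRHS]int0; apply: le_Rintegral => //.
  - exact: test_integrable (testB (testMl (smooth_cst _) tZ) (testMl (smooth_cst _) tG)).
  - exact: test_integrable.
  move=> x _; under eq_bigr do rewrite VE.
  have w0 := regw_gt0 x e0.
  set w := regw e x in w0 *; set s := \sum_(i < n) x ord0 i ^+ 2.
  have sw1 : s * w <= 1.
    by rewrite /w /regw -/s ler_pdivrMr ?regw_den_gt0// mul1r lerDl ltW.
  (* The difference of the two sides is a nonnegative multiple of the square of (c / 2) f x_i w +
     d_i f. *)
  have per (i : 'I_n) : - (c / 2) * (x ord0 i ^+ 2 * w * w ^+ b.+1 * f x ^+ 2) -
      2 / c * (pderiv i f x ^+ 2 * w ^+ b) <= 2 * x ord0 i * w ^+ b.+1 * f x * pderiv i f x.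
    rewrite -subr_ge0.
    have -> : 2 * x ord0 i * w ^+ b.+1 * f x * pderiv i f x -
      (- (c / 2) * (x ord0 i ^+ 2 * w * w ^+ b.+1 * f x ^+ 2) -
      2 / c * (pderiv i f x ^+ 2 * w ^+ b)) =
      w ^+ b * (2 / c) * (c / 2 * (f x * x ord0 i * w) + pderiv i f x) ^+ 2.
      by rewrite exprS; field; rewrite gt_eqF.
    by rewrite mulr_ge0 ?sqr_ge0// mulr_ge0 ?exprn_ge0 ?divr_ge0// ltW.
  apply: (@le_trans _ _ (\sum_(i < n) (w ^+ b.+1 * f x ^+ 2 -
     2 * b.+1%:R * (x ord0 i ^+ 2 * w * w ^+ b.+1 * f x ^+ 2) +
     (- (c / 2) * (x ord0 i ^+ 2 * w * w ^+ b.+1 * f x ^+ 2) -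
      2 / c * (pderiv i f x ^+ 2 * w ^+ b))))); last first.
    by apply: ler_sum => i _; rewrite lerD2l; exact: per.
  have -> : \sum_(i < n) (w ^+ b.+1 * f x ^+ 2 -
     2 * b.+1%:R * (x ord0 i ^+ 2 * w * w ^+ b.+1 * f x ^+ 2) +
     (- (c / 2) * (x ord0 i ^+ 2 * w * w ^+ b.+1 * f x ^+ 2) -
      2 / c * (pderiv i f x ^+ 2 * w ^+ b))) =
     (n%:R - (2 * b.+1%:R + c / 2) * (s * w)) * (w ^+ b.+1 * f x ^+ 2) -
     2 / c * (grad2 f x * w ^+ b).
    have -> : n%:R = \sum_(i < n) 1 :> R by rewrite sumr_const card_ord.
    rewrite /grad2 /s !(mulr_suml, mulr_sumr).
    rewrite -sumrB mulr_suml -sumrB; apply: eq_bigr => i _.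
    ring.
  (* Here |x|^2 w <= 1 enters; by the choice of [c], n - 2 (b + 1) - c / 2 = c / 2. *)
  rewrite lerD2r (mulrC (f x ^+ 2)) ler_wpM2r//.
    by rewrite mulr_ge0 ?sqr_ge0// exprn_ge0// ltW.
  rewrite [leLHS](_ : _ = n%:R - (2 * b.+1%:R + c / 2)); last by rewrite /c; field.
  by rewrite lerD2l lerN2 ler_piMr// addr_ge0 ?mulr_ge0 ?invr_ge0 ?(ltW c0).
rewrite RintegralB// in key; last 2 first.
- exact: test_integrable (testMl (smooth_cst _) tZ).
- exact: test_integrable (testMl (smooth_cst _) tG).
rewrite !RintegralZl// in key; [|exact: test_integrable..].
move: key; rewrite subr_le0 -ler_pdivlMl ?divr_gt0// => /le_trans; apply.
by rewrite le_eqVlt; apply/orP; left; apply/eqP; field; rewrite gt_eqF.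
Qed.

End hardy.

(** * Derivatives of smooth functions in arbitrary directions *)

Section chain_rule.
Context {R : realType} {n : nat}.
Implicit Types (f : 'rV[R]_n -> R) (x v w : 'rV[R]_n).

Lemma is_derive_scale f x v (c d : R) :
  is_derive x v f d -> is_derive x (c *: v) f (c * d).
Proof.
move=> /is_derive_line h; apply/is_derive_line.
have h0 : is_derive (0 : R) (1 : R) (fun t : R => t * c) c.
  have [d1 d2] := is_deriveM (is_derive_id (0 : R) 1) (is_derive_cst c (0 : R) (1 : R)).
  by apply: DeriveDef => //; rewrite d2 scale0r add0r [_ *: _]mulr1.
rewrite (_ : (fun t => _) = (fun t : R => f (t *: v + x)) \o (fun t : R => t * c)); last first.
  by apply/funext => t /=; rewrite scalerA.
rewrite mulrC; apply: is_derive1_comp => //=.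
by rewrite mul0r.
Qed.

(** The mean value theorem is applied to the increment along [v] from the moving base point x + h w;
    continuity of [dv] then gives the limit. *)
Lemma is_derive_add f (dv : 'rV[R]_n -> R) x v w (d : R) :
  (forall y, is_derive y v f (dv y)) -> continuous dv -> is_derive x w f d ->
  is_derive x (v + w) f (dv x + d).
Proof.
move=> fv cdv [fw <-].
suff H : h^-1 *: ((f \o shift x) (h *: (v + w)) - f x) @[h --> 0^'] --> dv x + 'D_w f x.
  by apply: DeriveDef; [apply/cvg_ex; eexists; exact: H|exact: cvg_lim H].
have E : forall h : R, h^-1 *: ((f \o shift x) (h *: (v + w)) - f x) =
   h^-1 *: (f (h *: v + (h *: w + x)) - f (h *: w + x)) +
   h^-1 *: ((f \o shift x) (h *: w) - f x).
  by move=> h; rewrite -scalerDr /= [h *: (v + w)]scalerDr -[h *: v + _ + x]addrA; congr (_ *: _); rewrite [RHS]addrA subrK.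
under eq_fun do rewrite E; apply: cvgD; last exact: fw.
have mvt (h : R) : h != 0 -> exists2 t : R, 0 <= t <= 1 &
    h^-1 *: (f (h *: v + (h *: w + x)) - f (h *: w + x)) = dv (t *: (h *: v) + (h *: w + x)).
  move=> h0.
  have dg (t : R) : is_derive t 1 (fun t : R => f (t *: (h *: v) + (h *: w + x)))
      (h * dv (t *: (h *: v) + (h *: w + x))).
    have /is_derive_line H := is_derive_scale h (fv (t *: (h *: v) + (h *: w + x))).
    apply/is_derive_line; move: H.
    rewrite (_ : (fun _ => _) = (fun s : R => f ((s *: 1 + t) *: (h *: v) + (h *: w + x)))) //.
    by apply/funext => s; rewrite [s *: 1]mulr1 scalerDl addrA.
  have cg : continuous (fun t : R => f (t *: (h *: v) + (h *: w + x))).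
    by move=> t; apply: derivable_continuous1; have [] := dg t.
  have [t t01 ft] := @MVT_segment _ _ _ 0 1 ler01 (fun t _ => dg t) (continuous_subspaceT cg).
  exists t; first by move: t01; rewrite in_itv.
  move: ft; rewrite scale1r scale0r add0r subr0 mulr1 => ->.
  by rewrite [_ *: _]mulrA mulVf// mul1r.
apply/cvgrPdist_le => e e0.
have := cdv x => /cvgrPdist_le/(_ e e0)/nbhs_ballP[del /= del0 xdel].
have vw0 : 0 < `|v| + `|w| + 1 by rewrite ltr_wpDl.
near=> h; have h0 : h != 0 by near: h; exact: nbhs_dnbhs_neq.
have [t /andP[t0 t1] ->] := mvt h h0; apply: xdel.
rewrite -ball_normE /= addrA [X in x - X]addrC opprD addrA subrr sub0r normrN.
rewrite (le_lt_trans (ler_normD _ _))// !normrZ (ger0_norm t0).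
apply: (@le_lt_trans _ _ (`|h| * (`|v| + `|w| + 1))).
  rewrite !mulrDr -addrA lerD// ?ler_piMl ?mulr_ge0//.
  by rewrite lerDl mulr1.
rewrite -ltr_pdivlMr//; near: h; apply: dnbhs0_lt; exact: divr_gt0.
Unshelve. all: by end_near. Qed.

(** The coordinates of [v] are added one at a time with [is_derive_add]: [smooth] speaks of
    coordinate directions, whereas rays need arbitrary ones. *)
Lemma smooth_is_derive f x v : smooth f ->
  is_derive x v f (\sum_(i < n) v ord0 i * pderiv i f x).
Proof.
move=> sf; have /= vE : v = \sum_(i < n) v ord0 i *: delta_mx ord0 i.
  by rewrite {1}(row_sum_delta v).
rewrite {1}vE; elim: (index_enum _) x => [|i r IH] x.
  by rewrite !big_nil; exact: is_derive0.
rewrite !big_cons; apply: (is_derive_add (dv := fun y => v ord0 i * pderiv i f y)) => //.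
  by move=> y; apply: is_derive_scale; apply/derivableP; exact: smooth_derivable.
apply: smooth_continuous; apply: smoothM; [exact: smooth_cst|exact: smooth_pderiv].
Qed.

(** The difference is the squared length of the part of the gradient orthogonal to [v]. *)
Lemma radial_derivative_le f x v : \sum_(i < n) v ord0 i ^+ 2 = 1 ->
  (\sum_(i < n) v ord0 i * pderiv i f x) ^+ 2 <= grad2 f x.
Proof.
move=> v1; set c := \sum_(i < n) v ord0 i * pderiv i f x.
have cE : \sum_(i < n) v ord0 i * pderiv i f x = c by [].
clearbody c; rewrite -subr_ge0.
have -> : grad2 f x - c ^+ 2 = \sum_(i < n) (pderiv i f x - c * v ord0 i) ^+ 2.
  transitivity (grad2 f x - 2 * c * (\sum_(i < n) v ord0 i * pderiv i f x) +
      c ^+ 2 * \sum_(i < n) v ord0 i ^+ 2).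
    by rewrite v1 cE; ring.
  rewrite /grad2 !mulr_sumr -sumrB -big_split/=.
  by apply: eq_bigr => i _; ring.
by apply: sumr_ge0 => i _; exact: sqr_ge0.
Qed.

End chain_rule.

Lemma ge0_integral_mrestr d (T : measurableType d) (R : realType)
    (m : {measure set T -> \bar R}) (D : set T) (mD : measurable D) (f : T -> \bar R) :
  measurable_fun setT f -> (forall x, 0 <= f x)%E ->
  (\int[mrestr m mD]_x f x = \int[m]_(x in D) f x)%E.
Proof.
move=> mf f0; rewrite (@ge0_negligible_integral _ _ _ _ setT (~` D))//; last 2 first.
- exact: measurableC.
- by rewrite -[LHS]/(m (~` D `&` D)) setICl measure0.
rewrite setTD setCK; apply: eq_measure_integral => A mA AD.
by rewrite -[LHS]/(m (A `&` D)) setIidl.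
Qed.

(** * Polar coordinates *)

Section polar.
Context {R : realType} {n : nat}.
Hypothesis n0 : (0 < n)%N.
Local Notation mu := (lebesgue_rV R n).
Implicit Types (x : 'rV[R]_n).

Lemma enormZ (s : R) x : 0 <= s -> enorm (s *: x) = s * enorm x.
Proof.
move=> s0; rewrite /enorm -[in RHS](ger0_norm s0) -sqrtr_sqr -sqrtrM ?sqr_ge0//.
by congr Num.sqrt; rewrite mulr_sumr; apply: eq_bigr => i _; rewrite mxE exprMn.
Qed.

Lemma enorm_eq0 x : enorm x = 0 -> x = 0.
Proof.
move=> x0; apply/rowP => i; rewrite mxE; apply/eqP; rewrite -sqrf_eq0.
have /eqP := sqr_enorm x; rewrite x0 expr0n/= eq_sym psumr_eq0; last by move=> j _; exact: sqr_ge0.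
by move=> /allP/(_ i); rewrite mem_index_enum => /(_ isT).
Qed.

Lemma coord_le_enorm x i : `|x ord0 i| <= enorm x.
Proof.
rewrite -sqrtr_sqr ler_sqrt ?sqr_sum_ge0// (bigD1 i)//= lerDl.
by apply: sumr_ge0 => j _; exact: sqr_ge0.
Qed.

Lemma continuous_enorm : continuous (@enorm R n).
Proof.
move=> x; apply: (@continuous_comp _ _ _ (fun x : 'rV[R]_n => \sum_(i < n) x ord0 i ^+ 2) Num.sqrt).
  exact: (smooth_continuous smooth_sqr_sum).
exact: sqrt_continuous.
Qed.

Lemma measurable_enorm : measurable_fun setT (@enorm R n).
Proof. by apply: continuous_measurable_rV; exact: continuous_enorm. Qed.

(** At the origin the value is 0, since the inverse of 0 is 0; [punctured] removes that point. *)
Definition dir x : 'rV[R]_n := (enorm x)^-1 *: x.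

Lemma measurable_dir : measurable_fun setT dir.
Proof.
apply: measurable_fun_rVP => i.
rewrite (_ : (fun _ => _) = (fun x => enorm x `^ (-1) * x ord0 i)); last first.
  by apply/funext => x; rewrite mxE powR_inv1// enorm_ge0.
apply: measurable_funM; last exact: measurable_rV_coord.
exact: (measurableT_comp (@measurable_powR R (-1)) measurable_enorm).
Qed.

Lemma dirZ (s : R) x : 0 < s -> dir (s *: x) = dir x.
Proof.
move=> s0; rewrite /dir enormZ ?ltW// scalerA invfM mulrAC mulVf ?mul1r//.
by rewrite gt_eqF.
Qed.

Definition punctured : set 'rV[R]_n := [set x | 0 < enorm x].
Definition unit_ball : set 'rV[R]_n := [set x | 0 < enorm x <= 1].

Lemma measurable_enorm_itv (I : interval R) : measurable [set x : 'rV[R]_n | enorm x \in I].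
Proof.
rewrite -[X in measurable X]setTI.
exact: (measurable_enorm measurableT (measurable_itv I)).
Qed.

Lemma measurable_punctured : measurable punctured.
Proof.
rewrite (_ : punctured = [set x | enorm x \in `]0, +oo[])//; first exact: measurable_enorm_itv.
by apply/seteqP; split => x; rewrite /punctured /= in_itv/= andbT.
Qed.

Lemma measurable_unit_ball : measurable unit_ball.
Proof.
rewrite (_ : unit_ball = [set x | enorm x \in `]0, 1]])//; first exact: measurable_enorm_itv.
Qed.

(* The image under [x |-> x / |x|] of Lebesgue measure on the unit ball, that is,
   [1/n] times the surface measure of the unit sphere. *)
Definition sphere_measure0 := image_measure (mrestr mu measurable_unit_ball) measurable_dir.

Definition sphere_measure : set 'rV[R]_n -> \bar R := sphere_measure0.

HB.instance Definition _ := isMeasure.Build _ _ _ sphere_measure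
  (measure0 sphere_measure0) (measure_ge0 sphere_measure0)
  (@measure_semi_sigma_additive _ _ _ sphere_measure0).

Lemma sphere_measure_lty A : measurable A -> (sphere_measure A < +oo)%E.
Proof.
move=> mA; have := @lebesgue_rV_cube_fin R n 1; apply: le_lt_trans.
apply: le_measure; rewrite ?inE.
- apply: measurableI; last exact: measurable_unit_ball.
  by rewrite -[X in measurable X]setTI; exact: measurable_dir.
- apply: (@measurable_box _ _ (fun=> [set t | `|t| <= 1])) => i.
  rewrite (_ : mkset _ = `[- 1, 1]%classic); first exact: measurable_itv.
  by apply/seteqP; split => t /=; rewrite in_itv/= ler_norml.
- by move=> x [_ /andP[_ x1]] i; exact: le_trans (coord_le_enorm _ _) x1.
Qed.

Let sphere_measure_fin : fin_num_fun sphere_measure.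
Proof. by move=> A mA; rewrite ge0_fin_numE//; exact: sphere_measure_lty. Qed.

HB.instance Definition _ := Measure_isFinite.Build _ _ _ sphere_measure sphere_measure_fin.

Lemma sphere_measureE A :
  sphere_measure A = mu [set x | A (dir x) /\ 0 < enorm x <= 1].
Proof. by []. Qed.

Lemma sphere_measure_gt0 : (0 < sphere_measure setT)%E.
Proof.
rewrite sphere_measureE.
(* With c = 1/n the cube ]0, c]^n has positive measure and lies in the unit ball, as n c^2 <= n c =
   1. *)
pose c : R := n%:R^-1.
have c0 : 0 < c by rewrite invr_gt0 ltr0n.
have c1 : c <= 1 by rewrite /c invf_le1 ?ltr0n// ler1n.
apply: (@lt_le_trans _ _ (mu [set x | forall i, `]0, c]%classic (x ord0 i)])).
  have -> : mu [set x | forall i, `]0, c]%classic (x ord0 i)] = (\prod_(i < n) c%:E)%E.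
    rewrite (lebesgue_rV_box (A := fun=> `]0, c]%classic)) => [|i]; last exact: measurable_itv.
    by apply: eq_bigr => i _; rewrite lebesgue_measure_itv/= lte_fin c0 oppr0 adde0.
  by rewrite prodEFin lte_fin; apply: prodr_gt0.
apply: le_measure; rewrite ?inE.
- exact: (@measurable_box _ _ (fun=> `]0, c]%classic)).
- rewrite (_ : mkset _ = unit_ball); first exact: measurable_unit_ball.
  by apply/seteqP; split => x //=; case.
move=> x /= xc; split => //.
have [i _] : exists i : 'I_n, True by exists (Ordinal n0).
have xi j : 0 < x ord0 j <= c by have := xc j; rewrite in_itv.
rewrite (lt_le_trans _ (coord_le_enorm x i)) ?normr_gt0 ?gt_eqF//=; last by case/andP: (xi i).
rewrite -(@ler_pXn2r _ 2)// ?nnegrE ?enorm_ge0// sqr_enorm expr1n.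
apply: (@le_trans _ _ (\sum_(j < n) c)).
  apply: ler_sum => j _; have /andP[x0 xc'] := xi j.
  apply: (@le_trans _ _ (c ^+ 2)); first by rewrite ler_pXn2r// nnegrE ltW.
  by rewrite expr2 ler_piMl// ltW.
by rewrite sumr_const card_ord -[c *+ n]mulr_natr mulVf// pnatr_eq0 -lt0n.
Qed.

Lemma sphere_measure_enorm1 : sphere_measure [set w | enorm w != 1] = 0%E.
Proof.
rewrite sphere_measureE (_ : mkset _ = set0) ?measure0//.
apply/seteqP; split => // x /= [/eqP + /andP[x0 _]]; apply.
by rewrite /dir enormZ ?invr_ge0 ?enorm_ge0// mulVf// gt_eqF.
Qed.

End polar.

(** Left rays are stable under intersection and generate the Borel sets. They suit
    [lebesgue_halfline], which is finite on each of them. *)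
Lemma measure_unique_rays (R : realType) (m1 m2 : {measure set (measurableTypeR R) -> \bar R}) :
  (forall b : R, m1 `]-oo, b]%classic = m2 `]-oo, b]%classic) ->
  (forall b : R, (m1 `]-oo, b]%classic < +oo)%E) ->
  forall A, measurable A -> m1 A = m2 A.
Proof.
move=> m12 m1oo A mA.
pose G : set (set (measurableTypeR R)) := [set X | exists b : R, X = `]-oo, b]%classic].
apply: (@measure_unique _ R (measurableTypeR R) G (fun k => `]-oo, k%:R]%classic)) => //.
- rewrite -[LHS]/((@ocitv R).-sigma.-measurable) RGenOInfty.measurableE.
  apply/seteqP; split.
    apply: smallest_sub; first exact: smallest_sigma_algebra.
    move=> _ [x ->]; rewrite -setCitvl -(setTD `]-oo, x]%classic).
    by apply: sigma_algebraCD; apply: sub_sigma_algebra; exists x.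
  apply: smallest_sub; first exact: smallest_sigma_algebra.
  move=> _ [x ->]; rewrite -setCitvr -(setTD `]x, +oo[%classic).
  by apply: sigma_algebraCD; apply: sub_sigma_algebra; exists x.
- move=> _ _ [a ->] [b ->]; exists (Num.min a b).
  by apply/seteqP; split => x /=; rewrite !in_itv/= le_min => /andP.
- by move=> k; exists k%:R.
- apply/seteqP; split => // x _; exists (Num.truncn `|x|).+1 => //=.
  by rewrite in_itv/= (le_trans (ler_norm x))// ltW// truncnS_gt.
- by move=> _ [b ->]; exact: m12.
Qed.

(** * Lebesgue measure as a product of a radial and a spherical measure *)

Section polar_formula.
Context {R : realType} {n : nat}.
Hypothesis n0 : (0 < n)%N.
Local Notation mu := (lebesgue_rV R n).
Local Notation sigma := (@sphere_measure R n).
Implicit Types (x : 'rV[R]_n).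

Definition halfline : set (measurableTypeR R) := `]0, +oo[%classic.

Lemma measurable_halfline : measurable halfline.
Proof. exact: measurable_itv. Qed.

Definition lebesgue_halfline0 : {measure set (measurableTypeR R) -> \bar R} :=
  mrestr (@lebesgue_measure R) measurable_halfline.

Definition lebesgue_halfline : set (measurableTypeR R) -> \bar R := lebesgue_halfline0.

HB.instance Definition _ := isMeasure.Build _ _ _ lebesgue_halfline
  (measure0 lebesgue_halfline0) (measure_ge0 lebesgue_halfline0)
  (@measure_semi_sigma_additive _ _ _ lebesgue_halfline0).

Lemma lebesgue_halflineE A : lebesgue_halfline A = lebesgue_measure (A `&` halfline).
Proof. by []. Qed.

Lemma lebesgue_halfline_ray_lty (b : R) : (lebesgue_halfline `]-oo, b]%classic < +oo)%E.
Proof.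
rewrite lebesgue_halflineE.
apply: (@le_lt_trans _ _ (lebesgue_measure (`[- `|b|, `|b|]%classic : set R))).
  apply: le_measure; rewrite ?inE//; first by apply: measurableI => //; exact: measurable_itv.
  move=> x []; rewrite /halfline /= !in_itv/= ?andbT => xb x0.
  by rewrite (le_trans xb (ler_norm b)) andbT ltW// (le_lt_trans _ x0)// oppr_le0.
by rewrite lebesgue_measure_itv/=; case: ifPn => // _; rewrite ltry.
Qed.

Let lebesgue_halfline_sigma_finite : sigma_finite setT lebesgue_halfline.
Proof.
exists (fun k => `]-oo, k%:R]%classic).
  apply/esym/seteqP; split => // x _; exists (Num.truncn `|x|).+1 => //=.
  by rewrite in_itv/= (le_trans (ler_norm x))// ltW// truncnS_gt.
by move=> k; split; [exact: measurable_itv|exact: lebesgue_halfline_ray_lty].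
Qed.

HB.instance Definition _ := Measure_isSigmaFinite.Build _ _ _ lebesgue_halfline
  lebesgue_halfline_sigma_finite.

Lemma measurable_enormX : measurable_fun setT (fun x => enorm x ^+ n : measurableTypeR R).
Proof. by apply: measurable_funX; exact: measurable_enorm. Qed.

Lemma root_expK (b : R) : 0 < b -> (b `^ n%:R^-1) ^+ n = b.
Proof.
move=> b0; rewrite -powR_mulrn ?powR_ge0// -powRrM mulVf ?powRr1// ?ltW//.
by rewrite pnatr_eq0 -lt0n.
Qed.

Lemma exp_rootK (b : R) : 0 < b -> (b ^+ n) `^ n%:R^-1 = b.
Proof.
move=> b0; rewrite -powR_mulrn ?ltW// -powRrM mulfV ?powRr1// ?ltW//.
by rewrite pnatr_eq0 -lt0n.
Qed.

(** The homothety of ratio b^(1/n) maps the unit sector onto this one and multiplies Lebesgue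
    measure by b, the length of ]0, b]. For b <= 0 both sides vanish. *)
Lemma lebesgue_sector_ray (W : set 'rV[R]_n) (b : R) : measurable W ->
  mu [set x | [/\ 0 < enorm x, enorm x ^+ n <= b & W (dir x)]] =
  (lebesgue_halfline `]-oo, b]%classic * sigma W)%E.
Proof.
move=> mW; have [b0|b0] := leP b 0.
  rewrite (_ : mkset _ = set0); last first.
    apply/seteqP; split => // x [/= x0 xb _].
    by have := lt_le_trans (exprn_gt0 n x0) (le_trans xb b0); rewrite ltxx.
  rewrite measure0 lebesgue_halflineE (_ : _ `&` _ = set0) ?measure0 ?mul0e//.
  apply/seteqP; split => // x []; rewrite /halfline /= !in_itv/= ?andbT => xb x0.
  by have := lt_le_trans x0 (le_trans xb b0); rewrite ltxx.
rewrite lebesgue_halflineE (_ : _ `&` _ = `]0, b]%classic); last first.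
  apply/seteqP; split => x; rewrite /halfline /= !in_itv/= ?andbT.
    by move=> [xb x0]; rewrite x0.
  by move=> /andP[].
rewrite lebesgue_measure_itv/= lte_fin b0 oppr0 adde0 sphere_measureE.
set s := (b `^ n%:R^-1)^-1.
have r0 : 0 < b `^ n%:R^-1 by rewrite powR_gt0.
have s0 : 0 < s by rewrite invr_gt0.
have mA : measurable [set x : 'rV[R]_n | W (dir x) /\ 0 < enorm x <= 1].
  have mdW : measurable (@dir R n @^-1` W).
    by rewrite -[X in measurable X]setTI; exact: measurable_dir.
  exact: (measurableI _ _ mdW measurable_unit_ball).
rewrite -(lebesgue_rV_affine 0 s0 mA) exprVn root_expK// muleA -EFinM mulfV ?gt_eqF// mul1e.
congr (mu _); apply/seteqP; split => x /=; rewrite addr0 dirZ// enormZ ?(ltW s0)//.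
  move=> [x0 xb Wx]; split => //; rewrite mulr_gt0//= /s mulrC ler_pdivrMr// mul1r.
  by rewrite -(@ler_pXn2r _ n)// ?nnegrE ?enorm_ge0 ?(ltW r0)// root_expK.
move=> [Wx /andP[sx0 sx1]]; split => //.
  by move: sx0; rewrite pmulr_rgt0.
move: sx1; rewrite /s mulrC ler_pdivrMr// mul1r.
by rewrite -(@ler_pXn2r _ n)// ?nnegrE ?enorm_ge0 ?(ltW r0)// root_expK.
Qed.

Lemma measurable_sector (W : set 'rV[R]_n) : measurable W ->
  measurable [set x | 0 < enorm x /\ W (dir x)].
Proof.
move=> mW; have mdW : measurable (@dir R n @^-1` W).
  by rewrite -[X in measurable X]setTI; exact: measurable_dir.
exact: (measurableI _ _ measurable_punctured mdW).
Qed.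

(** For fixed [W] both sides are measures in [A], the left one as a pushforward by |x|^n, and they
    agree on left rays. *)
Lemma lebesgue_sector (A : set (measurableTypeR R)) (W : set 'rV[R]_n) :
  measurable A -> measurable W ->
  mu [set x | [/\ 0 < enorm x, A (enorm x ^+ n) & W (dir x)]] =
  (lebesgue_halfline A * sigma W)%E.
Proof.
move=> mA mW.
pose m1 := image_measure (mrestr mu (measurable_sector mW)) measurable_enormX.
have sW : 0 <= fine (sigma W) by exact: fine_ge0.
have sWE : sigma W = (fine (sigma W))%:E.
  by rewrite fineK// ge0_fin_numE//; exact: sphere_measure_lty.
pose m2 := mscale (NngNum sW) lebesgue_halfline.
have -> : mu [set x | [/\ 0 < enorm x, A (enorm x ^+ n) & W (dir x)]] = m1 A.
  congr (mu _); apply/seteqP; split => x /=; first by move=> [].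
  by move=> [? []].
have m2E B : m2 B = (lebesgue_halfline B * sigma W)%E by rewrite [in RHS]sWE muleC.
rewrite -m2E.
have E b : m1 `]-oo, b]%classic = (lebesgue_halfline `]-oo, b]%classic * sigma W)%E.
  rewrite -lebesgue_sector_ray//; congr (mu _); apply/seteqP; split => x /=.
    by rewrite in_itv/= => -[? []].
  by move=> []; rewrite in_itv.
apply: measure_unique_rays => // b; rewrite E ?m2E//.
rewrite sWE lte_mul_pinfty// ?lee_fin//.
  by rewrite ge0_fin_numE//; exact: lebesgue_halfline_ray_lty.
by rewrite ltry.
Qed.

(* In the radial variable [s = |x|^n] the polar Jacobian is constant. *)
Definition polar_map x : measurableTypeR R * 'rV[R]_n := (enorm x ^+ n, dir x).

Definition polar_inv (p : measurableTypeR R * 'rV[R]_n) : 'rV[R]_n :=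
  (p.1 `^ n%:R^-1) *: p.2.

Lemma measurable_polar_map : measurable_fun setT polar_map.
Proof.
by apply/measurable_fun_pairP; split; [exact: measurable_enormX|exact: measurable_dir].
Qed.

Lemma measurable_polar_inv : measurable_fun setT polar_inv.
Proof.
apply: measurable_fun_rVP => i.
rewrite (_ : (fun _ => _) = (fun p : measurableTypeR R * 'rV[R]_n =>
  (p.1 `^ n%:R^-1 : measurableTypeR R) * (p.2 ord0 i : measurableTypeR R))); last first.
  by apply/funext => x; rewrite mxE.
apply: measurable_funM.
  exact: (measurableT_comp (@measurable_powR R n%:R^-1) measurable_fst).
exact: (measurableT_comp (measurable_rV_coord i) measurable_snd).
Qed.

Lemma polar_mapK x : 0 < enorm x -> polar_inv (polar_map x) = x.
Proof.
move=> x0; rewrite /polar_inv /polar_map /= exp_rootK//.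
by rewrite /dir scalerA mulfV ?scale1r// gt_eqF.
Qed.

Lemma lebesgue_not_punctured : mu (~` punctured) = 0%E.
Proof.
case: n n0 => // k _; rewrite -(lebesgue_rV_set1 (0 : 'rV[R]_k.+1)); congr (lebesgue_rV _ _ _).
apply/seteqP; split => x; rewrite /punctured /=.
  by move=> /negP; rewrite -leNgt => x0; apply: enorm_eq0; apply/eqP; rewrite eq_le x0 enorm_ge0.
move=> ->; have := @enormZ R k.+1 0 0 (lexx 0).
by rewrite scale0r mul0r => ->; rewrite ltxx.
Qed.

(** The image of Lebesgue measure on the punctured space under [polar_map] agrees with the product
    measure on rectangles, hence everywhere. Tonelli's theorem then separates the variables, the
    origin being negligible. *)
Lemma polar_formula (F : 'rV[R]_n -> \bar R) :
  measurable_fun setT F -> (forall x, 0 <= F x)%E ->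
  (\int[mu]_x F x =
   \int[lebesgue_halfline]_r \int[sigma]_w F (polar_inv (r, w)))%E.
Proof.
move=> mF F0.
pose m' := image_measure (mrestr mu measurable_punctured) measurable_polar_map.
have mFP : measurable_fun setT (F \o polar_inv).
  by apply: measurableT_comp => //; exact: measurable_polar_inv.
have FP0 p : (0 <= (F \o polar_inv) p)%E by exact: F0.
transitivity (\int[lebesgue_halfline]_r (fubini_F sigma (F \o polar_inv) r))%E; last by [].
rewrite -fubini_tonelli1//.
transitivity (\int[m']_p (F \o polar_inv) p)%E; last first.
  apply: eq_measure_integral => A mA _; apply/esym; apply: product_measure_unique => //.
  move=> B W mB mW; rewrite -lebesgue_sector//; congr (mu _).
  by apply/seteqP; split => x /=; [move=> [[]]|move=> []].
rewrite (ge0_integral_pushforward measurable_polar_map)//.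
have mFPP : measurable_fun setT ((F \o polar_inv) \o polar_map).
  exact: (measurableT_comp mFP measurable_polar_map).
rewrite (ge0_integral_mrestr _ _ mFPP)//; last by move=> x; exact: FP0.
rewrite (@ge0_negligible_integral _ _ _ _ setT (~` @punctured R n))//; last 2 first.
- exact: (measurableC (@measurable_punctured R n)).
- exact: lebesgue_not_punctured.
rewrite setTD setCK; apply: eq_integral => x; rewrite inE => x0.
by rewrite /= polar_mapK.
Qed.

End polar_formula.

(** * Averages over spheres *)

Section ray_bound.
Context {R : realType} {n : nat}.
Hypothesis n5 : (5 <= n)%N.
Implicit Types (x w : 'rV[R]_n) (f : 'rV[R]_n -> R).

Let n_gt0 : (0 < n)%N. Proof. exact: leq_trans n5. Qed.
Let nR_gt0 : 0 < n%:R :> R. Proof. by rewrite ltr0n. Qed.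

Lemma test_vanish_enorm f : test_function f ->
  exists2 M : R, 0 < M & forall x, M < enorm x -> f x = 0.
Proof.
move=> tf; have [M M0 fM] := test_vanish tf.
exists (n%:R * M); first by rewrite mulr_gt0.
move=> x; rewrite ltNge => /negP xM; apply: fM; rewrite ltNge; apply/negP => xM'.
apply: xM; rewrite -(@ler_pXn2r _ 2)// ?nnegrE ?enorm_ge0 ?mulr_ge0 ?(ltW M0)// sqr_enorm.
apply: (@le_trans _ _ (\sum_(i < n) M ^+ 2)).
  apply: ler_sum => i _; rewrite -real_normK ?num_real//.
  by rewrite ler_pXn2r// ?nnegrE ?(ltW M0)//; exact: le_trans (ler_coord_norm _ _) xM'.
rewrite sumr_const card_ord exprMn -[leLHS]mulr_natl ler_wpM2r ?sqr_ge0// expr2.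
by rewrite ler_peMl// ler1n.
Qed.

(** The hypotheses are placed on t >= a because the powers to which this is applied are
    differentiated only at positive arguments. *)
Lemma C1_FTC (F dF : R -> R) (a b : R) : a < b ->
  (forall t, a <= t -> is_derive t (1 : R) F (dF t)) ->
  (forall t, a <= t -> {for t, continuous dF}) ->
  measurable_fun `[a, b] dF /\
  (\int[lebesgue_measure]_(t in `[a, b]) (dF t)%:E = (F b - F a)%:E)%E.
Proof.
move=> ab Fd dFc.
have cdF : {within `[a, b], continuous dF}.
  apply: continuous_in_subspaceT => t; rewrite inE/= in_itv/= => /andP[at_ _].
  exact: dFc.
have cF t : a <= t -> {for t, continuous F}.
  by move=> at_; apply: derivable_continuous1; have [] := Fd t at_.
split; first exact: subspace_continuous_measurable_fun.
rewrite EFinB; apply: (continuous_FTC2 ab cdF).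
- split.
  + by move=> t; rewrite in_itv/= => /andP[at_ _]; have [] := Fd t (ltW at_).
  + exact/cvg_at_right_filter/cF.
  + by apply/cvg_at_left_filter/cF; exact: ltW.
- by move=> t; rewrite in_itv/= => /andP[at_ _]; rewrite derive1E; have [_ ->] := Fd t (ltW at_).
Qed.

Lemma ge0_integral_halfline (g : R -> \bar R) :
  measurable_fun setT g -> (forall s, 0 <= g s)%E ->
  (\int[lebesgue_halfline]_s g s = \int[lebesgue_measure]_(s in `]0%R, +oo[) g s)%E.
Proof. by move=> mg g0; exact: (ge0_integral_mrestr _ measurable_halfline mg g0). Qed.

Lemma is_derive_ray f w (t : R) : smooth f -> 0 < t ->
  is_derive t 1 (fun s : R => f (s `^ n%:R^-1 *: w))
    ((\sum_(i < n) w ord0 i * pderiv i f (t `^ n%:R^-1 *: w)) *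
     (n%:R^-1 * t `^ (n%:R^-1 - 1))).
Proof.
move=> sf t0.
have h (s : R) : is_derive s 1 (fun s : R => f (s *: w)) (\sum_(i < n) w ord0 i * pderiv i f (s *: w)).
  have /is_derive_line H := @smooth_is_derive _ _ f (s *: w) w sf.
  apply/is_derive_line; move: H.
  rewrite (_ : (fun _ => _) = (fun h : R => f ((h *: 1 + s) *: w)))//.
  by apply/funext => k; rewrite [k *: 1]mulr1 scalerDl.
exact: (is_derive1_comp (h _) (is_derive1_powR _ t0)).
Qed.

(** In the variable s = |x|^n, |f (r w)| is at most the integral of |dF| from r^n to a point beyond
    the support. The arithmetic-geometric inequality splits the integrand into an energy density and
    a power of s that is integrable at infinity since n > 4. The parameter [t] weighs the two parts
    and is chosen later. *)
Lemma ray_bound f w (r e t : R) : test_function f -> enorm w = 1 ->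
  0 < e -> 0 < r -> e <= r ^+ 2 -> 0 < t ->
  ((`|f (r *: w)|)%:E <=
   (t / n%:R)%:E * \int[lebesgue_halfline]_s
      (grad2 f (polar_inv (s, w)) * regw e (polar_inv (s, w)))%:E +
   (r `^ (4 - n%:R) / (2 * t * (n%:R - 4)))%:E)%E.
Proof.
move=> tf w1 e0 r0 er t0.
have sf := test_smooth tf.
have [M M0 fM] := test_vanish_enorm tf.
pose G x := grad2 f x * regw e x.
(* At s = b the point of the ray has norm r + M > M, where [f] vanishes. *)
pose a : R := r ^+ n; pose b : R := (r + M) ^+ n.
have a0 : 0 < a by rewrite exprn_gt0.
have ab : a < b by rewrite ltr_pXn2r// ?nnegrE ?ltrDl// ?addr_ge0 ?ltW.
pose F (s : R) := f (s `^ n%:R^-1 *: w).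
pose dF (s : R) := ((\sum_(i < n) w ord0 i * pderiv i f (s `^ n%:R^-1 *: w)) *
     (n%:R^-1 * s `^ (n%:R^-1 - 1))).
have Fd s : a <= s -> is_derive s (1 : R) F (dF s).
  by move=> as_; apply: is_derive_ray => //; exact: lt_le_trans as_.
have dFc s : a <= s -> {for s, continuous dF}.
  move=> as_; have s0 : 0 < s := lt_le_trans a0 as_.
  apply: continuousM.
    apply: (@continuous_comp _ _ _ (fun s : R => s `^ n%:R^-1)
      (fun t : R => \sum_(i < n) w ord0 i * pderiv i f (t *: w))).
      by apply: derivable_continuous1; have [] := is_derive1_powR n%:R^-1 s0.
    apply: (@continuous_comp _ _ _ (fun t : R => t *: w)
      (fun x => \sum_(i < n) w ord0 i * pderiv i f x)).
      exact: scalel_continuous.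
    apply: smooth_continuous; apply: smooth_sum => i.
    by apply: smoothM; [exact: smooth_cst|exact: smooth_pderiv].
  apply: continuousM; first exact: cst_continuous.
  by apply: derivable_continuous1; have [] := is_derive1_powR (n%:R^-1 - 1) s0.
have Fa : F a = f (r *: w) by rewrite /F /a exp_rootK.
have Fb : F b = 0.
  rewrite /F /b exp_rootK ?addr_gt0//; apply: fM.
  by rewrite enormZ ?addr_ge0 ?ltW// w1 mulr1 ltrDr.
have [mdF FTC] := C1_FTC ab Fd dFc.
have -> : `|f (r *: w)|%:E = (`|\int[lebesgue_measure]_(s in `[a, b]) (dF s)%:E|)%E.
  by rewrite FTC abse_EFin Fa Fb sub0r normrN.
have mGw : measurable_fun setT (fun s : measurableTypeR R => (G (polar_inv (s, w)))%:E).
  apply/measurable_EFinP; apply: (@measurableT_comp _ _ _ _ _ _ G).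
    apply: continuous_measurable_rV; apply: smooth_continuous.
    apply: smoothM; last exact: smooth_regw.
    by apply: smooth_sum => i; apply: smoothX; exact: smooth_pderiv.
  exact: (measurableT_comp measurable_polar_inv (measurable_pair2 w)).
have mtGw : measurable_fun setT (fun s : measurableTypeR R =>
    ((t / n%:R)%:E * (G (polar_inv (s, w)))%:E)%E).
  by apply/measurable_EFinP; apply: measurable_funM => //; exact/measurable_EFinP.
pose c : R := 4 / n%:R - 1.
have c0 : c < 0 by rewrite subr_lt0 ltr_pdivrMr// mul1r ltr_nat.
pose h (s : R) : R := (2 * n%:R * t)^-1 * s `^ (c - 1).
pose H (s : R) : R := (2 * n%:R * t)^-1 * c^-1 * s `^ c.
have Hd s : a <= s -> is_derive s (1 : R) H (h s).
  move=> as_; have s0 : 0 < s := lt_le_trans a0 as_.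
  have [d1 d2] := is_derive1_powR c s0.
  have [d3 d4] := is_deriveM (is_derive_cst ((2 * n%:R * t)^-1 * c^-1) s (1 : R)) (is_derive1_powR c s0).
  apply: DeriveDef => //; rewrite d4 scaler0 addr0 /h [_ *: _]mulrA -[_ / c * c]mulrA.
  by rewrite mulVf ?mulr1// lt_eqF.
have hc s : a <= s -> {for s, continuous h}.
  move=> as_; have s0 : 0 < s := lt_le_trans a0 as_.
  apply: continuousM; first exact: cst_continuous.
  by apply: derivable_continuous1; have [] := is_derive1_powR (c - 1) s0.
have [mh FTCh] := C1_FTC ab Hd hc.
have pw s : a <= s -> `|dF s| <= t / n%:R * G (polar_inv (s, w)) + h s.
  move=> as_; have s0 : 0 < s := lt_le_trans a0 as_.
  rewrite /G /polar_inv /=; set x := s `^ n%:R^-1 *: w.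
  rewrite /dF -/x; set D := \sum_(i < n) w ord0 i * pderiv i f x.
  set g := grad2 f x; set W := regw e x.
  have W0 : 0 < W by exact: regw_gt0.
  have Dg : D ^+ 2 <= g.
    by apply: radial_derivative_le; rewrite -sqr_enorm w1 expr1n.
  have x2 : \sum_(i < n) x ord0 i ^+ 2 = s `^ (2 / n%:R).
    rewrite -sqr_enorm /x enormZ ?powR_ge0// w1 mulr1 -powR_mulrn ?powR_ge0// -powRrM.
    by congr (_ `^ _); rewrite mulrC.
  (* Since e <= r^2 <= |x|^2 on this part of the ray, the regularised weight is within a factor 2 of
     |x|^-2. *)
  have WI : W^-1 <= 2 * s `^ (2 / n%:R).
    rewrite /W /regw invrK x2 [leRHS]mulr_natl [leRHS]mulr2n lerD2l (le_trans er)//.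
    rewrite -(exp_rootK n_gt0 r0) -powR_mulrn ?powR_ge0// -powRrM mulrC.
    apply: ge0_ler_powR; rewrite ?nnegrE ?(ltW a0) ?(ltW s0) ?divr_ge0//.
  set p := s `^ (n%:R^-1 - 1).
  have p0 : 0 <= p by exact: powR_ge0.
  have ps : p ^+ 2 * s `^ (2 / n%:R) = s `^ (c - 1).
    rewrite -powR_mulrn// -powRrM -powRD; last by rewrite (gt_eqF s0) implybT.
    by congr (_ `^ _); rewrite /c; field; rewrite gt_eqF.
  (* Young's inequality, from the square of 2 t W |D| - p. *)
  have amgm : `|D| * p <= t * (g * W) + (2 * t)^-1 * s `^ (c - 1).
    apply: (@le_trans _ _ (t * (D ^+ 2 * W) + p ^+ 2 * W^-1 / (4 * t))).
      rewrite -(real_normK (num_real D)) -subr_ge0.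
      have -> : t * (`|D| ^+ 2 * W) + p ^+ 2 * W^-1 / (4 * t) - `|D| * p =
          (2 * t * W * `|D| - p) ^+ 2 / (4 * t * W).
        by field; rewrite !gt_eqF.
      by rewrite divr_ge0 ?sqr_ge0// !mulr_ge0// ltW.
    apply: lerD.
      by rewrite ler_wpM2l ?(ltW t0)// ler_wpM2r// ltW.
    rewrite -ps; apply: (@le_trans _ _ (p ^+ 2 * (2 * s `^ (2 / n%:R)) / (4 * t))).
      rewrite ler_wpM2r ?invr_ge0 ?mulr_ge0 ?(ltW t0)//.
      by rewrite ler_wpM2l// sqr_ge0.
    by rewrite le_eqVlt; apply/orP; left; apply/eqP; field; rewrite gt_eqF.
  rewrite normrM normrM (ger0_norm p0) (@ger0_norm _ n%:R^-1) ?invr_ge0//.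
  rewrite mulrCA -ler_pdivlMl ?invr_gt0// invrK.
  apply: le_trans amgm _; rewrite le_eqVlt; apply/orP; left; apply/eqP.
  by rewrite /h; field; rewrite !gt_eqF.
apply: le_trans (le_abse_integral _ _ _) _ => //; first exact/measurable_EFinP.
apply: (@le_trans _ _ (\int[lebesgue_measure]_(s in `[a, b])
   ((t / n%:R)%:E * (G (polar_inv (s, w)))%:E + (h s)%:E))%E).
  apply: ge0_le_integral => //.
  - by apply: measurableT_comp => //; exact/measurable_EFinP.
  - apply: emeasurable_funD; last exact/measurable_EFinP.
    exact: (measurable_funTS mtGw).
  - by move=> s; rewrite /= in_itv/= => /andP[as_ _]; rewrite lee_fin; exact: pw.
have G0 x : 0 <= G x by rewrite mulr_ge0 ?grad2_ge0// ltW// regw_gt0.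
have tn0 : 0 <= t / n%:R by rewrite divr_ge0// ltW.
have h0 s : 0 <= h s.
  by rewrite mulr_ge0 ?powR_ge0// invr_ge0 !mulr_ge0// ltW.
rewrite ge0_integralD//; last 4 first.
- by move=> s _; rewrite mule_ge0 ?lee_fin.
- exact: (measurable_funTS mtGw).
- by move=> s _; rewrite lee_fin.
- exact/measurable_EFinP.
apply: leeD.
  rewrite ge0_integralZl//; last 2 first.
  - exact: (measurable_funTS mGw).
  - by move=> s _; rewrite lee_fin.
  apply: lee_wpmul2l; first by rewrite lee_fin.
  rewrite (ge0_integral_halfline mGw); last by move=> s; rewrite lee_fin.
  apply: ge0_subset_integral => //.
  - exact: (measurable_funTS mGw).
  - by move=> s _; rewrite lee_fin.
  - by move=> s /=; rewrite !in_itv/= => /andP[as_ _]; rewrite andbT (lt_le_trans a0).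
rewrite FTCh lee_fin /H.
have -> : r `^ (4 - n%:R) = a `^ c.
  rewrite /a -powR_mulrn ?ltW// -powRrM /c; congr (_ `^ _); field.
  by rewrite gt_eqF.
have -> : 2 * t * (n%:R - 4) = - (2 * n%:R * t * c).
  by rewrite /c; field; rewrite gt_eqF.
have bc0 : 0 <= b `^ c by exact: powR_ge0.
have alg (A B T C : R) : T != 0 -> C != 0 ->
    A / - (T * C) - (T^-1 / C * B - T^-1 / C * A) = - (B / (T * C)).
  by move=> T0 C0; field; rewrite T0 C0.
rewrite -subr_ge0 alg ?(lt_eqF c0)//; last by rewrite gt_eqF// !mulr_gt0.
by rewrite -mulrN -invrN -mulrN divr_ge0// !mulr_ge0 ?oppr_ge0// ltW.
Qed.
End ray_bound.

Section sphere_average.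
Context {R : realType} {n : nat}.
Hypothesis n5 : (5 <= n)%N.
Local Notation mu := (lebesgue_rV R n).
Local Notation sigma := (@sphere_measure R n).
Implicit Types (x w : 'rV[R]_n) (f : 'rV[R]_n -> R).

Lemma measurable_scale (r : R) : measurable_fun setT (fun w : 'rV[R]_n => r *: w).
Proof.
rewrite (_ : (fun _ => _) = (fun w => r *: w + 0)); first exact: measurable_affine_rV.
by apply/funext => w; rewrite addr0.
Qed.

Lemma smooth_energy_density (e : R) f : 0 < e -> smooth f ->
  smooth (fun x => grad2 f x * regw e x).
Proof.
move=> e0 sf; apply: smoothM; last exact: smooth_regw.
by apply: smooth_sum => i; apply: smoothX; exact: smooth_pderiv.
Qed.

(** The ray bound is integrated over the unit sphere; Tonelli's theorem and the polar formula
    recognise the full energy in the iterated integral. A single ray sees only part of the energy,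
    so a non-radial [f] is controlled in the mean over spheres. *)
Lemma sphere_average_bound f (r e t : R) : test_function f ->
  0 < e -> 0 < r -> e <= r ^+ 2 -> 0 < t ->
  (\int[sigma]_w (`|f (r *: w)|)%:E <=
   (t / n%:R)%:E * \int[mu]_x (grad2 f x * regw e x)%:E +
   (r `^ (4 - n%:R) / (2 * t * (n%:R - 4)))%:E * sigma setT)%E.
Proof.
move=> tf e0 r0 er t0.
have n0 : (0 < n)%N by exact: leq_trans n5.
have sf := test_smooth tf.
pose G (p : measurableTypeR R * 'rV[R]_n) : \bar R :=
  (grad2 f (polar_inv p) * regw e (polar_inv p))%:E.
have mG0 : measurable_fun setT (fun x => (grad2 f x * regw e x)%:E).
  apply/measurable_EFinP; apply: continuous_measurable_rV; apply: smooth_continuous.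
  exact: smooth_energy_density.
have mG : measurable_fun setT G := measurableT_comp mG0 measurable_polar_inv.
have G00 x : (0 <= (grad2 f x * regw e x)%:E)%E.
  by rewrite lee_fin mulr_ge0 ?grad2_ge0// ltW// regw_gt0.
have G0 p : (0 <= G p)%E by exact: G00.
rewrite (polar_formula n0 mG0 G00).
have -> : (\int[lebesgue_halfline]_s \int[sigma]_w
    (grad2 f (polar_inv (s, w)) * regw e (polar_inv (s, w)))%:E =
  \int[sigma]_w \int[lebesgue_halfline]_s G (s, w))%E.
  exact: (fubini_tonelli G mG G0).
have mGw : measurable_fun setT (fun w => \int[lebesgue_halfline]_s G (s, w))%E.
  exact: (@measurable_fun_fubini_tonelli_G _ _ _ _ R lebesgue_halfline G mG G0).
have tn0 : (0 <= (t / n%:R)%:E)%E by rewrite lee_fin divr_ge0// ltW.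
have Gw0 w : (0 <= \int[lebesgue_halfline]_s G (s, w))%E by exact: integral_ge0.
have c0 : 0 <= r `^ (4 - n%:R) / (2 * t * (n%:R - 4)).
  by rewrite divr_ge0 ?powR_ge0// !mulr_ge0 ?(ltW t0)// subr_ge0 ler_nat ltnW.
rewrite -(ge0_integralZl _ _ mGw)// -integral_cst//.
rewrite -ge0_integralD//; last 2 first.
- by move=> w _; rewrite mule_ge0.
- exact: measurable_funeM.
apply: ae_ge0_le_integral => //.
- apply/measurable_EFinP; apply: measurableT_comp => //.
  apply: (measurableT_comp _ (measurable_scale r)).
  by apply: continuous_measurable_rV; exact: smooth_continuous.
- by move=> w _; rewrite adde_ge0 ?lee_fin// mule_ge0.
- by apply: emeasurable_funD; [exact: measurable_funeM|exact: measurable_cst].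
(* The ray bound concerns unit vectors; the others are null for the sphere measure. *)
exists [set w | enorm w != 1]; split.
- rewrite (_ : mkset _ = ~` [set x | enorm x \in `[(1 : R), (1 : R)]]).
    exact: (measurableC (@measurable_enorm_itv R n _)).
  by apply/seteqP; split => x /=; rewrite in_itv/= -eq_le eq_sym => /negP.
- exact: sphere_measure_enorm1.
move=> w /= h; apply/negP => /eqP w1; apply: h => _.
exact: ray_bound.
Qed.

End sphere_average.

(** Indices are chosen with integrals at most 2^-(j+1). The series then has a finite integral, hence
    a finite sum almost everywhere, which forces its terms to 0. The condition j <= s j transfers
    bounds that hold for all large indices. *)
Lemma ae_cvg_subsequence d (T : measurableType d) (R : realType)
    (m : {measure set T -> \bar R}) (F : nat -> T -> R) :
  (forall k, measurable_fun setT (F k)) -> (forall k x, 0 <= F k x) ->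
  (\int[m]_x (F k x)%:E)%E @[k --> \oo] --> 0%E ->
  exists2 s : nat -> nat, forall j, (j <= s j)%N &
    {ae m, forall x, F (s j) x @[j --> \oo] --> (0 : R)}.
Proof.
move=> mF F0 /fine_cvgP[Ffin /cvgrPdist_lt F00].
have /choice[s sP] : forall j, exists k, (j <= k)%N /\
    (\int[m]_x (F k x)%:E <= (1 / (2 ^ j.+1)%:R)%:E)%E.
  move=> j; have e0 : 0 < 1 / (2 ^ j.+1)%:R :> R by rewrite divr_gt0// ltr0n expn_gt0.
  have nr := F00 _ e0; near \oo => k; exists k; split; first by near: k; exact: nbhs_infty_ge.
  have kfin : (\int[m]_x (F k x)%:E)%E \is a fin_num by near: k; exact: Ffin.
  rewrite -(fineK kfin) lee_fin; apply: ltW; apply: le_lt_trans (ler_norm _) _.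
  by rewrite -normrN -sub0r; near: k; exact: nr.
exists s; first by move=> j; have [] := sP j.
have mFs j : measurable_fun setT (fun x => (F (s j) x)%:E) by exact/measurable_EFinP.
have F0s j x : setT x -> (0 <= (F (s j) x)%:E)%E by rewrite lee_fin.
have S1 : (\int[m]_x (\sum_(j <oo) (F (s j) x)%:E) < +oo)%E.
  rewrite integral_nneseries//; apply: (@le_lt_trans _ _ 1%:E); last by rewrite ltry.
  apply: le_trans (epsilon_trick0 xpredT (@ler01 R)).
  apply: lee_nneseries => [j *|j *]; last by have [] := sP j.
  by apply: integral_ge0 => x _; rewrite lee_fin.
have mS : measurable_fun setT (fun x => \sum_(j <oo) (F (s j) x)%:E)%E.
  by apply: ge0_emeasurable_sum => // j x _ _; rewrite lee_fin.
have iS : m.-integrable setT (fun x => \sum_(j <oo) (F (s j) x)%:E)%E.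
  apply/integrableP; split => //.
  rewrite (eq_integral (fun x => \sum_(j <oo) (F (s j) x)%:E)%E)// => x _.
  by rewrite gee0_abs//; apply: nneseries_ge0 => j _ _; rewrite lee_fin.
have := integrable_ae measurableT iS; apply: filterS => x /(_ I) Sx.
have Slt : (\sum_(j <oo) (F (s j) x)%:E < +oo)%E by rewrite ltey_eq Sx.
apply: cvg_series_cvg_0.
apply: nondecreasing_is_cvgn.
  by apply: nondecreasing_series.
exists (fine (\sum_(j <oo) (F (s j) x)%:E)%E) => _ [k _ <-].
rewrite -lee_fin fineK// /series/= -sumEFin.
by apply: nneseries_lim_ge => j _; rewrite lee_fin.
Unshelve. all: by end_near. Qed.

(** * Weak lower semicontinuity *)

Section weak_limits.
Context {R : realType} {n : nat}.
Local Notation mu := (lebesgue_rV R n).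
Implicit Types (u f g h psi W : 'rV[R]_n -> R) (phi : nat -> 'rV[R]_n -> R).

(** If a > d then (a / d)^(p - 1) >= 1. The inequality plays the role of Hoelder's: it turns
    smallness in L^p into smallness in L^1 on bounded sets, up to the error [d]. *)
Lemma le_add_powR (a d p : R) : 0 <= a -> 0 < d -> 1 <= p -> a <= d + d `^ (1 - p) * a `^ p.
Proof.
move=> a0 d0 p1; have [ad|da] := leP a d.
  by apply: le_trans ad _; rewrite lerDl mulr_ge0// powR_ge0.
have a_gt0 : 0 < a := lt_trans d0 da.
apply: (@le_trans _ _ (d `^ (1 - p) * a `^ p)); last by rewrite lerDr ltW.
have -> : a `^ p = a * a `^ (p - 1).
  by rewrite mulr_powRB1// (lt_le_trans ltr01).
rewrite mulrCA ler_peMr// -opprB powRN mulrC ler_pdivlMr ?powR_gt0// mul1r.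
by apply: ge0_ler_powR; rewrite ?nnegrE ?subr_ge0 ?(ltW d0) ?(ltW a_gt0) ?(ltW da).
Qed.

(** On the bounded support of [psi], [le_add_powR] splits the difference into the constant [d] and a
    multiple of its p-th power; [d] is fixed before [k]. *)
Lemma cvg_integral_test u phi psi (p : R) : 1 <= p -> loc_integrable u ->
  (forall k, test_function (phi k)) ->
  (\int[mu]_x (`|phi k x - u x| `^ p)%:E)%E @[k --> \oo] --> 0%E ->
  test_function psi ->
  \int[mu]_x (phi k x * psi x) @[k --> \oo] --> \int[mu]_x (u x * psi x).
Proof.
move=> p1 lu tphi /fine_cvgP[ufin /cvgrPdist_le ucvg] tpsi.
have cpsi : continuous psi by apply: smooth_continuous; exact: test_smooth.
have [C C0 psiC] := test_bounded tpsi; have [M M0 psiM] := test_vanish tpsi.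
set B := [set x : 'rV[R]_n | `|x| <= M].
have mB : measurable B := measurable_sup_ball M.
have Bfin : (mu B < +oo)%E by apply: compact_lebesgue_rV_fin; exact: compact_sup_ball.
have muBE : mu B = (fine (mu B))%:E by rewrite fineK// ge0_fin_numE.
have lphi k : loc_integrable (phi k).
  by apply: continuous_loc_integrable; apply: smooth_continuous; exact: test_smooth.
have mw k : measurable_fun setT (fun x => `|phi k x - u x| `^ p).
  apply: (measurableT_comp (@measurable_powR R p)).
  apply: measurableT_comp => //; apply: measurable_funB; first exact: (lphi k).1.
  exact: lu.1.
have bound k d : 0 < d -> (\int[mu]_x (`|phi k x - u x| `^ p)%:E)%E \is a fin_num ->
   `|\int[mu]_x (u x * psi x) - \int[mu]_x (phi k x * psi x)| <=
   C * d * fine (mu B) + C * d `^ (1 - p) * fine (\int[mu]_x (`|phi k x - u x| `^ p)%:E)%E.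
  move=> d0 kfin.
  have i1 := loc_integrable_mul lu cpsi psiM.
  have i2 := loc_integrable_mul (lphi k) cpsi psiM.
  have i12 : mu.-integrable setT (EFin \o (fun x => u x * psi x - phi k x * psi x)).
    by have := integrableB measurableT i1 i2; apply: eq_integrable => // x _; rewrite /= EFinB.
  rewrite -RintegralB//; apply: le_trans (le_normr_Rintegral measurableT i12) _.
  rewrite -lee_fin /Rintegral fineK; last exact: integrable_fin_num (integrable_norm i12).
  rewrite EFinD !EFinM -muBE (fineK kfin).
  apply: (@le_trans _ _ (\int[mu]_x ((C * d)%:E * (\1_B x)%:E + (C * d `^ (1 - p))%:E * (`|phi k x - u x| `^ p)%:E))%E).
    apply: ge0_le_integral => //.
    - apply/measurable_EFinP; apply: measurableT_comp => //.
      apply: measurable_funB; apply: measurable_funM.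
      + exact: lu.1.
      + exact: continuous_measurable_rV.
      + exact: (lphi k).1.
      + exact: continuous_measurable_rV.
    - apply: emeasurable_funD; apply: measurable_funeM; apply/measurable_EFinP => //.
    - move=> x _; rewrite -!EFinM -EFinD lee_fin -mulrBl normrM distrC.
      rewrite indicE; have [xB|xB] := boolP (x \in B).
        rewrite mulr1 -!mulrA -mulrDr mulrC; apply: ler_pM => //.
        exact: le_add_powR.
      rewrite psiM ?normr0 ?mulr0 ?add0r.
        by rewrite mulr_ge0 ?powR_ge0// mulr_ge0 ?powR_ge0// ltW.
      by rewrite ltNge; apply/negP => xM; move/negP: xB; apply; rewrite inE.
  have mB1 : measurable_fun setT (fun x => (\1_B x : R)%:E) by exact/measurable_EFinP.
  have mwE : measurable_fun setT (fun x => (`|phi k x - u x| `^ p)%:E) by exact/measurable_EFinP.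
  have B10 x : setT x -> (0 <= (\1_B x : R)%:E)%E by rewrite lee_fin.
  have w0 x : setT x -> (0 <= (`|phi k x - u x| `^ p)%:E)%E by rewrite lee_fin powR_ge0.
  have c10 : (0 <= (C * d)%:E)%E by rewrite lee_fin mulr_ge0// ltW.
  have c20 : (0 <= (C * d `^ (1 - p))%:E)%E by rewrite lee_fin mulr_ge0 ?powR_ge0// ltW.
  rewrite (@ge0_integralD _ _ _ mu setT measurableT
    (fun x => (C * d)%:E * (\1_B x)%:E)%E
    (fun x => (C * d `^ (1 - p))%:E * (`|phi k x - u x| `^ p)%:E)%E).
  - rewrite (ge0_integralZl mu measurableT mB1 B10 c10).
    by rewrite (ge0_integralZl mu measurableT mwE w0 c20) integral_indic// setIT.
  - by move=> x /B10 Bx; rewrite mule_ge0.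
  - exact: measurable_funeM.
  - by move=> x /w0 wx; rewrite mule_ge0.
  - exact: measurable_funeM.
apply/cvgrPdist_le => e e0.
(* This makes the first error term at most e / 2; adding 1 secures a positive denominator. *)
pose d := e / (2 * (C * fine (mu B) + 1)).
have V0 : 0 <= fine (mu B) by exact: fine_ge0.
have CV0 : 0 < C * fine (mu B) + 1 by rewrite ltr_wpDl// mulr_ge0// ltW.
have d0 : 0 < d by rewrite divr_gt0// mulr_gt0.
have K0 : 0 < 2 * (C * d `^ (1 - p)) by rewrite !mulr_gt0// powR_gt0.
have nr := ucvg _ (divr_gt0 e0 K0).
near=> k; have kfin : (\int[mu]_x (`|phi k x - u x| `^ p)%:E)%E \is a fin_num by near: k.
apply: le_trans (bound k d d0 kfin) _; rewrite [leRHS](splitr e); apply: lerD.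
  have -> : C * d * fine (mu B) = (C * fine (mu B)) * (e / 2) / (C * fine (mu B) + 1).
    by rewrite /d; field; rewrite gt_eqF.
  rewrite ler_pdivrMr// [leRHS]mulrC ler_wpM2r ?lerDl//.
  by rewrite divr_ge0// ltW.
rewrite mulrC -ler_pdivlMr; last by rewrite mulr_gt0// powR_gt0.
have -> : e / 2 / (C * d `^ (1 - p)) = e / (2 * (C * d `^ (1 - p))).
  by field; rewrite !gt_eqF// powR_gt0.
apply: le_trans (ler_norm _) _; rewrite -normrN -sub0r; near: k; exact: nr.
Unshelve. all: by end_near. Qed.

End weak_limits.

Section weak_lower_bound.
Context {R : realType} {n : nat}.
Local Notation mu := (lebesgue_rV R n).
Implicit Types (u f g h psi W : 'rV[R]_n -> R) (phi : nat -> 'rV[R]_n -> R).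

(* Pointwise [W h^2 >= 2 h W psi - W psi^2]; the limit relation replaces [h] by [T k]. *)
Lemma weak_lower_bound h W psi (T : nat -> 'rV[R]_n -> R) (c eta : R) (N : nat) :
  measurable_fun setT h -> measurable_fun setT W -> (forall x, 0 <= W x) -> 0 < eta ->
  mu.-integrable setT (EFin \o (fun x => h x * (W x * psi x))) ->
  mu.-integrable setT (EFin \o (fun x => W x * psi x ^+ 2)) ->
  (forall k, mu.-integrable setT (EFin \o (fun x => T k x * (W x * psi x)))) ->
  (forall k, mu.-integrable setT (EFin \o (fun x => W x * (T k x - psi x) ^+ 2))) ->
  \int[mu]_x (T k x * (W x * psi x)) @[k --> \oo] --> \int[mu]_x (h x * (W x * psi x)) ->
  (forall k, (N <= k)%N -> \int[mu]_x (W x * (T k x - psi x) ^+ 2) <= c) ->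
  (((1 - eta) * (\int[mu]_x (W x * psi x ^+ 2)) - c / eta)%:E <=
    \int[mu]_x (W x * h x ^+ 2)%:E)%E.
Proof.
move=> mh mW W0 eta0 ih ipsi iT iTp Th Tc.
set A := \int[mu]_x (W x * psi x ^+ 2).
have [->|foo] := eqVneq (\int[mu]_x (W x * h x ^+ 2)%:E)%E +oo%E; first exact: leey.
have mWh : measurable_fun setT (fun x => W x * h x ^+ 2).
  by apply: measurable_funM => //; exact: measurable_funX.
have Wh0 x : 0 <= W x * h x ^+ 2 by rewrite mulr_ge0// sqr_ge0.
have iWh : mu.-integrable setT (EFin \o (fun x => W x * h x ^+ 2)).
  apply/integrableP; split; first exact/measurable_EFinP.
  rewrite (eq_integral (fun x => (W x * h x ^+ 2)%:E)) => [|x _].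
    by rewrite ltey.
  by rewrite /= ger0_norm.
have fE : (\int[mu]_x (W x * h x ^+ 2)%:E)%E = (\int[mu]_x (W x * h x ^+ 2))%:E.
  by rewrite /Rintegral fineK// integrable_fin_num.
rewrite fE lee_fin.
set I := \int[mu]_x (h x * (W x * psi x)) in Th.
(* Integrated form of W (h - psi)^2 >= 0. *)
have H1 : 2 * I - A <= \int[mu]_x (W x * h x ^+ 2).
  rewrite /I /A -RintegralZl// -RintegralB//; last 1 first.
  - by have := integrableZl measurableT 2 ih; apply: eq_integrable => // x _; rewrite /= EFinM.
  apply: le_Rintegral => //.
  - have := integrableB measurableT (integrableZl measurableT 2 ih) ipsi.
    by apply: eq_integrable => // x _; rewrite /= EFinB EFinM.
  - move=> x _; rewrite -subr_ge0.
    have -> : W x * h x ^+ 2 - (2 * (h x * (W x * psi x)) - W x * psi x ^+ 2) =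
      W x * (h x - psi x) ^+ 2 by ring.
    by rewrite mulr_ge0// sqr_ge0.
(* Each pairing with [T k] is bounded below by means of the square of eta psi + (T k - psi), and the
   bound survives in the limit. *)
have H2 : (1 - eta / 2) * A - c / (2 * eta) <= I.
  have <- : limn (fun k => \int[mu]_x (T k x * (W x * psi x))) = I by exact: cvg_lim Th.
  apply: limr_ge; first by apply/cvg_ex; exists I.
  near=> k.
  have Nk : (N <= k)%N by near: k; exact: nbhs_infty_ge.
  apply: (@le_trans _ _ ((1 - eta / 2) * A - (2 * eta)^-1 * \int[mu]_x (W x * (T k x - psi x) ^+ 2))).
    rewrite lerD2l lerN2 mulrC ler_wpM2r//; last exact: Tc.
    by rewrite invr_ge0 mulr_ge0// ltW.
  rewrite /A -!RintegralZl// -RintegralB//; last 2 first.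
  - by have := integrableZl measurableT (1 - eta / 2) ipsi; apply: eq_integrable => // x _; rewrite /= EFinM.
  - by have := integrableZl measurableT (2 * eta)^-1 (iTp k); apply: eq_integrable => // x _; rewrite /= EFinM.
  apply: le_Rintegral => //.
  - have := integrableB measurableT (integrableZl measurableT (1 - eta / 2) ipsi)
      (integrableZl measurableT (2 * eta)^-1 (iTp k)).
    by apply: eq_integrable => // x _; rewrite /= EFinB !EFinM.
  - move=> x _; rewrite -subr_ge0.
    have -> : T k x * (W x * psi x) - ((1 - eta / 2) * (W x * psi x ^+ 2) -
       (2 * eta)^-1 * (W x * (T k x - psi x) ^+ 2)) =
      W x * (2 * eta)^-1 * (eta * psi x + (T k x - psi x)) ^+ 2.
      by field; rewrite gt_eqF.
    by rewrite mulr_ge0 ?sqr_ge0// mulr_ge0// invr_ge0 mulr_ge0// ltW.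
apply: le_trans H1.
have -> : (1 - eta) * A - c / eta = 2 * ((1 - eta / 2) * A - c / (2 * eta)) - A.
  by field; rewrite gt_eqF.
by rewrite lerD2r ler_pM2l.
Unshelve. all: by end_near. Qed.

(** [eta] and [c] are fixed before [A], so that they serve all late approximants at once. *)
Lemma le_of_weak_lower_bound (L e : R) : 0 <= L -> 0 < e ->
  exists eta c : R, [/\ 0 < eta, eta < 1, 0 < c &
    forall A : R, (1 - eta) * A - c / eta <= L -> A <= L + e].
Proof.
(* This gives eta (L + e) = e / 2, and c = eta e / 2 makes c / eta equal to e / 2 as well. *)
move=> L0 e0; pose eta := e / (2 * (L + e)).
have Le0 : 0 < L + e by rewrite ltr_wpDl.
have eta0 : 0 < eta by rewrite divr_gt0// mulr_gt0.
have eta1 : eta < 1.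
  rewrite /eta ltr_pdivrMr ?mulr_gt0// mul1r mulrDr mulr_natl mulr2n.
  by rewrite (_ : 2 * e = e + e); [lra|ring].
exists eta, (eta * (e / 2)); split => //; first by rewrite mulr_gt0// divr_gt0.
move=> A; rewrite [eta * (e / 2)]mulrC mulfK ?gt_eqF// lerBlDr => h.
have h' : (1 - eta) * A <= (1 - eta) * (L + e).
  apply: (le_trans h); rewrite mulrBl mul1r /eta.
  have -> : e / (2 * (L + e)) * (L + e) = e / 2 by field; rewrite gt_eqF.
  lra.
by move: h'; rewrite ler_pM2l// subr_gt0.
Qed.

End weak_lower_bound.

(** * Energies of test functions against the D22 norm *)

Section energies.
Context {R : realType} {n : nat}.
Hypothesis n5 : (5 <= n)%N.
Local Notation mu := (lebesgue_rV R n).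
Local Notation p := (crit_exp R n).
Implicit Types (u f h psi chi : 'rV[R]_n -> R) (phi : nat -> 'rV[R]_n -> R).

Let n_gt0 : (0 < n)%N. Proof. exact: leq_trans n5. Qed.
Let nR_gt0 : 0 < n%:R :> R. Proof. by rewrite ltr0n. Qed.
Let n4_gt0 : 0 < n%:R - 4 :> R. Proof. by rewrite subr_gt0 ltr_nat. Qed.

Lemma crit_exp_gt2 : 2 < p.
Proof. by rewrite /crit_exp ltr_pdivlMr//; lra. Qed.

Lemma test_sqr f : test_function f -> test_function (fun x => f x ^+ 2).
Proof.
move=> tf; rewrite (_ : (fun _ => _) = fun x => f x * f x).
  exact: testMl (test_smooth tf) tf.
by apply/funext => x; rewrite expr2.
Qed.

Lemma test_grad2 f : test_function f -> test_function (grad2 f).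
Proof.
move=> tf; rewrite /grad2.
apply: (@test_sum _ _ _ _ (fun i x => pderiv i f x ^+ 2)) => i.
by apply: test_sqr; exact: test_pderiv.
Qed.

Lemma test_energy_density (e : R) f : 0 < e -> test_function f ->
  test_function (fun x => grad2 f x * regw e x).
Proof.
move=> e0 tf; rewrite (_ : (fun _ => _) = fun x => regw e x * grad2 f x).
  by apply: testMl; [exact: smooth_regw|exact: test_grad2].
by apply/funext => x; rewrite mulrC.
Qed.

Lemma Rintegral_sum (I : finType) (F : I -> 'rV[R]_n -> R) :
  (forall i, mu.-integrable setT (EFin \o F i)) ->
  \int[mu]_x (\sum_i F i x) = \sum_i \int[mu]_x F i x.
Proof.
move=> iF; rewrite /Rintegral; under eq_integral do rewrite -sumEFin.
rewrite integral_sum//=.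
rewrite (eq_bigr (fun i => (fine (\int[mu]_x (F i x)%:E))%:E)%E) ?sumEFin// => i _.
by rewrite fineK//; exact: (integrable_fin_num measurableT (iF i)).
Qed.

Lemma D22_norm2_term_ge0 i j f : 0 <= \int[mu]_x (pderivs [:: i; j] f x ^+ 2).
Proof. by apply: Rintegral_ge0 => x _; exact: sqr_ge0. Qed.

(** Hardy's inequality with b = 0 for the derivative d_i chi, whose constant (2 / (n - 2))^2 is at
    most 1. The bound does not depend on [e], and the uniformity in the regularisation below rests
    on this. *)
Lemma hardy_pderiv (e : R) (i : 'I_n) chi : 0 < e -> test_function chi ->
  \int[mu]_x (regw e x * pderiv i chi x ^+ 2) <=
  \sum_(j < n) \int[mu]_x (pderivs [:: j; i] chi x ^+ 2).
Proof.
move=> e0 tc; have ti := test_pderiv i tc.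
have h := hardy (b := 0) e0 (leq_trans _ n5) ti.
apply: le_trans (le_trans (h isT) _).
  by rewrite le_eqVlt; apply/orP; left; apply/eqP; apply: eq_Rintegral => x _; rewrite expr1 mulrC.
apply: (@le_trans _ _ (1 * \int[mu]_x (grad2 (pderiv i chi) x * regw e x ^+ 0))).
  apply: ler_wpM2r.
    by apply: Rintegral_ge0 => x _; rewrite expr0 mulr1 grad2_ge0.
  have n2 : 0 < n%:R - 2 * 1%:R :> R by have := n4_gt0; rewrite mulr1; lra.
  rewrite expr_le1// ?divr_ge0// ?(ltW n2)// ler_pdivrMr// mul1r mulr1.
  have n5' : 5 <= n%:R :> R by rewrite ler_nat.
  by move: n5'; lra.
rewrite mul1r; under eq_Rintegral do rewrite expr0 mulr1.
rewrite -Rintegral_sum// => j; apply: test_integrable; apply: test_sqr.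
exact: test_pderiv.
Qed.

Lemma energy_le_D22_norm2 (e : R) chi : 0 < e -> test_function chi ->
  \int[mu]_x (grad2 chi x * regw e x) <= D22_norm2 chi.
Proof.
move=> e0 tc.
have -> : \int[mu]_x (grad2 chi x * regw e x) =
    \sum_(i < n) \int[mu]_x (regw e x * pderiv i chi x ^+ 2).
  rewrite -Rintegral_sum => [|i].
    by apply: eq_Rintegral => x _; rewrite /grad2 mulrC mulr_sumr.
  apply: test_integrable; apply: testMl; first exact: smooth_regw.
  by apply: test_sqr; exact: test_pderiv.
rewrite /D22_norm2 exchange_big/=; apply: ler_sum => i _.
exact: hardy_pderiv.
Qed.

Lemma energy_pderiv_le_D22_norm2 (e : R) i chi : 0 < e -> test_function chi ->
  \int[mu]_x (regw e x * pderiv i chi x ^+ 2) <= D22_norm2 chi.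
Proof.
move=> e0 tc; apply: le_trans (energy_le_D22_norm2 e0 tc).
apply: le_Rintegral => //.
- apply: test_integrable; apply: testMl; first exact: smooth_regw.
  by apply: test_sqr; exact: test_pderiv.
- by apply: test_integrable; exact: test_energy_density.
- move=> x _; rewrite mulrC ler_wpM2r ?(ltW (regw_gt0 _ _))// /grad2 (bigD1 i)//= lerDl.
  by apply: sumr_ge0 => j _; exact: sqr_ge0.
Qed.

(** Expand the sum of the squares of n a_i - s, where s is the sum of the a_i. *)
Lemma sqr_sum_le (a : 'I_n -> R) : (\sum_(i < n) a i) ^+ 2 <= n%:R * \sum_(i < n) a i ^+ 2.
Proof.
set s := \sum_(i < n) a i.
have sE : \sum_(i < n) a i = s by []. clearbody s.
have : 0 <= \sum_(i < n) (n%:R * a i - s) ^+ 2 by apply: sumr_ge0 => i _; exact: sqr_ge0.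
have -> : \sum_(i < n) (n%:R * a i - s) ^+ 2 =
    n%:R * (n%:R * \sum_(i < n) a i ^+ 2 - s ^+ 2).
  transitivity (n%:R ^+ 2 * (\sum_(i < n) a i ^+ 2) - 2 * n%:R * s * (\sum_(i < n) a i) +
     s ^+ 2 * \sum_(i < n) 1).
    rewrite !mulr_sumr -sumrB -big_split/=; apply: eq_bigr => i _; ring.
  by rewrite sE sumr_const card_ord; ring.
by rewrite pmulr_rge0// subr_ge0.
Qed.

Lemma laplacian_le_D22_norm2 chi : test_function chi ->
  \int[mu]_x (laplacian chi x ^+ 2) <= n%:R * D22_norm2 chi.
Proof.
move=> tc.
have it i : mu.-integrable setT (EFin \o (fun x => pderivs [:: i; i] chi x ^+ 2)).
  by apply: test_integrable; apply: test_sqr; exact: test_pderivs.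
apply: (@le_trans _ _ (n%:R * \sum_(i < n) \int[mu]_x (pderivs [:: i; i] chi x ^+ 2))).
  rewrite -Rintegral_sum// -RintegralZl//; last first.
    apply: test_integrable; apply: (@test_sum _ _ _ _ (fun i x => pderivs [:: i; i] chi x ^+ 2)) => i.
    by apply: test_sqr; exact: test_pderivs.
  apply: le_Rintegral => //.
  - by apply: test_integrable; apply: test_sqr; exact: test_laplacian.
  - apply: test_integrable; apply: testMl; first exact: smooth_cst.
    apply: (@test_sum _ _ _ _ (fun i x => pderivs [:: i; i] chi x ^+ 2)) => i.
    by apply: test_sqr; exact: test_pderivs.
  - by move=> x _; exact: sqr_sum_le.
rewrite ler_pM2l//; apply: ler_sum => i _; rewrite (bigD1 i)//= lerDl.
by apply: sumr_ge0 => j _; exact: D22_norm2_term_ge0.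
Qed.

Lemma laplacian_symm f psi : test_function f -> test_function psi ->
  \int[mu]_x (f x * laplacian psi x) = \int[mu]_x (laplacian f x * psi x).
Proof.
move=> tf tp; have sf := test_smooth tf.
rewrite /laplacian; under eq_Rintegral do rewrite mulr_sumr.
under [RHS]eq_Rintegral do rewrite mulr_suml.
rewrite !Rintegral_sum.
- apply: eq_bigr => i _; have [_ _ /(_ _ tp) ->] := test_weak_deriv2 i tf.
  by rewrite sqrrN expr1n mul1r.
- by move=> i; exact: test_integrable (testMl (test_smooth (test_pderivs [:: i; i] tf)) tp).
- by move=> i; exact: test_integrable (testMl sf (test_pderivs [:: i; i] tp)).
Qed.

Lemma loc_integrable_sum (h : 'I_n -> 'rV[R]_n -> R) : (forall i, loc_integrable (h i)) ->
  loc_integrable (fun x => \sum_(i < n) h i x).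
Proof.
move=> lh.
have mh : measurable_fun setT (fun x => \sum_(i < n) h i x).
  by apply: measurable_sum => i; exact: (lh i).1.
split=> // K cK; have mK := compact_measurable_rV cK.
apply: (@le_lt_trans _ _ (\int[mu]_(x in K) (\sum_(i < n) `|(h i x)%:E|)%E)%E).
  apply: ge0_le_integral => //.
  - by apply: measurable_funTS; apply/measurable_EFinP; apply: measurableT_comp.
  - apply: emeasurable_sum => i; apply: measurable_funTS; apply/measurable_EFinP.
    by apply: measurableT_comp => //; exact: (lh i).1.
  - by move=> x _; rewrite /= sumEFin lee_fin; exact: ler_norm_sum.
rewrite ge0_integral_sum//; last first.
  move=> i; apply: measurable_funTS; apply/measurable_EFinP.
  by apply: measurableT_comp => //; exact: (lh i).1.
by apply: lte_sum_pinfty => i _; exact: (lh i).2.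
Qed.

Lemma weak_laplacian_integral u l psi : is_weak_laplacian u l -> test_function psi ->
  [/\ loc_integrable u, loc_integrable l &
  \int[mu]_x (l x * psi x) = \int[mu]_x (u x * laplacian psi x)].
Proof.
move=> [h hw ->] tp.
(* Local integrability of [u] is recorded in the components of the weak Laplacian, so an index is
   taken from n > 0. *)
have lu : loc_integrable u by have [] := hw (Ordinal n_gt0).
have lh i : loc_integrable (h i) by have [] := hw i.
split => //; first exact: loc_integrable_sum.
have [M _ pM] := test_vanish tp.
have cp f : test_function f -> continuous f.
  by move=> tf; apply: smooth_continuous; exact: test_smooth.
under eq_Rintegral do rewrite mulr_suml.
under [RHS]eq_Rintegral do rewrite /laplacian mulr_sumr.
rewrite !Rintegral_sum.
- apply: eq_bigr => i _; have [_ _ /(_ _ tp) ->] := hw i.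
  by rewrite sqrrN expr1n mul1r.
- move=> i; have [N _ pN] := test_vanish (test_pderivs [:: i; i] tp).
  by apply: (loc_integrable_mul lu _ pN); apply: cp; exact: test_pderivs.
- by move=> i; apply: (loc_integrable_mul (lh i) _ pM); exact: cp.
Qed.

End energies.

(** * Energies along an approximating sequence *)

Section approximation.
Context {R : realType} {n : nat}.
Hypothesis n5 : (5 <= n)%N.
Local Notation mu := (lebesgue_rV R n).
Local Notation p := (crit_exp R n).
Implicit Types (f h psi chi : 'rV[R]_n -> R).

Let n_gt0 : (0 < n)%N. Proof. exact: leq_trans n5. Qed.
Let nR_gt0 : 0 < n%:R :> R. Proof. by rewrite ltr0n. Qed.
Let p_ge1 : 1 <= p. Proof. by have := crit_exp_gt2 (R := R) n5; lra. Qed.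

Variables (u : 'rV[R]_n -> R) (phi : nat -> 'rV[R]_n -> R).
Hypothesis tphi : forall k, test_function (phi k).
Hypothesis cphi : D22_cauchy phi.
Hypothesis uphi : (\int[mu]_x (`|phi k x - u x| `^ p)%:E)%E @[k --> \oo] --> 0%E.

Lemma laplacian_sub k m x :
  laplacian (phi k \- phi m) x = laplacian (phi k) x - laplacian (phi m) x.
Proof.
rewrite /laplacian -sumrB; apply: eq_bigr => i _.
by rewrite pderivs_subr//; exact: test_smooth.
Qed.

Lemma pderiv_sub i k m x :
  pderiv i (phi k \- phi m) x = pderiv i (phi k) x - pderiv i (phi m) x.
Proof.
rewrite -[LHS]/(pderivs [:: i] (phi k \- phi m) x).
by rewrite pderivs_subr//; exact: test_smooth.
Qed.

(** [weak_lower_bound] with weight 1 tests [l] against the Laplacian of a late approximant, itself a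
    test function; the pairings converge once a second Laplacian is moved onto it. The Sobolev
    inequality of the approximants can thus be compared with the energy of [u]. *)
Lemma D22_laplacian_lower l (e : R) : is_weak_laplacian u l -> 0 < e ->
  exists N, forall m, (N <= m)%N ->
    ((\int[mu]_x (laplacian (phi m) x ^+ 2))%:E <= \int[mu]_x (l x ^+ 2)%:E + e%:E)%E.
Proof.
move=> wl e0.
have [foo|foo] := eqVneq (\int[mu]_x (l x ^+ 2)%:E)%E +oo%E.
  by exists 0%N => m _; rewrite foo addye// leey.
have L0 : (0 <= \int[mu]_x (l x ^+ 2)%:E)%E.
  by apply: integral_ge0 => x _; rewrite lee_fin sqr_ge0.
have LE : (\int[mu]_x (l x ^+ 2)%:E)%E = (fine (\int[mu]_x (l x ^+ 2)%:E)%E)%:E.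
  by rewrite fineK// ge0_fin_numE// ltey.
set L := fine _ in LE.
have [eta [c [eta0 eta1 c0 H]]] := @le_of_weak_lower_bound _ L e (fine_ge0 L0) e0.
(* The threshold c / n absorbs the factor n of [laplacian_le_D22_norm2]. *)
have [N HN] := cphi (divr_gt0 c0 nR_gt0).
exists N => m Nm; rewrite LE -EFinD lee_fin; apply: H; rewrite -lee_fin -LE.
have tl := test_laplacian (tphi m).
have [lu ll wE] := weak_laplacian_integral n5 wl tl.
have [M _ lM] := test_vanish tl.
have cl : continuous (laplacian (phi m)) by apply: smooth_continuous; exact: test_smooth.
have F1 (g : 'rV[R]_n -> R) : (fun x => g x * (1 * laplacian (phi m) x)) =
    (fun x => g x * laplacian (phi m) x) by apply/funext => x; rewrite mul1r.
have F2 (g : 'rV[R]_n -> R) : (fun x => 1 * g x) = g by apply/funext => x; rewrite mul1r.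
have -> : \int[mu]_x (laplacian (phi m) x ^+ 2) = \int[mu]_x (1 * laplacian (phi m) x ^+ 2).
  by apply: eq_Rintegral => x _; rewrite mul1r.
have -> : (\int[mu]_x (l x ^+ 2)%:E = \int[mu]_x (1 * l x ^+ 2)%:E)%E.
  by apply: eq_integral => x _; rewrite mul1r.
apply: (@weak_lower_bound R n l (fun=> 1) (laplacian (phi m))
  (fun k => laplacian (phi k)) c eta N).
- exact: ll.1.
- exact: measurable_cst.
- by [].
- by [].
- rewrite F1; exact: (loc_integrable_mul ll cl lM).
- rewrite (F2 (fun x => laplacian (phi m) x ^+ 2)); exact: (test_integrable (test_sqr tl)).
- move=> k; rewrite F1.
  exact: (test_integrable (testMl (test_smooth (test_laplacian (tphi k))) tl)).
- move=> k; rewrite (F2 (fun x => (laplacian (phi k) x - laplacian (phi m) x) ^+ 2)).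
  exact: (test_integrable (test_sqr (testB (test_laplacian (tphi k)) tl))).
- have E1 (g : 'rV[R]_n -> R) : \int[mu]_x (g x * (1 * laplacian (phi m) x)) =
      \int[mu]_x (g x * laplacian (phi m) x).
    by apply: eq_Rintegral => x _; rewrite mul1r.
  rewrite E1 wE (_ : (fun k => _) = (fun k => \int[mu]_x (phi k x * laplacian (laplacian (phi m)) x))).
    exact: (cvg_integral_test p_ge1 lu tphi uphi (test_laplacian tl)).
  by apply/funext => k; rewrite E1; exact: (esym (laplacian_symm (tphi k) tl)).
- move=> k Nk.
  have -> : \int[mu]_x (1 * (laplacian (phi k) x - laplacian (phi m) x) ^+ 2) =
      \int[mu]_x (laplacian (phi k \- phi m) x ^+ 2).
    by apply: eq_Rintegral => x _; rewrite mul1r laplacian_sub.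
  apply: le_trans (laplacian_le_D22_norm2 n5 (testB (tphi k) (tphi m))) _.
  rewrite mulrC -(ler_pdivlMr _ _ nR_gt0); apply: ltW; exact: HN.
Qed.

(** The tested function is the weight times the derivative of [phi m], again a test function, so one
    integration by parts reduces the pairings to convergence of [phi] to [u]. *)
Lemma D22_pderiv_lower i h (d eta c : R) (N m : nat) : is_weak_deriv [:: i] u h ->
  0 < d -> 0 < eta ->
  (forall k, (N <= k)%N -> D22_norm2 (phi k \- phi m) <= c) ->
  (((1 - eta) * \int[mu]_x (regw d x * pderiv i (phi m) x ^+ 2) - c / eta)%:E <=
   \int[mu]_x (regw d x * h x ^+ 2)%:E)%E.
Proof.
move=> [lu lh wE] d0 eta0 Hc.
have tp := test_pderiv i (tphi m).
have sw := smooth_regw (n := n) d0.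
have twp : test_function (fun x => regw d x * pderiv i (phi m) x) by exact: testMl.
have [M _ lM] := test_vanish twp.
have cwp := smooth_continuous (test_smooth twp).
apply: (@weak_lower_bound R n h (regw d) (pderiv i (phi m)) (fun k => pderiv i (phi k)) c eta N) => //.
- exact: lh.1.
- by apply: continuous_measurable_rV; exact: smooth_continuous.
- by move=> x; exact/ltW/regw_gt0.
- exact: loc_integrable_mul lh cwp lM.
- exact: test_integrable (testMl sw (test_sqr tp)).
- by move=> k; exact: test_integrable (testMl (test_smooth (test_pderiv i (tphi k))) twp).
- move=> k.
  exact: test_integrable (testMl sw (test_sqr (testB (test_pderiv i (tphi k)) tp))).
- have -> : \int[mu]_x (h x * (regw d x * pderiv i (phi m) x)) =
      - \int[mu]_x (u x * pderiv i (fun x => regw d x * pderiv i (phi m) x) x).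
    by rewrite (wE _ twp) expr1 mulN1r opprK.
  have E k : \int[mu]_x (pderiv i (phi k) x * (regw d x * pderiv i (phi m) x)) =
      - \int[mu]_x (phi k x * pderiv i (fun x => regw d x * pderiv i (phi m) x) x).
    by rewrite (integral_by_parts _ (test_smooth (tphi k)) twp) opprK.
  rewrite (_ : (fun k => _) = (fun k => - \int[mu]_x (phi k x *
      pderiv i (fun x => regw d x * pderiv i (phi m) x) x))); last exact/funext.
  apply: cvgN.
  exact: (cvg_integral_test p_ge1 lu tphi uphi (test_pderiv i twp)).
- move=> k Nk.
  have -> : \int[mu]_x (regw d x * (pderiv i (phi k) x - pderiv i (phi m) x) ^+ 2) =
      \int[mu]_x (regw d x * pderiv i (phi k \- phi m) x ^+ 2).
    by apply: eq_Rintegral => x _; rewrite pderiv_sub.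
  apply: le_trans (Hc k Nk).
  exact: (energy_pderiv_le_D22_norm2 n5 i d0 (testB (tphi k) (tphi m))).
Qed.

Lemma regw_le_enorm (d : R) (x : 'rV[R]_n) : 0 < d -> 0 < enorm x -> regw d x <= enorm x ^- 2.
Proof.
move=> d0 x0; rewrite /regw -sqr_enorm lef_pV2 ?posrE ?exprn_gt0//.
  by rewrite lerDl ltW.
by rewrite addr_gt0// exprn_gt0.
Qed.

Lemma ae_enorm_gt0 : {ae mu, forall x : 'rV[R]_n, 0 < enorm x}.
Proof.
exists (~` @punctured R n); split.
- exact: (measurableC (@measurable_punctured R n)).
- exact: (lebesgue_not_punctured n_gt0).
- by move=> x.
Qed.

(** [N] precedes [d] because the energy of the differences is bounded by the D22 norm whatever the
    regularisation. The loss c is shared equally among the n directions. *)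
Lemma D22_grad_lower g (e : R) : is_weak_grad u g -> 0 < e ->
  exists N, forall m, (N <= m)%N -> forall d, 0 < d ->
    ((\int[mu]_x (grad2 (phi m) x * regw d x))%:E <=
     \int[mu]_x (enorm x ^- 2 * \sum_(i < n) g i x ^+ 2)%:E + e%:E)%E.
Proof.
move=> wg e0.
set J := (\int[mu]_x (enorm x ^- 2 * \sum_(i < n) g i x ^+ 2)%:E)%E.
have [foo|foo] := eqVneq J +oo%E.
  by exists 0%N => m _ d _; rewrite foo addye// leey.
have mg i : measurable_fun setT (g i) by have [_ []] := wg i.
have sg0 x : 0 <= \sum_(i < n) g i x ^+ 2 by apply: sumr_ge0 => i _; exact: sqr_ge0.
have Jx0 x : 0 <= enorm x ^- 2 * \sum_(i < n) g i x ^+ 2.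
  by rewrite mulr_ge0// invr_ge0 sqr_ge0.
have L0 : (0 <= J)%E by apply: integral_ge0 => x _; rewrite lee_fin.
have LE : J = (fine J)%:E by rewrite fineK// ge0_fin_numE// ltey.
have [eta [c [eta0 eta1 c0 H]]] := @le_of_weak_lower_bound _ (fine J) e (fine_ge0 L0) e0.
have [N HN] := cphi (divr_gt0 c0 nR_gt0).
exists N => m Nm d d0; rewrite LE -EFinD lee_fin; apply: H; rewrite -lee_fin -LE.
have sw := smooth_regw (n := n) d0.
have mw : measurable_fun setT (@regw R n d).
  by apply: continuous_measurable_rV; exact: smooth_continuous.
apply: (@le_trans _ _ (\sum_(i < n) \int[mu]_x (regw d x * g i x ^+ 2)%:E)%E).
  have -> : \int[mu]_x (grad2 (phi m) x * regw d x) =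
      \sum_(i < n) \int[mu]_x (regw d x * pderiv i (phi m) x ^+ 2).
    rewrite -Rintegral_sum => [|i].
      by apply: eq_Rintegral => x _; rewrite /grad2 mulrC mulr_sumr.
    exact: test_integrable (testMl sw (test_sqr (test_pderiv i (tphi m)))).
  have -> : c / eta = \sum_(i < n) ((c / n%:R) / eta).
    rewrite sumr_const card_ord -[RHS]mulr_natl; field.
    by rewrite !gt_eqF.
  rewrite mulr_sumr -sumrB -sumEFin; apply: lee_sum => i _.
  apply: (D22_pderiv_lower (N := N)) => // k Nk.
  exact/ltW/HN.
rewrite -ge0_integral_sum//; last 2 first.
- by move=> i; apply/measurable_EFinP; apply: measurable_funM => //; exact: measurable_funX.
- by move=> i x _; rewrite lee_fin mulr_ge0 ?sqr_ge0// ltW// regw_gt0.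
apply: ae_ge0_le_integral => //.
- by move=> x _; apply: sume_ge0 => i _; rewrite lee_fin mulr_ge0 ?sqr_ge0// ltW// regw_gt0.
- apply: emeasurable_sum => i.
  by apply/measurable_EFinP; apply: measurable_funM => //; exact: measurable_funX.
- by move=> x _; rewrite lee_fin.
- apply/measurable_EFinP; apply: measurable_funM.
    rewrite (_ : (fun _ => _) = fun x => enorm x `^ (- 2%:R)).
      exact: (measurableT_comp (@measurable_powR R (- 2%:R)) measurable_enorm).
    by apply/funext => x; rewrite powR_invn// enorm_ge0.
  by apply: measurable_sum => i; exact: measurable_funX.
have := ae_enorm_gt0; apply: filterS => x x0 _.
rewrite sumEFin lee_fin -mulr_sumr ler_wpM2r//.
exact: regw_le_enorm.
Qed.

(** A Cauchy sequence is bounded: |b|^2 <= 2 |a|^2 + 2 |b - a|^2 with the fixed term [phi N]. This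
    crude bound yields finiteness of the integrals of [u] even when its gradient energy is
    infinite. *)
Lemma D22_energy_bounded : exists B N, [/\ 0 < B & forall m, (N <= m)%N -> forall d, 0 < d ->
  \int[mu]_x (grad2 (phi m) x * regw d x) <= B].
Proof.
have [N HN] := cphi ltr01.
have D0 k m : 0 <= D22_norm2 (phi k \- phi m).
  by rewrite /D22_norm2; apply: sumr_ge0 => i _; apply: sumr_ge0 => j _;
    exact: D22_norm2_term_ge0.
have DN0 : 0 <= D22_norm2 (phi N).
  by rewrite /D22_norm2; apply: sumr_ge0 => i _; apply: sumr_ge0 => j _;
    exact: D22_norm2_term_ge0.
exists (2 * D22_norm2 (phi N) + 2), N; split; first by rewrite ltr_wpDl// mulr_ge0.
move=> m Nm d d0; have tD := testB (tphi m) (tphi N).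
have i1 := test_integrable (test_energy_density d0 (tphi N)).
have i2 := test_integrable (test_energy_density d0 tD).
have t1 := testMl (smooth_cst 2) (test_energy_density d0 (tphi N)).
have t2 := testMl (smooth_cst 2) (test_energy_density d0 tD).
have eD := etrans (RintegralD measurableT (test_integrable t1) (test_integrable t2))
  (congr2 +%R (RintegralZl 2 measurableT i1) (RintegralZl 2 measurableT i2)).
have h : \int[mu]_x (grad2 (phi m) x * regw d x) <=
    \int[mu]_x (2 * (grad2 (phi N) x * regw d x) + 2 * (grad2 (phi m \- phi N) x * regw d x)).
  apply: le_Rintegral measurableT _ (test_integrable (testD t1 t2)) _.
    exact: (test_integrable (test_energy_density d0 (tphi m))).
  move=> x _; rewrite !mulrA -mulrDl ler_wpM2r ?(ltW (regw_gt0 _ _))//.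
  rewrite /grad2 !mulr_sumr -big_split/=; apply: ler_sum => i _.
  rewrite pderiv_sub -subr_ge0.
  set a := pderiv i (phi N) x; set b := pderiv i (phi m) x.
  have -> : 2 * a ^+ 2 + 2 * (b - a) ^+ 2 - b ^+ 2 = (2 * a - b) ^+ 2 by ring.
  exact: sqr_ge0.
apply: (le_trans h); rewrite eD.
apply: lerD; first by rewrite ler_pM2l// energy_le_D22_norm2.
rewrite -[leRHS]mulr1 ler_pM2l//; apply: le_trans (energy_le_D22_norm2 n5 d0 tD) _.
exact/ltW/HN.
Qed.

End approximation.

Lemma fatou_le d (T : measurableType d) (R : realType) (m : {measure set T -> \bar R})
    (F : nat -> T -> R) (G : T -> R) (b : \bar R) (K : nat) :
  (forall k, measurable_fun setT (F k)) -> measurable_fun setT G ->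
  (forall k x, 0 <= F k x) -> (forall x, 0 <= G x) ->
  {ae m, forall x, F k x @[k --> \oo] --> G x} ->
  (forall k, (K <= k)%N -> \int[m]_x (F k x)%:E <= b)%E ->
  (\int[m]_x (G x)%:E <= b)%E.
Proof.
move=> mF mG F0 G0 [N [mN N0 NP]] Fb.
(* Removing the exceptional null set makes the convergence pointwise. *)
rewrite (@ge0_negligible_integral _ _ _ m setT N)//; last 2 first.
- exact/measurable_EFinP.
- by move=> x _; rewrite lee_fin.
have mTN : measurable (setT `\` N) by exact: measurableD.
have mFE k : measurable_fun (setT `\` N) (fun x => (F k x)%:E).
  by apply: measurable_funTS; exact/measurable_EFinP.
have -> : (\int[m]_(x in setT `\` N) (G x)%:E =
    \int[m]_(x in setT `\` N) limn_einf (fun k => (F k x)%:E))%E.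
  apply: eq_integral => x; rewrite inE => -[_ xN]; apply/esym.
  have cx : F k x @[k --> \oo] --> G x by apply: contrapT => h; apply: xN; exact: NP.
  have ce : (F k x)%:E @[k --> \oo] --> (G x)%:E by apply: cvg_EFin => //; exact: nearW.
  rewrite is_cvg_limn_einfE; first exact: cvg_lim ce.
  by apply/cvg_ex; exists (G x)%:E.
apply: le_trans (fatou m mTN mFE _) _; first by move=> k x _; rewrite lee_fin.
rewrite limn_einf_lim; apply: lime_le; first exact: is_cvg_einfs.
(* The infimum over the tail from [k] is at most the term of index [maxn K k], where the bound
   holds. *)
apply: nearW => k; apply: le_trans (Fb (maxn K k) (leq_maxl _ _)).
apply: le_trans (ge0_subset_integral _ mTN measurableT _ _ _) => //.
- by apply: ereal_inf_lbound; exists (maxn K k) => //=; exact: leq_maxr.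
- exact/measurable_EFinP.
- by move=> x _; rewrite lee_fin.
Qed.

(** * Limits on spheres *)

Section radial_functions.
Context {R : realType} {n : nat}.
Hypothesis n5 : (5 <= n)%N.
Local Notation mu := (lebesgue_rV R n).
Local Notation sigma := (@sphere_measure R n).
Local Notation gam := ((n%:R - 4) / 2 : R).

Let n_gt0 : (0 < n)%N. Proof. exact: leq_trans n5. Qed.
Let nR_gt0 : 0 < n%:R :> R. Proof. by rewrite ltr0n. Qed.
Let n4_gt0 : 0 < n%:R - 4 :> R. Proof. by rewrite subr_gt0 ltr_nat. Qed.

Variables (psi : nat -> 'rV[R]_n -> R) (B : R) (K : nat).
Hypothesis tpsi : forall k, test_function (psi k).
Hypothesis B0 : 0 < B.
Hypothesis psiB : forall m, (K <= m)%N -> forall d, 0 < d ->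
  \int[mu]_x (grad2 (psi m) x * regw d x) <= B.

Let kappa := fine (sigma setT).

Lemma sphere_measure_fine : sigma setT = kappa%:E.
Proof. by rewrite fineK// ge0_fin_numE// sphere_measure_lty. Qed.

Lemma kappa_gt0 : 0 < kappa.
Proof. by rewrite -lte_fin -sphere_measure_fine; exact: sphere_measure_gt0. Qed.

(** What [sphere_average_bound] leaves after division by the mass [kappa], for t = r^(-gam)
    B^(-1/2): the first term comes from the energy, the second from the power of r. *)
Definition radial_cst : R := (n%:R * kappa)^-1 + (2 * (n%:R - 4))^-1.

Lemma radial_cst_gt0 : 0 < radial_cst.
Proof. by rewrite addr_gt0// invr_gt0 mulr_gt0// kappa_gt0. Qed.

(** Fatou's lemma on the sphere of radius [r] passes the mean bound of the approximants to their
    constant limit. *)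
Lemma sphere_limit_le (r v : R) : 0 < r ->
  {ae sigma, forall w, psi k (r *: w) @[k --> \oo] --> v} ->
  `|v| <= radial_cst * B `^ 2^-1 * r `^ (- gam).
Proof.
move=> r0 cv; have k0 := kappa_gt0.
set b := B `^ 2^-1; set g := r `^ (- gam).
have b0 : 0 < b by exact: powR_gt0.
have g0 : 0 < g by exact: powR_gt0.
have bb : b * b = B.
  rewrite /b -powRD; last by rewrite (gt_eqF B0) implybT.
  have -> : 2^-1 + 2^-1 = 1 :> R by field.
  by rewrite powRr1// ltW.
have gg : r `^ (4 - n%:R) = g * g.
  by rewrite /g -powRD; [congr (_ `^ _); field|rewrite (gt_eqF r0) implybT].
have key : ((`|v| * kappa)%:E <= (g / b / n%:R * B + g * g / (2 * (g / b) * (n%:R - 4)) * kappa)%:E)%E.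
  have -> : (`|v| * kappa)%:E = (\int[sigma]_w `|v|%:E)%E.
    by rewrite EFinM -[X in (_ * X)%E]sphere_measure_fine integral_cst.
  apply: (@fatou_le _ _ _ sigma (fun k w => `|psi k (r *: w)|) (fun=> `|v|) _ K) => //.
  - move=> k; apply: measurableT_comp => //.
    apply: (measurableT_comp _ (measurable_scale r)).
    by apply: continuous_measurable_rV; apply: smooth_continuous; exact: test_smooth.
  - by move: cv; apply: filterS => w; exact: cvg_norm.
  - move=> k Kk; have r20 : 0 < r ^+ 2 by rewrite exprn_gt0.
    (* The value e = r^2 is the largest that the ray bound allows, and t = g / b gives both terms
       the same order B^(1/2) r^(-gam). *)
    apply: le_trans (sphere_average_bound n5 (tpsi k) r20 r0 (lexx _) (divr_gt0 g0 b0)) _.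
    rewrite EFinD [in leRHS]EFinM (EFinM _ kappa) -gg -sphere_measure_fine.
    apply: leeD => //; apply: lee_wpmul2l.
      by rewrite lee_fin !divr_ge0// ltW.
    have E := test_integrable (test_energy_density r20 (tpsi k)).
    rewrite -[X in (X <= _)%E]fineK; last exact: (integrable_fin_num measurableT E).
    by rewrite lee_fin; exact: psiB.
move: key; rewrite lee_fin -ler_pdivlMr// => /le_trans; apply.
rewrite le_eqVlt; apply/orP; left; apply/eqP; rewrite /radial_cst -bb.
by field; rewrite !gt_eqF.
Qed.

End radial_functions.

Lemma ae_imp d (T : measurableType d) (R : realType) (m : {measure set T -> \bar R})
    (P Q : T -> Prop) :
  (forall x, P x -> Q x) -> {ae m, forall x, P x} -> {ae m, forall x, Q x}.
Proof. by move=> PQ; apply: filterS. Qed.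

Lemma ae_and d (T : measurableType d) (R : realType) (m : {measure set T -> \bar R})
    (P Q : T -> Prop) :
  {ae m, forall x, P x} -> {ae m, forall x, Q x} -> {ae m, forall x, P x /\ Q x}.
Proof. by move=> aP aQ; exact: filterI. Qed.

(** * Radial functions *)

Section radial_estimates.
Context {R : realType} {n : nat}.
Hypothesis n5 : (5 <= n)%N.
Local Notation mu := (lebesgue_rV R n).
Local Notation sigma := (@sphere_measure R n).
Local Notation gam := ((n%:R - 4) / 2 : R).
Local Notation rcst := (@radial_cst R n).

Let n_gt0 : (0 < n)%N. Proof. exact: leq_trans n5. Qed.

Variables (u : 'rV[R]_n -> R) (psi : nat -> 'rV[R]_n -> R) (B : R) (K : nat).
Hypothesis mu_ : measurable_fun setT u.
Hypothesis tpsi : forall k, test_function (psi k).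
Hypothesis upsi : {ae mu, forall x, psi k x @[k --> \oo] --> u x}.
Hypothesis B0 : 0 < B.
Hypothesis psiB : forall m, (K <= m)%N -> forall d, 0 < d ->
  \int[mu]_x (grad2 (psi m) x * regw d x) <= B.

Lemma ae_notin_null d (T : measurableType d) (m : {measure set T -> \bar R}) (N : set T) :
  measurable N -> m N = 0%E -> {ae m, forall x, ~ N x}.
Proof. by move=> mN N0; exists N; split => // x /contrapT. Qed.

Lemma ae_indic_null d (T : measurableType d) (m : {measure set T -> \bar R}) (f : T -> \bar R) :
  measurable_fun setT f -> (forall x, 0 <= f x)%E -> (\int[m]_x f x = 0)%E ->
  {ae m, forall x, f x = 0%E}.
Proof.
move=> mf f0 If; have /ae_eq_integral_abs : (\int[m]_x `|f x| = 0)%E.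
  by rewrite -[RHS]If; apply: eq_integral => x _; rewrite gee0_abs.
by move=> /(_ measurableT mf); apply: filterS => x; exact.
Qed.

(* Strauss' radial lemma: by Fubini in polar coordinates, almost every [x] lies on a sphere
   on which the [psi k] converge almost everywhere to the constant value [u x]. *)
Lemma radial_pointwise_bound : radial u ->
  {ae mu, forall x, `|u x| <= rcst * B `^ 2^-1 * enorm x `^ (- gam)}.
Proof.
move=> [f uf]; have [N [mN N0 NP]] := ae_and uf upsi.
have mFN : measurable_fun setT (fun x => (\1_N x : R)%:E) by exact/measurable_EFinP.
have FN0 x : (0 <= (\1_N x : R)%:E)%E by rewrite lee_fin.
have mFNP : measurable_fun setT (fun q => (\1_N (polar_inv q) : R)%:E) :=
  measurableT_comp mFN (@measurable_polar_inv R n).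
(* In polar coordinates the null set [N] has a null trace on almost every sphere. *)
have I0 : (\int[lebesgue_halfline]_s \int[sigma]_w (\1_N (polar_inv (s, w)) : R)%:E = 0)%E.
  by rewrite -(polar_formula n_gt0 mFN FN0) integral_indic// setIT.
have mH : measurable_fun setT (fun s => \int[sigma]_w (\1_N (polar_inv (s, w)) : R)%:E)%E.
  exact: (@measurable_fun_fubini_tonelli_F _ _ _ _ R sigma _ mFNP (fun q => FN0 _)).
have H0 s : (0 <= \int[sigma]_w (\1_N (polar_inv (s, w)) : R)%:E)%E.
  by apply: integral_ge0 => w _.
have [Z [mZ Z0 ZP]] := ae_indic_null mH H0 I0.
have a1 := ae_notin_null mN N0.
have a2 := ae_enorm_gt0 n5 (R := R).
(* [Z] holds the exceptional radii in the variable |x|^n; the points with such a radius are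
   negligible, so almost every [x] lies on a good sphere. *)
have a3 : {ae mu, forall x, ~ [/\ 0 < enorm x, Z (enorm x ^+ n) & setT (dir x)]}.
  apply: (@ae_notin_null _ _ mu [set x | [/\ 0 < enorm x, Z (enorm x ^+ n) & setT (dir x)]]).
    rewrite (_ : mkset _ = punctured `&` (fun x => enorm x ^+ n) @^-1` Z).
      apply: measurableI; first exact: measurable_punctured.
      by rewrite -[X in measurable X]setTI; exact: measurable_enormX.
    by apply/seteqP; split => x; [move=> []|move=> [] *; split].
  by apply: (etrans (lebesgue_sector n_gt0 mZ measurableT)); rewrite Z0 mul0e.
have a4 : {ae mu, forall x, ~ N x /\ 0 < enorm x /\
  ~ [/\ 0 < enorm x, Z (enorm x ^+ n) & setT (dir x)]} := ae_and a1 (ae_and a2 a3).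
apply: (ae_imp _ a4) => x [xN [x0 xZ]].
apply: (sphere_limit_le n5 tpsi B0 psiB x0).
have HZ : (\int[sigma]_w (\1_N (polar_inv ((enorm x ^+ n : measurableTypeR R), w)) : R)%:E = 0)%E.
  by apply: contrapT => h; apply: xZ; split => //; apply: ZP.
have mFNw : measurable_fun setT
    (fun w => (\1_N (polar_inv ((enorm x ^+ n : measurableTypeR R), w)) : R)%:E).
  exact: (measurableT_comp mFNP (measurable_pair1 _)).
have b1 := ae_indic_null mFNw (fun w => FN0 _) HZ.
have b2 : {ae sigma, forall w, ~ (enorm w != 1)}.
  apply: (@ae_notin_null _ _ sigma [set w | enorm w != 1]).
    rewrite (_ : mkset _ = ~` [set x | enorm x \in `[(1 : R), (1 : R)]]).
      exact: (measurableC (@measurable_enorm_itv R n _)).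
    by apply/seteqP; split => y /=; rewrite in_itv/= -eq_le eq_sym => /negP.
  exact: sphere_measure_enorm1.
have b3 : {ae sigma, forall w, (\1_N (polar_inv ((enorm x ^+ n : measurableTypeR R), w)) : R)%:E = 0%E /\
  ~ (enorm w != 1)} := ae_and b1 b2.
apply: (ae_imp _ b3) => w [w1 /negP/negPn/eqP w2].
have wN : ~ N (enorm x *: w).
  move=> Nw; move: w1; rewrite /polar_inv/= exp_rootK// indicE mem_set//.
  by move=> /eqP; rewrite eqe oner_eq0.
have nu y : ~ N y -> u y = f (enorm y) /\ psi k y @[k --> \oo] --> u y.
  by move=> yN; apply: contrapT => h; apply: yN; exact: NP.
(* Both points have norm |x|, so radiality identifies the limit at |x| w with u x. *)
have [_ ] := nu _ wN; have [-> _] := nu _ wN.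
by rewrite enormZ ?(ltW x0)// w2 mulr1; have [-> _] := nu _ xN.
Qed.

(** The constant of [hardy] for b = 1. *)
Definition rellich_cst : R := (2 / (n%:R - 4)) ^+ 2.

(** [hardy] with b = 1 for the approximants, then Fatou's lemma twice: along the sequence at a fixed
    regularisation, and as the regularisation tends to 0. *)
Lemma weighted_norm_bound : (\int[mu]_x (enorm x ^- 4 * u x ^+ 2)%:E <= (rellich_cst * B)%:E)%E.
Proof.
have mue : measurable_fun setT (fun x : 'rV[R]_n => enorm x ^- 4).
  rewrite (_ : (fun _ => _) = fun x => enorm x `^ (- 4%:R)).
    exact: (measurableT_comp (@measurable_powR R (- 4%:R)) measurable_enorm).
  by apply/funext => x; rewrite powR_invn// enorm_ge0.
have mw (d : R) : 0 < d -> measurable_fun setT (fun x : 'rV[R]_n => regw d x ^+ 2).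
  move=> d0; apply: continuous_measurable_rV; apply: smooth_continuous.
  by apply: smoothX; exact: smooth_regw.
have d0 (k : nat) : 0 < k.+1%:R^-1 :> R by rewrite invr_gt0.
apply: (@fatou_le _ _ _ mu (fun k x => regw k.+1%:R^-1 x ^+ 2 * u x ^+ 2) _ _ 0%N).
- by move=> k; apply: measurable_funM; [exact: mw|exact: measurable_funX].
- by apply: measurable_funM => //; exact: measurable_funX.
- by move=> k x; rewrite mulr_ge0 ?sqr_ge0.
- by move=> x; rewrite mulr_ge0 ?sqr_ge0// invr_ge0 exprn_ge0// enorm_ge0.
- have := ae_enorm_gt0 n5 (R := R); apply: filterS => x x0.
  apply: cvgM; last exact: cvg_cst.
  have -> : enorm x ^- 4 = (enorm x ^+ 2 + 0)^-1 ^+ 2 by rewrite addr0 exprVn -exprM.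
  rewrite expr2; under eq_fun do rewrite expr2 /regw -sqr_enorm.
  suff h : (enorm x ^+ 2 + k.+1%:R^-1)^-1 @[k --> \oo] --> (enorm x ^+ 2 + 0)^-1 by exact: cvgM.
  apply: cvgV; first by rewrite addr0 gt_eqF// exprn_gt0.
  by apply: cvgD; [exact: cvg_cst|exact: cvg_harmonic].
move=> k _; apply: (@fatou_le _ _ _ mu (fun j x => regw k.+1%:R^-1 x ^+ 2 * psi j x ^+ 2) _ _ K).
- move=> j; apply: measurable_funM; first exact: mw.
  apply: measurable_funX; apply: continuous_measurable_rV; apply: smooth_continuous.
  exact: test_smooth.
- by apply: measurable_funM; [exact: mw|exact: measurable_funX].
- by move=> j x; rewrite mulr_ge0 ?sqr_ge0.
- by move=> x; rewrite mulr_ge0 ?sqr_ge0.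
- move: upsi; apply: filterS => x cx; apply: cvgM; first exact: cvg_cst.
  by rewrite expr2; under eq_fun do rewrite expr2; exact: cvgM.
move=> j Kj; have tj : test_function (fun x => psi j x ^+ 2 * regw k.+1%:R^-1 x ^+ 2).
  rewrite (_ : (fun _ => _) = fun x => regw k.+1%:R^-1 x ^+ 2 * psi j x ^+ 2).
    by apply: testMl; [apply: smoothX; exact: smooth_regw|exact: test_sqr].
  by apply/funext => x; rewrite mulrC.
have -> : (\int[mu]_x (regw k.+1%:R^-1 x ^+ 2 * psi j x ^+ 2)%:E)%E =
    (\int[mu]_x (psi j x ^+ 2 * regw k.+1%:R^-1 x ^+ 2))%:E.
  rewrite /Rintegral fineK; last exact: (integrable_fin_num measurableT (test_integrable tj)).
  by apply: eq_integral => x _; rewrite mulrC.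
rewrite lee_fin; have h := hardy (b := 1) (d0 k) n5 (tpsi j).
apply: (le_trans h); rewrite /rellich_cst.
have -> : n%:R - 2 * 2%:R = n%:R - 4 :> R by ring.
apply: ler_wpM2l; first exact: sqr_ge0.
by under eq_Rintegral do rewrite expr1; exact: psiB.
Qed.

End radial_estimates.

Section radial_critical.
Context {R : realType} {n : nat}.
Hypothesis n5 : (5 <= n)%N.
Local Notation mu := (lebesgue_rV R n).
Local Notation p := (crit_exp R n).
Local Notation gam := ((n%:R - 4) / 2 : R).
Local Notation rcst := (@radial_cst R n).

Let n4_gt0 : 0 < n%:R - 4 :> R. Proof. by rewrite subr_gt0 ltr_nat. Qed.

Lemma measurable_enormN (k : nat) : measurable_fun setT (fun x : 'rV[R]_n => enorm x ^- k).
Proof.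
rewrite (_ : (fun _ => _) = fun x => enorm x `^ (- k%:R)).
  exact: (measurableT_comp (@measurable_powR R (- k%:R)) measurable_enorm).
by apply/funext => x; rewrite powR_invn// enorm_ge0.
Qed.

Lemma crit_expB2 : p - 2 = 8 / (n%:R - 4).
Proof. by rewrite /crit_exp; field; rewrite gt_eqF. Qed.

Variables (u : 'rV[R]_n -> R) (psi : nat -> 'rV[R]_n -> R) (B : R) (K : nat).
Hypothesis mu_ : measurable_fun setT u.
Hypothesis tpsi : forall k, test_function (psi k).
Hypothesis upsi : {ae mu, forall x, psi k x @[k --> \oo] --> u x}.
Hypothesis B0 : 0 < B.
Hypothesis psiB : forall m, (K <= m)%N -> forall d, 0 < d ->
  \int[mu]_x (grad2 (psi m) x * regw d x) <= B.

Definition crit_cst : R := rcst `^ (p - 2) * @rellich_cst R n.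

Lemma crit_cst_gt0 : 0 < crit_cst.
Proof.
by rewrite mulr_gt0//; [apply: powR_gt0; exact: radial_cst_gt0|
  rewrite /rellich_cst exprn_gt0// divr_gt0].
Qed.

(** In |u|^p = |u|^(p - 2) u^2 the pointwise bound is applied to the first factor. Since gam (p - 2)
    = 4 it produces |x|^-4 and leaves the Hardy integral; the powers of B add up to (p - 2) / 2 + 1
    = p / 2. *)
Lemma radial_crit_bound : radial u ->
  (\int[mu]_x (`|u x| `^ p)%:E <= (crit_cst * B `^ (p / 2))%:E)%E.
Proof.
move=> ru; have rc0 : 0 < rcst := radial_cst_gt0 n5.
have p2 : 0 < p - 2 by rewrite crit_expB2 divr_gt0.
set A := rcst `^ (p - 2) * B `^ ((p - 2) / 2).
have A0 : 0 <= A by rewrite mulr_ge0// powR_ge0.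
have mH : measurable_fun setT (fun x : 'rV[R]_n => enorm x ^- 4 * u x ^+ 2).
  by apply: measurable_funM; [exact: measurable_enormN|exact: measurable_funX].
have H0 x : 0 <= enorm x ^- 4 * u x ^+ 2.
  by rewrite mulr_ge0 ?sqr_ge0// invr_ge0 exprn_ge0// enorm_ge0.
apply: (@le_trans _ _ (\int[mu]_x (A%:E * (enorm x ^- 4 * u x ^+ 2)%:E))%E); last first.
  rewrite ge0_integralZl_EFin//; last 2 first.
  - by move=> x _; rewrite lee_fin.
  - exact/measurable_EFinP.
  apply: (le_trans (lee_wpmul2l _ (weighted_norm_bound n5 mu_ tpsi upsi psiB))).
    by rewrite lee_fin.
  rewrite -EFinM lee_fin le_eqVlt; apply/orP; left; apply/eqP.
  rewrite /A /crit_cst.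
  have -> : B `^ (p / 2) = B `^ ((p - 2) / 2) * B.
    rewrite -[X in _ = _ * X](powRr1 (ltW B0)) -powRD; last by rewrite (gt_eqF B0) implybT.
    by congr (_ `^ _); field.
  by ring.
apply: ae_ge0_le_integral => //.
- apply/measurable_EFinP.
  by apply: (measurableT_comp (@measurable_powR R p)); exact: measurableT_comp.
- by move=> x _; rewrite mule_ge0 ?lee_fin.
- by apply: measurable_funeM; exact/measurable_EFinP.
have a := ae_and (ae_enorm_gt0 n5 (R := R)) (radial_pointwise_bound n5 tpsi upsi B0 psiB ru).
apply: ae_imp a => x [x0 ux] _; rewrite -EFinM lee_fin.
have [->|u0] := eqVneq (u x) 0.
  by rewrite normr0 powR0 ?expr0n/= ?mulr0// gt_eqF//; lra.
have nu0 : 0 < `|u x| by rewrite normr_gt0.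
have -> : `|u x| `^ p = `|u x| `^ (p - 2) * u x ^+ 2.
  rewrite -(real_normK (num_real (u x))) -powR_mulrn ?normr_ge0//.
  by rewrite -powRD; [congr (_ `^ _); ring|rewrite (gt_eqF nu0) implybT].
rewrite [leRHS]mulrA; apply: ler_wpM2r; first exact: sqr_ge0.
have h := ge0_ler_powR (ltW p2) (normr_ge0 (u x)) (le_trans (normr_ge0 _) ux) ux.
apply: (le_trans h).
rewrite !powRM ?powR_ge0 ?(ltW rc0) ?mulr_ge0 ?powR_ge0 ?(ltW rc0)//.
rewrite -!powRrM /A.
have -> : 2^-1 * (p - 2) = (p - 2) / 2 by ring.
have -> : - gam * (p - 2) = - 4%:R by rewrite crit_expB2; field; rewrite gt_eqF.
by rewrite powR_invn// ltW.
Qed.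

End radial_critical.

(** * Lower bound for the radial quotient *)

Section sobolev_constant.
Context {R : realType} {n : nat}.
Hypothesis n5 : (5 <= n)%N.
Local Notation mu := (lebesgue_rV R n).
Local Notation p := (crit_exp R n).
Implicit Types (u f : 'rV[R]_n -> R).

Let p_gt0 : 0 < p. Proof. by have := crit_exp_gt2 (R := R) n5; lra. Qed.

Lemma measurable_powR_norm d (T : measurableType d) (f : T -> R) (q : R) :
  measurable_fun setT f -> measurable_fun setT (fun x => `|f x| `^ q).
Proof.
by move=> mf; apply: (measurableT_comp (@measurable_powR R q)); exact: measurableT_comp.
Qed.

Lemma test_measurable f : test_function f -> measurable_fun setT f.
Proof. by move=> tf; apply: continuous_measurable_rV; apply: smooth_continuous; exact: test_smooth. Qed.

Lemma test_powR_integrable f (q : R) : 0 < q -> test_function f ->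
  mu.-integrable setT (EFin \o (fun x => `|f x| `^ q)).
Proof.
move=> q0 tf; have [C C0 fC] := test_bounded tf; have [M _ fM] := test_vanish tf.
apply: (@bounded_vanish_integrable _ _ _ (C `^ q) M).
- exact: measurable_powR_norm (test_measurable tf).
- move=> x; rewrite ger0_norm ?powR_ge0//.
  by apply: ge0_ler_powR; rewrite ?nnegrE ?(ltW q0) ?(ltW C0).
- by move=> x /fM ->; rewrite normr0 powR0// gt_eqF.
Qed.

(** [fine] sends an infinite integral to 0; finiteness is proved separately for test functions and
    for radial elements of [D22]. *)
Definition crit_integral f : R := fine (\int[mu]_x (`|f x| `^ p)%:E).

Lemma crit_integral_ge0 f : 0 <= crit_integral f.
Proof. by apply: fine_ge0; apply: integral_ge0 => x _; rewrite lee_fin powR_ge0. Qed.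

Lemma test_crit_integralE f : test_function f ->
  (\int[mu]_x (`|f x| `^ p)%:E)%E = (crit_integral f)%:E.
Proof.
move=> tf; rewrite fineK//.
exact: (integrable_fin_num measurableT (test_powR_integrable p_gt0 tf)).
Qed.

Definition sobolev_quotients : set R :=
  [set t | exists f, [/\ test_function f, 0 < crit_integral f &
    t = (\int[mu]_x (laplacian f x ^+ 2)) / crit_integral f `^ (2 / p)]].

Definition sobolev_cst : R := inf sobolev_quotients.

Lemma sobolev_quotients_ge0 : lbound sobolev_quotients 0.
Proof.
move=> _ [f [tf f0 ->]]; apply: divr_ge0; last exact: powR_ge0.
by apply: Rintegral_ge0 => x _; exact: sqr_ge0.
Qed.

Lemma nonzero_powR_integral_gt0 u (q : R) : 0 < q -> measurable_fun setT u -> nonzero u ->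
  (0 < \int[mu]_x (`|u x| `^ q)%:E)%E.
Proof.
move=> q0 mu_ u0; rewrite lt_neqAle integral_ge0 ?andbT; last first.
  by move=> x _; rewrite lee_fin powR_ge0.
apply/negP => /eqP/esym h; apply: u0.
have := ae_indic_null (m := mu) _ _ h; move=> /(_ _ _)/wrap[].
  by apply/measurable_EFinP; exact: measurable_powR_norm.
  by move=> x; rewrite lee_fin powR_ge0.
apply: ae_imp => x [] /powR_eq0_eq0 /eqP.
by rewrite normr_eq0 => /eqP.
Qed.

(** By the polar formula the set 0 < |x|^n <= 1/2 has half the mass of the sphere measure, hence
    positive measure, and the bump is positive on it. *)
Lemma bump_nonzero : nonzero (fun x : 'rV[R]_n => flat 0 (1 - \sum_(i < n) x ord0 i ^+ 2)).
Proof.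
move=> [N [mN N0 NP]].
have n0 : (0 < n)%N by exact: leq_trans n5.
have := lebesgue_sector_ray (R := R) n0 2^-1 (@measurableT _ 'rV[R]_n).
rewrite lebesgue_halflineE (_ : _ `&` _ = `]0, 2^-1]%classic); last first.
  apply/seteqP; split => x; rewrite /halfline/= !in_itv/= ?andbT.
    by move=> [-> ->].
  by move=> /andP[-> ->].
rewrite lebesgue_measure_itv/= lte_fin invr_gt0 ltr0n/= sube0 => h.
have : (0 < (2^-1 : R)%:E * @sphere_measure R n setT)%E.
  by rewrite mule_gt0 ?lte_fin//; exact: sphere_measure_gt0.
rewrite -h; apply/negP; rewrite -leNgt -N0; apply: le_measure; rewrite ?inE//.
  rewrite (_ : mkset _ = punctured `&` (fun x => enorm x ^+ n) @^-1` `]-oo, 2^-1]%classic).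
    apply: measurableI; first exact: measurable_punctured.
    by rewrite -[X in measurable X]setTI; apply: measurable_enormX; first exact: measurableT; exact: measurable_itv.
  apply/seteqP; split => x /=; rewrite in_itv/=.
    by move=> [].
  by move=> [? ?]; split.
move=> x [/= x0 xn _]; apply: NP => /=; apply/eqP; rewrite gt_eqF// flat_gt0//.
rewrite -sqr_enorm subr_gt0 ltNge; apply/negP => x1.
have : 1 <= enorm x ^+ n.
  rewrite exprn_ege1//; apply: contraLR x1; rewrite -!ltNge => x1.
  by rewrite exprn_ilt1 ?enorm_ge0.
by apply/negP; rewrite -ltNge; apply: le_lt_trans xn _; rewrite invf_lt1// ltr1n.
Qed.

Lemma sobolev_quotients_nonempty : sobolev_quotients !=set0.
Proof.
have tb := @test_bump R n; set f := (fun _ => _) in tb.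
exists ((\int[mu]_x (laplacian f x ^+ 2)) / crit_integral f `^ (2 / p)), f; split => //.
rewrite -lte_fin -test_crit_integralE//.
exact: nonzero_powR_integral_gt0 (test_measurable tb) bump_nonzero.
Qed.

Lemma sobolev_cst_ge0 : 0 <= sobolev_cst.
Proof. exact: lb_le_inf sobolev_quotients_nonempty sobolev_quotients_ge0. Qed.

Lemma sobolev_inequality f : test_function f ->
  sobolev_cst * crit_integral f `^ (2 / p) <= \int[mu]_x (laplacian f x ^+ 2).
Proof.
move=> tf; have [->|f0] := eqVneq (crit_integral f) 0.
  rewrite powR0 ?mulr0; first by apply: Rintegral_ge0 => x _; exact: sqr_ge0.
  by rewrite gt_eqF// divr_gt0.
have f1 : 0 < crit_integral f by rewrite lt_neqAle eq_sym f0 crit_integral_ge0.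
rewrite -ler_pdivlMr ?powR_gt0//; apply: ge_inf.
  by exists 0; exact: sobolev_quotients_ge0.
by exists f.
Qed.

(** Solves a power bound for [B], turning upper bounds on integrals into lower bounds on
    energies. *)
Lemma powR_le_invert (a C B r : R) : 0 <= a -> 0 < C -> 0 < B -> 0 < r ->
  a <= C * B `^ (r / 2) -> C `^ (- (2 / r)) * a `^ (2 / r) <= B.
Proof.
move=> a0 C0 B0 r0 aCB.
have h : a `^ (2 / r) <= C `^ (2 / r) * B.
  apply: (le_trans (ge0_ler_powR _ _ _ aCB)).
  - by rewrite divr_ge0// ltW.
  - by rewrite nnegrE.
  - by rewrite nnegrE mulr_ge0 ?powR_ge0// ltW.
  rewrite powRM ?powR_ge0 ?(ltW C0)// -powRrM.
  have -> : r / 2 * (2 / r) = 1 by field; rewrite gt_eqF.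
  by rewrite powRr1// ltW.
apply: (@le_trans _ _ (C `^ (- (2 / r)) * (C `^ (2 / r) * B))).
  by rewrite ler_wpM2l// powR_ge0.
by rewrite mulrA -powRD ?addNr ?powRr0 ?mul1r// (gt_eqF C0) implybT.
Qed.

End sobolev_constant.

(** When the limit is 0 the threshold e^(1/q) works directly; otherwise the power is a composition
    with exp and ln. *)
Lemma cvg_powR_norm (R : realType) (q : R) (v : nat -> R) (a : R) : 0 < q ->
  v k @[k --> \oo] --> a -> `|v k| `^ q @[k --> \oo] --> `|a| `^ q.
Proof.
move=> q0 va; have nva : `|v k| @[k --> \oo] --> `|a| by exact: cvg_norm.
have [a0|a0] := eqVneq a 0.
  rewrite a0 normr0 powR0 ?gt_eqF//; apply/cvgrPdist_lt => e e0.
  have eq0 : 0 < e `^ q^-1 by exact: powR_gt0.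
  move/cvgrPdist_lt : va => /(_ _ eq0); apply: filterS => j.
  rewrite a0 !sub0r !normrN => h; rewrite ger0_norm ?powR_ge0//.
  rewrite -[ltRHS]powRr1 ?(ltW e0)// -[X in _ < _ `^ X](mulVf (lt0r_neq0 q0)) powRrM.
  by apply: gt0_ltr_powR; rewrite ?nnegrE ?powR_ge0.
have na0 : 0 < `|a| by rewrite normr_gt0.
have h1 : ln `|v k| @[k --> \oo] --> ln `|a|.
  exact: (@continuous_cvg _ _ _ _ _ (fun k => `|v k|) (@ln R) _ (continuous_ln na0) nva).
have h2 : q * ln `|v k| @[k --> \oo] --> q * ln `|a| by apply: cvgM => //; exact: cvg_cst.
have h3 : expR (q * ln `|v k|) @[k --> \oo] --> expR (q * ln `|a|).
  exact: (@continuous_cvg _ _ _ _ _ (fun k => q * ln `|v k|) (@expR R) _ (@continuous_expR R _) h2).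
rewrite {2}/powR gt_eqF//; apply: cvg_trans h3.
apply: near_eq_cvg; near=> k; rewrite /powR gt_eqF//.
near: k; move/cvgrPdist_lt : nva => /(_ _ na0); apply: filterS => k.
rewrite ltr_norml => /andP[_]; lra.
Unshelve. all: by end_near. Qed.

Section radial_D22.
Context {R : realType} {n : nat}.
Hypothesis n5 : (5 <= n)%N.
Local Notation mu := (lebesgue_rV R n).
Local Notation p := (crit_exp R n).

Let n4_gt0 : 0 < n%:R - 4 :> R. Proof. by rewrite subr_gt0 ltr_nat. Qed.
Let p_gt0 : 0 < p. Proof. by have := crit_exp_gt2 (R := R) n5; lra. Qed.

Lemma D22_ae_subsequence (u : 'rV[R]_n -> R) (phi : nat -> 'rV[R]_n -> R) :
  measurable_fun setT u -> (forall k, test_function (phi k)) ->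
  (\int[mu]_x (`|phi k x - u x| `^ p)%:E)%E @[k --> \oo] --> 0%E ->
  exists2 s : nat -> nat, forall j, (j <= s j)%N &
    {ae mu, forall x, phi (s j) x @[j --> \oo] --> u x}.
Proof.
move=> mu_ tphi uphi.
have [] := @ae_cvg_subsequence _ _ _ mu (fun k x => `|phi k x - u x| `^ p) _ _ uphi.
- move=> k; apply: (measurable_powR_norm (f := fun x => phi k x - u x)).
  by apply: measurable_funB => //; exact: test_measurable.
- by move=> k x; exact: powR_ge0.
move=> s sP a; exists s => //; apply: ae_imp a => x cx.
apply/cvgrPdist_lt => e e0; have ep : 0 < e `^ p by exact: powR_gt0.
move/cvgrPdist_lt : cx => /(_ _ ep); apply: filterS => j.
rewrite sub0r normrN ger0_norm ?powR_ge0// distrC => h.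
rewrite ltNge; apply/negP => eh; move: h; apply/negP; rewrite -leNgt.
by apply: ge0_ler_powR; rewrite ?nnegrE ?(ltW p_gt0) ?(ltW e0).
Qed.

(** The factor that appears when [radial_crit_bound] is solved for [B], that is, 1 / C'. *)
Definition gradient_cst : R := @crit_cst R n `^ (- (2 / p)).

Lemma gradient_cst_gt0 : 0 < gradient_cst.
Proof. by apply: powR_gt0; exact: crit_cst_gt0. Qed.

Lemma rellich_cst_gt0 : 0 < @rellich_cst R n.
Proof. by rewrite /rellich_cst exprn_gt0// divr_gt0. Qed.

Lemma lee_addgt0_EFin (x : R) (y : \bar R) : (0 <= y)%E ->
  (forall b e : R, y = b%:E -> 0 < e -> x <= b + e) -> (x%:E <= y)%E.
Proof.
case: y => [b _ h|_ _|//]; last by rewrite leey.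
by rewrite lee_fin; apply/ler_addgt0Pr => e e0; exact: h.
Qed.

(** The estimates hold for any eventual bound [B] on the energy of the approximants. A crude [B]
    from the Cauchy property gives finiteness. If the gradient energy G is finite, B = G + e is
    admissible for late indices and gives the inequalities in G as e tends to 0. *)
Lemma radial_D22_bounds (u : 'rV[R]_n -> R) g l :
  D22 u -> radial u -> is_weak_grad u g -> is_weak_laplacian u l ->
  [/\ (\int[mu]_x (`|u x| `^ p)%:E = (crit_integral u)%:E)%E,
      (\int[mu]_x (enorm x ^- 4 * u x ^+ 2)%:E < +oo)%E,
      ((@sobolev_cst R n * crit_integral u `^ (2 / p))%:E <= \int[mu]_x (l x ^+ 2)%:E)%E,
      ((gradient_cst * crit_integral u `^ (2 / p))%:E <=
        \int[mu]_x (enorm x ^- 2 * \sum_(i < n) g i x ^+ 2)%:E)%E &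
      (\int[mu]_x (enorm x ^- 4 * u x ^+ 2)%:E <= (@rellich_cst R n)%:E *
        \int[mu]_x (enorm x ^- 2 * \sum_(i < n) g i x ^+ 2)%:E)%E].
Proof.
move=> [mu_ [phi [tphi cphi uphi]]] ru wg wl.
have [s sj sP] := D22_ae_subsequence mu_ tphi uphi.
set I := (\int[mu]_x (`|u x| `^ p)%:E)%E.
set H := (\int[mu]_x (enorm x ^- 4 * u x ^+ 2)%:E)%E.
set G := (\int[mu]_x (enorm x ^- 2 * _)%:E)%E.
set L := (\int[mu]_x (l x ^+ 2)%:E)%E.
have bound B N : 0 < B -> (forall m, (N <= m)%N -> forall d, 0 < d ->
    \int[mu]_x (grad2 (phi m) x * regw d x) <= B) ->
    (I <= (@crit_cst R n * B `^ (p / 2))%:E)%E /\ (H <= (@rellich_cst R n * B)%:E)%E.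
  move=> B0 phiB.
  have psiB m : (N <= m)%N -> forall d, 0 < d ->
      \int[mu]_x (grad2 (phi (s m)) x * regw d x) <= B.
    by move=> Nm; apply: phiB; exact: leq_trans (sj m).
  split.
    exact: (radial_crit_bound n5 mu_ (fun k => tphi (s k)) sP B0 psiB ru).
  exact: (weighted_norm_bound n5 mu_ (fun k => tphi (s k)) sP psiB).
have [B0 [N0 [B00 phiB0]]] := D22_energy_bounded n5 tphi cphi.
have [IB0 HB0] := bound _ _ B00 phiB0.
have I0 : (0 <= I)%E by apply: integral_ge0 => x _; rewrite lee_fin powR_ge0.
have H0 : (0 <= H)%E.
  by apply: integral_ge0 => x _; rewrite lee_fin mulr_ge0 ?sqr_ge0// invr_ge0 exprn_ge0// enorm_ge0.
have G0 : (0 <= G)%E.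
  apply: integral_ge0 => x _; rewrite lee_fin mulr_ge0 ?invr_ge0 ?sqr_ge0//.
  by apply: sumr_ge0 => i _; exact: sqr_ge0.
have L0 : (0 <= L)%E by apply: integral_ge0 => x _; rewrite lee_fin sqr_ge0.
have IE : I = (crit_integral u)%:E.
  by rewrite /crit_integral -/I fineK// ge0_fin_numE//; exact: le_lt_trans IB0 (ltry _).
have Hlt : (H < +oo)%E by exact: le_lt_trans HB0 (ltry _).
have Gb b e : G = b%:E -> 0 < e ->
    (I <= (@crit_cst R n * (b + e) `^ (p / 2))%:E)%E /\ (H <= (@rellich_cst R n * (b + e))%:E)%E.
  move=> Gb e0; have [N HN] := D22_grad_lower n5 tphi cphi uphi wg e0.
  have b0 : 0 <= b by rewrite -lee_fin -Gb.
  apply: (bound _ N); first by rewrite ltr_wpDl.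
  by move=> m Nm d d0; rewrite -lee_fin EFinD -Gb; exact: HN.
split => //.
- apply: lee_addgt0_EFin => // b e Lb e0.
  have b0 : 0 <= b by rewrite -lee_fin -Lb.
  have be0 : 0 < b + e by rewrite ltr_wpDl.
  (* If the Sobolev constant is 0 the bound is trivial; otherwise one may divide by it. *)
  have := sobolev_cst_ge0 (R := R) n5; rewrite le_eqVlt => /predU1P[<-|S0].
    by rewrite mul0r ltW.
  have [N HN] := D22_laplacian_lower n5 tphi cphi uphi wl e0.
  have C0 : 0 < @sobolev_cst R n `^ (- (p / 2)) by exact: powR_gt0.
  suff h : crit_integral u <= @sobolev_cst R n `^ (- (p / 2)) * (b + e) `^ (p / 2).
    have := powR_le_invert (crit_integral_ge0 u) C0 be0 p_gt0 h.
    rewrite -powRrM (_ : - (p / 2) * - (2 / p) = 1) ?powRr1 ?(ltW S0)//.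
    by field; rewrite gt_eqF.
  rewrite -lee_fin -IE.
  (* Fatou's lemma along the subsequence, with the Sobolev inequality of each approximant. *)
  apply: (@fatou_le _ _ _ mu (fun j x => `|phi (s j) x| `^ p) (fun x => `|u x| `^ p) _ N).
  + by move=> k; apply: measurable_powR_norm; exact: test_measurable.
  + exact: measurable_powR_norm.
  + by move=> k x; exact: powR_ge0.
  + by move=> x; exact: powR_ge0.
  + by apply: ae_imp sP => x; exact: cvg_powR_norm.
  + move=> k Nk; rewrite test_crit_integralE// lee_fin.
    have := HN _ (leq_trans Nk (sj k)); rewrite -/L Lb -EFinD lee_fin => h.
    have {}h := le_trans (sobolev_inequality n5 (tphi (s k))) h.
    have : crit_integral (phi (s k)) `^ (2 / p) <= (b + e) / @sobolev_cst R n.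
      by rewrite ler_pdivlMr// mulrC.
    have p20 : 0 <= p / 2 by rewrite divr_ge0// ltW.
    have q0 : 0 <= (b + e) / @sobolev_cst R n by rewrite divr_ge0// ltW.
    move=> /(ge0_ler_powR p20 (powR_ge0 _ _) q0).
    rewrite -powRrM (_ : 2 / p * (p / 2) = 1) ?powRr1 ?crit_integral_ge0//; last first.
      by field; rewrite gt_eqF.
    move=> /le_trans; apply; rewrite powRM ?(ltW be0) ?invr_ge0 ?(ltW S0)//.
    rewrite [leRHS]mulrC ler_wpM2l ?powR_ge0//.
    by rewrite -(powR_inv1 (ltW S0)) -powRrM mulN1r.
- apply: lee_addgt0_EFin => // b e Gbe e0.
  have b0 : 0 <= b by rewrite -lee_fin -Gbe.
  have [h _] := Gb _ _ Gbe e0; rewrite IE lee_fin in h.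
  by apply: powR_le_invert h => //; [exact: crit_integral_ge0|exact: crit_cst_gt0|rewrite ltr_wpDl].
- have rc := rellich_cst_gt0; have [Gfin|] := boolP (G \is a fin_num); last first.
    by rewrite ge0_fin_numE// ltey negbK => /eqP ->; rewrite gt0_muley ?lte_fin// leey.
  rewrite -(fineK Gfin) -EFinM.
  apply/lee_addgt0Pr => e e0; have er0 : 0 < e / @rellich_cst R n by rewrite divr_gt0.
  have [_] := Gb _ _ (esym (fineK Gfin)) er0.
  by rewrite mulrDr (mulrC _ (e / _)) divfK ?gt_eqF// EFinD.
Qed.

End radial_D22.

(** Young's inequality with exponents 1 / (1 - t) and 1 / t; the endpoint t = 1, which corresponds
    to q = p, has no finite conjugate and is treated apart. *)
Lemma young_powR (R : realType) (X Y t : R) : 0 <= X -> 0 <= Y -> 0 < t <= 1 ->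
  X `^ (1 - t) * Y `^ t <= (1 - t) * X + t * Y.
Proof.
move=> X0 Y0 /andP[t0]; rewrite le_eqVlt => /predU1P[->|t1].
  by rewrite subrr powRr0 mul0r add0r !mul1r powRr1.
have s0 : 0 < 1 - t by rewrite subr_gt0.
have := @conjugate_powR R (X `^ (1 - t)) (Y `^ t) (1 - t)^-1 t^-1 (powR_ge0 _ _) (powR_ge0 _ _).
rewrite !invr_gt0 !invrK subrK => /(_ s0 t0 erefl).
by rewrite -!powRrM !divff ?gt_eqF// !powRr1// (mulrC (1 - t)) (mulrC t).
Qed.

(** * Interpolation between the Hardy integral and the critical integral *)

Section interpolation.
Context {R : realType} {n : nat}.
Hypothesis n5 : (5 <= n)%N.
Local Notation mu := (lebesgue_rV R n).
Local Notation p := (crit_exp R n).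

Let n4_gt0 : 0 < n%:R - 4 :> R. Proof. by rewrite subr_gt0 ltr_nat. Qed.
Let p_gt2 : 2 < p. Proof. by have := crit_exp_gt2 (R := R) n5. Qed.

(** The weight t with q = 2 (1 - t) + p t. *)
Definition interp (q : R) : R := (q - 2) / (p - 2).

Lemma interp_itv q : 2 < q <= p -> 0 < interp q <= 1.
Proof.
move=> /andP[q2 qp]; have p2 : 0 < p - 2 by rewrite subr_gt0.
by rewrite divr_gt0 ?subr_gt0//= ler_pdivrMr// mul1r lerD2r.
Qed.

(** |x|^-beta is thus the power 1 - t of |x|^-4, so interpolation with the unweighted critical
    integral matches the weights exactly. *)
Lemma hardy_expE q : @hardy_exp R n q = 4 * (1 - interp q).
Proof.
rewrite /hardy_exp /interp crit_expB2//; field.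
by rewrite gt_eqF.
Qed.

Lemma interp_exponent q : 1 - interp q + interp q * (p / 2) = q / 2.
Proof.
have p2 : p - 2 != 0 by rewrite subr_eq0 gt_eqF.
by rewrite /interp; field.
Qed.

Lemma interpolation_pointwise q (r v : R) : 0 < r -> 2 < q <= p ->
  r `^ (- @hardy_exp R n q) * `|v| `^ q =
  (r ^- 4 * v ^+ 2) `^ (1 - interp q) * (`|v| `^ p) `^ interp q.
Proof.
move=> r0 qp; have /andP[t0 t1] := interp_itv qp.
have q0 : 0 < q by case/andP : qp; lra.
have [->|v0] := eqVneq v 0.
  rewrite normr0 (powR0 (lt0r_neq0 q0)) (powR0 (_ : p != 0)); last by rewrite gt_eqF//; lra.
  by rewrite (powR0 (lt0r_neq0 t0)) !mulr0.
have nv0 : 0 < `|v| by rewrite normr_gt0.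
have -> : v ^+ 2 = `|v| `^ 2%:R by rewrite powR_mulrn// real_normK// num_real.
rewrite -powR_invn ?(ltW r0)// powRM ?powR_ge0// -!powRrM -mulrA -powRD; last first.
  by rewrite (gt_eqF nv0) implybT.
congr (_ `^ _ * _ `^ _); first by rewrite hardy_expE; ring.
by have := interp_exponent q; move: (interp q) p => t s; lra.
Qed.

Variables (u : 'rV[R]_n -> R).
Hypothesis mu_ : measurable_fun setT u.

(** Hoelder's inequality from Young's pointwise one: the factors are normalised by [h] and [a], so
    that after integration the weights 1 - t and t add up to 1. *)
Lemma interpolation q (h a : R) : 2 < q <= p -> 0 < h -> 0 < a ->
  (\int[mu]_x (enorm x ^- 4 * u x ^+ 2)%:E <= h%:E)%E ->
  (\int[mu]_x (`|u x| `^ p)%:E = a%:E)%E ->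
  (\int[mu]_x (enorm x `^ (- @hardy_exp R n q) * `|u x| `^ q)%:E <=
    (h `^ (1 - interp q) * a `^ interp q)%:E)%E.
Proof.
move=> qp h0 a0 Hh Ia; have /andP[t0 t1] := interp_itv qp.
set t := interp q in t0 t1 *; set A := h `^ (1 - t) * a `^ t.
have A0 : 0 <= A by rewrite mulr_ge0 ?powR_ge0.
have X0 x : 0 <= enorm x ^- 4 * u x ^+ 2.
  by rewrite mulr_ge0 ?sqr_ge0// invr_ge0 exprn_ge0// enorm_ge0.
have mX : measurable_fun setT (fun x : 'rV[R]_n => enorm x ^- 4 * u x ^+ 2).
  by apply: measurable_funM; [exact: measurable_enormN|exact: measurable_funX].
have mY : measurable_fun setT (fun x => `|u x| `^ p) by exact: measurable_powR_norm.
have c1 : 0 <= A * ((1 - t) / h) by rewrite mulr_ge0// divr_ge0 ?(ltW h0)// subr_ge0.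
have c2 : 0 <= A * (t / a) by rewrite mulr_ge0// divr_ge0 ?(ltW a0)// (ltW t0).
have E0 x : (0 <= (A * ((1 - t) / h))%:E * (enorm x ^- 4 * u x ^+ 2)%:E)%E.
  by rewrite mule_ge0 ?lee_fin.
have E1 x : (0 <= (A * (t / a))%:E * (`|u x| `^ p)%:E)%E.
  by rewrite mule_ge0 ?lee_fin// powR_ge0.
have mE0 : measurable_fun setT (fun x => (A * ((1 - t) / h))%:E * (enorm x ^- 4 * u x ^+ 2)%:E)%E.
  by apply: measurable_funeM; exact/measurable_EFinP.
have mE1 : measurable_fun setT (fun x => (A * (t / a))%:E * (`|u x| `^ p)%:E)%E.
  by apply: measurable_funeM; exact/measurable_EFinP.
apply: (@le_trans _ _ (\int[mu]_x ((A * ((1 - t) / h))%:E * (enorm x ^- 4 * u x ^+ 2)%:E +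
    (A * (t / a))%:E * (`|u x| `^ p)%:E))%E); last first.
  rewrite ge0_integralD// !ge0_integralZl_EFin//; first last.
  - exact/measurable_EFinP.
  - by move=> x _; rewrite lee_fin.
  - exact/measurable_EFinP.
  rewrite Ia; apply: (@le_trans _ _ ((A * ((1 - t) / h))%:E * h%:E + (A * (t / a))%:E * a%:E)%E).
    by rewrite leeD2r//; apply: lee_wpmul2l.
  rewrite -!EFinM -EFinD lee_fin le_eqVlt; apply/orP; left; apply/eqP.
  by field; rewrite !gt_eqF.
apply: ae_ge0_le_integral => //.
- by move=> x _; rewrite lee_fin mulr_ge0 ?powR_ge0.
- apply/measurable_EFinP; apply: measurable_funM; last exact: measurable_powR_norm.
  exact: (measurableT_comp (@measurable_powR R _) measurable_enorm).
- by move=> x _; rewrite adde_ge0.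
- exact: emeasurable_funD.
have := ae_enorm_gt0 n5 (R := R); apply: ae_imp => x x0 _.
rewrite -!EFinM -EFinD lee_fin interpolation_pointwise// -/t.
set X := enorm x ^- 4 * _; set Y := `|u x| `^ p.
have Xh : X = h * (X / h) by rewrite mulrC divfK ?gt_eqF.
have Ya : Y = a * (Y / a) by rewrite mulrC divfK ?gt_eqF.
have Xh0 : 0 <= X / h by rewrite divr_ge0 ?(ltW h0)//; exact: X0.
have Ya0 : 0 <= Y / a by rewrite divr_ge0 ?(ltW a0) ?powR_ge0.
have -> : X `^ (1 - t) * Y `^ t = A * ((X / h) `^ (1 - t) * (Y / a) `^ t).
  by rewrite {1}Xh {1}Ya (powRM _ (ltW h0) Xh0) (powRM _ (ltW a0) Ya0) /A mulrACA.
have -> : A * ((1 - t) / h) * X + A * (t / a) * Y = A * ((1 - t) * (X / h) + t * (Y / a)) by ring.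
by apply: ler_wpM2l => //; apply: young_powR => //; rewrite t0.
Qed.

Lemma weighted_powR_integral_gt0 q : 0 < q -> nonzero u ->
  (0 < \int[mu]_x (enorm x `^ (- @hardy_exp R n q) * `|u x| `^ q)%:E)%E.
Proof.
move=> q0 u0; have F0 x : 0 <= enorm x `^ (- @hardy_exp R n q) * `|u x| `^ q.
  by rewrite mulr_ge0 ?powR_ge0.
rewrite lt_neqAle integral_ge0 ?andbT; last by move=> x _; rewrite lee_fin.
apply/negP => /eqP/esym h; apply: u0.
have m1 : measurable_fun setT (fun x => (enorm x `^ (- @hardy_exp R n q) * `|u x| `^ q)%:E).
  apply/measurable_EFinP; apply: measurable_funM; last exact: measurable_powR_norm.
  exact: (measurableT_comp (@measurable_powR R _) measurable_enorm).
have a := ae_and (ae_enorm_gt0 n5 (R := R)) (ae_indic_null m1 (fun x => F0 x) h).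
apply: ae_imp a => x [x0 [] /eqP].
rewrite mulf_eq0 gt_eqF ?powR_gt0//= => /eqP/powR_eq0_eq0/eqP.
by rewrite normr_eq0 => /eqP.
Qed.

End interpolation.

Section radial_lower_bound.
Context {R : realType} {n : nat}.
Hypothesis n5 : (5 <= n)%N.
Local Notation mu := (lebesgue_rV R n).
Local Notation p := (crit_exp R n).
Variable lambda : R.
Hypothesis lambda_lt0 : lambda < 0.

Let p_gt2 : 2 < p. Proof. by have := crit_exp_gt2 (R := R) n5. Qed.
Let p_gt0 : 0 < p. Proof. exact: lt_trans p_gt2. Qed.
Let L_gt0 : 0 < - lambda. Proof. by rewrite oppr_gt0. Qed.

Definition radial_crit_cst : R := @sobolev_cst R n - lambda * @gradient_cst R n.

Lemma radial_crit_cst_gt0 : 0 < radial_crit_cst.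
Proof.
rewrite /radial_crit_cst -mulNr ltr_wpDl ?sobolev_cst_ge0//.
by rewrite mulr_gt0// gradient_cst_gt0.
Qed.

(** With r the numerator of the quotient, the Hardy integral is at most (rellich_cst / |lambda|) r
    and the critical integral at most (r / radial_crit_cst)^(p / 2). Interpolation bounds the
    weighted integral by this constant times r^(q / 2). *)
Definition interp_cst (q : R) : R :=
  (@rellich_cst R n / - lambda) `^ (1 - @interp R n q) *
  radial_crit_cst `^ (- (@interp R n q * (p / 2))).

Lemma interp_cst_gt0 q : 0 < interp_cst q.
Proof.
rewrite mulr_gt0// powR_gt0// ?radial_crit_cst_gt0//.
by rewrite divr_gt0// rellich_cst_gt0.
Qed.

Definition radial_bound (q : R) : R := interp_cst q `^ (- (2 / q)).

(** As lambda < 0, both terms of the numerator are nonnegative, so it controls each of the integrals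
    that are interpolated; the resulting power bound is then solved for the numerator. *)
Lemma radial_quotient_ge (q : R) (u : 'rV[R]_n -> R) g l : 2 < q <= p ->
  D22 u -> nonzero u -> radial u -> is_weak_grad u g -> is_weak_laplacian u l ->
  ((radial_bound q)%:E <= quotient q lambda u g l)%E.
Proof.
move=> qp Du u0 ru wg wl; have mu_ : measurable_fun setT u by case: Du.
have q0 : 0 < q by case/andP : qp; lra.
have [t0 t1] := andP (interp_itv n5 qp).
have [IE Hlt SL cG HG] := radial_D22_bounds n5 Du ru wg wl.
rewrite /quotient.
set I := (\int[mu]_x (enorm x `^ (- @hardy_exp R n q) * _)%:E)%E.
set G := (\int[mu]_x (enorm x ^- 2 * _)%:E)%E in cG HG *.
set L := (\int[mu]_x (l x ^+ 2)%:E)%E in SL *.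
set H := (\int[mu]_x (enorm x ^- 4 * _)%:E)%E in Hlt HG.
set a := crit_integral u in IE SL cG.
have a0 : 0 < a by rewrite -lte_fin -IE; exact: nonzero_powR_integral_gt0.
have H0 : (0 <= H)%E.
  by apply: integral_ge0 => x _; rewrite lee_fin mulr_ge0 ?sqr_ge0// invr_ge0 exprn_ge0// enorm_ge0.
have G0 : (0 <= G)%E.
  apply: integral_ge0 => x _; rewrite lee_fin mulr_ge0 ?invr_ge0 ?sqr_ge0//.
  by apply: sumr_ge0 => i _; exact: sqr_ge0.
have L0 : (0 <= L)%E by apply: integral_ge0 => x _; rewrite lee_fin sqr_ge0.
have I0 : (0 < I)%E by exact: weighted_powR_integral_gt0.
have NE : (L - lambda%:E * G = L + (- lambda)%:E * G)%E by rewrite EFinN mulNe.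
rewrite NE; set N := (L + _)%E.
have LG0 : (0 <= (- lambda)%:E * G)%E by rewrite mule_ge0 ?lee_fin ?(ltW L_gt0).
have bound h : 0 < h -> (H <= h%:E)%E -> (I <= (h `^ (1 - @interp R n q) * a `^ @interp R n q)%:E)%E.
  by move=> h0 Hh; exact: interpolation.
have Ifin : I = (fine I)%:E.
  rewrite fineK// ge0_fin_numE ?(ltW I0)//.
  (* Adding 1 gives a positive bound on [H], as [interpolation] requires. *)
  apply: le_lt_trans (bound (fine H + 1) _ _) (ltry _).
    by rewrite ltr_wpDl ?fine_ge0.
  by rewrite EFinD fineK ?ge0_fin_numE// leeDl.
have v0 : 0 < fine I by rewrite -lte_fin -Ifin.
rewrite Ifin poweR_EFin inver gt_eqF ?powR_gt0//.
(* The denominator being positive and finite, an infinite numerator makes the quotient infinite. *)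
have [Noo|Noo] := eqVneq N +oo%E.
  by rewrite Noo gt0_mulye ?leey// lte_fin invr_gt0 powR_gt0.
have N0 : (0 <= N)%E by rewrite adde_ge0.
have NF : N = (fine N)%:E by rewrite fineK// ge0_fin_numE// ltey.
rewrite NF -EFinM lee_fin ler_pdivlMr ?powR_gt0//.
set r := fine N in NF *.
have Sr : radial_crit_cst * a `^ (2 / p) <= r.
  rewrite -lee_fin -NF /N /radial_crit_cst -mulNr mulrDl EFinD.
  apply: leeD => //; rewrite -mulrA (EFinM (- lambda)).
  by apply: lee_wpmul2l => //; rewrite lee_fin ltW.
have r0 : 0 < r by apply: lt_le_trans Sr; rewrite mulr_gt0 ?radial_crit_cst_gt0 ?powR_gt0.
have C0 : 0 < @rellich_cst R n / - lambda by rewrite divr_gt0// rellich_cst_gt0.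
(* The numerator dominates |lambda| G alone. *)
have Hr : (H <= (@rellich_cst R n / - lambda * r)%:E)%E.
  apply: (le_trans HG); rewrite -mulrA (EFinM (@rellich_cst R n)); apply: lee_wpmul2l.
    by rewrite lee_fin ltW// rellich_cst_gt0.
  rewrite EFinM -lee_pdivrMl ?invr_gt0// invrK -NF.
  by rewrite /N leeDr.
have ar : a `^ @interp R n q <= (r / radial_crit_cst) `^ (@interp R n q * (p / 2)).
  rewrite (mulrC (@interp R n q)) (powRrM _ (p / 2)).
  have h : a `^ (2 / p) <= r / radial_crit_cst.
    by rewrite ler_pdivlMr ?radial_crit_cst_gt0// mulrC.
  apply: (ge0_ler_powR (ltW t0)); rewrite ?nnegrE ?powR_ge0 ?(ltW a0)//.
  have p20 : 0 <= p / 2 by rewrite divr_ge0// ltW.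
  have rs0 : 0 <= r / radial_crit_cst by rewrite divr_ge0 ?(ltW r0)// ltW// radial_crit_cst_gt0.
  have := ge0_ler_powR p20 (powR_ge0 _ _) rs0 h.
  rewrite -powRrM (_ : 2 / p * (p / 2) = 1) ?powRr1 ?(ltW a0)//.
  by field; rewrite gt_eqF.
apply: (powR_le_invert _ (interp_cst_gt0 q) r0 q0); first exact: ltW.
rewrite -lee_fin -Ifin; apply: (le_trans (bound _ _ Hr)); first by rewrite mulr_gt0.
rewrite lee_fin; apply: (le_trans (ler_wpM2l (powR_ge0 _ _) ar)).
rewrite le_eqVlt; apply/orP; left; apply/eqP.
have S0 := radial_crit_cst_gt0.
rewrite (powRM _ (ltW C0) (ltW r0)) (powRM _ (ltW r0)) ?invr_ge0 ?(ltW S0)//.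
rewrite -(powR_inv1 (ltW S0)) -(powRrM radial_crit_cst) mulN1r.
have -> : r `^ (q / 2) = r `^ (1 - @interp R n q) * r `^ (@interp R n q * (p / 2)).
  by rewrite -powRD ?interp_exponent// (gt_eqF r0) implybT.
by rewrite /interp_cst; ring.
Qed.

Lemma Sq_rad_ge (q : R) : 2 < q <= p -> ((radial_bound q)%:E <= Sq_rad n q lambda)%E.
Proof.
move=> qp; apply: le_ereal_inf_tmp => _ [u [g [l [[Du u0 ru wg wl] ->]]]].
exact: radial_quotient_ge.
Qed.

(** At q = p the interpolation weight is 1 and the factor from the Hardy integral disappears. *)
Lemma radial_bound_crit : radial_bound p = radial_crit_cst.
Proof.
have p2 : p - 2 != 0 by rewrite subr_eq0 gt_eqF.
rewrite /radial_bound /interp_cst /interp divff// subrr powRr0 mul1r mul1r -powRrM.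
have -> : - (p / 2) * - (2 / p) = 1 by field; rewrite gt_eqF.
by rewrite powRr1// ltW// radial_crit_cst_gt0.
Qed.

Lemma powR_continuous_exponent (T : topologicalType) (a : R) (f : T -> R) (x : T) : 0 < a ->
  {for x, continuous f} -> {for x, continuous (fun y => a `^ f y)}.
Proof.
move=> a0 cf.
rewrite (_ : (fun _ => _) = expR \o (fun y => f y * ln a)); last first.
  by apply/funext => y; rewrite /= /powR gt_eqF.
apply: (@continuous_comp _ _ _ (fun y => f y * ln a) expR); last exact: continuous_expR.
by apply: continuousM => //; exact: cst_continuous.
Qed.

Lemma radial_bound_continuous : {for p, continuous radial_bound}.
Proof.
have cq : {for p, continuous (fun q : R => q)} by exact: cvg_id.
have ci : {for p, continuous (fun q : R => @interp R n q)}.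
  apply: continuousM; last exact: cst_continuous.
  by apply: continuousB => //; exact: cst_continuous.
have S0 := radial_crit_cst_gt0.
have C0 : 0 < @rellich_cst R n / - lambda by rewrite divr_gt0// rellich_cst_gt0.
rewrite (_ : radial_bound = fun q =>
  (@rellich_cst R n / - lambda) `^ ((1 - @interp R n q) * - (2 / q)) *
  radial_crit_cst `^ (- (@interp R n q * (p / 2)) * - (2 / q))); last first.
  apply/funext => q; rewrite /radial_bound /interp_cst powRM ?powR_ge0//.
  by rewrite -!powRrM.
have c2 : {for p, continuous (fun q : R => - (2 / q))}.
  apply: continuousN; apply: continuousM; first exact: cst_continuous.
  by apply: continuousV => //; rewrite gt_eqF.
apply: continuousM; apply: powR_continuous_exponent => //; apply: continuousM => //.
  by apply: continuousB => //; exact: cst_continuous.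
by apply: continuousN; apply: continuousM => //; exact: cst_continuous.
Qed.

End radial_lower_bound.

Lemma le_powR_npos (R : realType) (a b s : R) : 0 < a -> a <= b -> s <= 0 -> b `^ s <= a `^ s.
Proof.
move=> a0 ab s0; have b0 := lt_le_trans a0 ab.
rewrite -[s]opprK (powRN a) (powRN b) lef_pV2 ?posrE ?powR_gt0//.
by apply: ge0_ler_powR; rewrite ?nnegrE ?oppr_ge0 ?(ltW a0) ?(ltW b0).
Qed.

Lemma ge0_integralZlT d (T : measurableType d) (R : realType) (m : {measure set T -> \bar R})
    (f : T -> \bar R) (c : R) : measurable_fun setT f -> (forall x, 0 <= f x)%E -> 0 <= c ->
  (\int[m]_x (c%:E * f x) = c%:E * \int[m]_x f x)%E.
Proof. by move=> mf f0 c0; rewrite ge0_integralZl_EFin. Qed.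

(** * Upper bound by translated test functions *)

Section upper_bound.
Context {R : realType} {n : nat}.
Hypothesis n5 : (5 <= n)%N.
Local Notation mu := (lebesgue_rV R n).
Local Notation p := (crit_exp R n).

Let n_gt0 : (0 < n)%N. Proof. exact: leq_trans n5. Qed.
Let n4_gt0 : 0 < n%:R - 4 :> R. Proof. by rewrite subr_gt0 ltr_nat. Qed.
Let p_gt2 : 2 < p. Proof. by have := crit_exp_gt2 (R := R) n5. Qed.
Let p_gt0 : 0 < p. Proof. exact: lt_trans p_gt2. Qed.

Lemma enorm_le_norm (x : 'rV[R]_n) : enorm x <= Num.sqrt n%:R * `|x|.
Proof.
rewrite /enorm -[X in _ * X](ger0_norm (normr_ge0 x)) -sqrtr_sqr -sqrtrM ?ler0n//.
apply: ler_wsqrtr.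
have -> : n%:R * `|x| ^+ 2 = \sum_(i < n) `|x| ^+ 2 by rewrite sumr_const card_ord mulr_natl.
apply: ler_sum => i _; rewrite -real_normK ?num_real//.
by rewrite lerXn2r ?nnegrE ?normr_ge0//; exact: ler_coord_norm.
Qed.

Lemma norm_le_enorm (x : 'rV[R]_n) : `|x| <= enorm x.
Proof.
rewrite [leLHS]/Num.norm/= mx_normrE; apply/bigmax_leP; split; first exact: enorm_ge0.
by move=> [i j] _/=; rewrite ord1; exact: coord_le_enorm.
Qed.

Lemma test_integral_EFin (f : 'rV[R]_n -> R) : test_function f ->
  (\int[mu]_x (f x)%:E)%E = (\int[mu]_x f x)%:E.
Proof.
by move=> tf; rewrite fineK//; exact: (integrable_fin_num measurableT (test_integrable tf)).
Qed.

Lemma translate_sqr_laplacian (f : 'rV[R]_n -> R) (a : 'rV[R]_n) : test_function f ->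
  (\int[mu]_x (laplacian (fun y => f (y + a)) x ^+ 2)%:E)%E = (\int[mu]_x (laplacian f x ^+ 2))%:E.
Proof.
move=> tf; have tl := test_sqr (test_laplacian tf); rewrite laplacian_translate.
have ml : measurable_fun setT (fun x => (laplacian f x ^+ 2)%:E).
  by apply/measurable_EFinP; exact: test_measurable tl.
have l0 x : (0 <= (laplacian f x ^+ 2)%:E)%E by rewrite lee_fin; exact: sqr_ge0.
exact: (etrans (ge0_integral_rV_translate a ml l0) (test_integral_EFin tl)).
Qed.

(** Where the translated gradient is nonzero, |x + a| <= M, hence |x| >= |a| - M >= rho and the
    singular weight is at most rho^-2. *)
Lemma translate_gradient_le (f : 'rV[R]_n -> R) (a : 'rV[R]_n) (M rho : R) : test_function f ->
  (forall x, M < `|x| -> grad2 f x = 0) -> 0 < rho -> rho + M <= `|a| ->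
  (\int[mu]_x (enorm x ^- 2 * \sum_(i < n) pderiv i (fun y => f (y + a)%R) x ^+ 2)%:E <=
    (rho ^- 2 * \int[mu]_x grad2 f x)%:E)%E.
Proof.
move=> tf fM rho0 rhoa; have tg := test_grad2 tf.
have g0 x : 0 <= grad2 f x by apply: sumr_ge0 => i _; exact: sqr_ge0.
have mg : measurable_fun setT (fun x => (grad2 f x)%:E).
  by apply/measurable_EFinP; exact: test_measurable.
have mga : measurable_fun setT (fun x : 'rV[R]_n => (grad2 f (x + a)%R)%:E).
  by apply/measurable_EFinP; apply: test_measurable; exact: test_translate.
have E x : \sum_(i < n) pderiv i (fun y => f (y + a)) x ^+ 2 = grad2 f (x + a).
  by apply: eq_bigr => i _; rewrite pderiv_translate.
have r0 : 0 <= rho ^- 2 by rewrite invr_ge0 sqr_ge0.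
have g0E x : (0 <= (grad2 f x)%:E)%E by rewrite lee_fin.
rewrite EFinM (etrans (esym (test_integral_EFin tg)) (esym (ge0_integral_rV_translate a mg g0E))).
have ga0E x : (0 <= (grad2 f (x + a))%:E)%E by rewrite lee_fin.
rewrite -(ge0_integralZlT mu mga ga0E r0).
apply: ge0_le_integral => //.
- by move=> x _; rewrite lee_fin E mulr_ge0// invr_ge0 sqr_ge0.
- under eq_fun do rewrite E.
  apply/measurable_EFinP; apply: measurable_funM; first exact: measurable_enormN.
  by apply: test_measurable; exact: test_translate.
- by apply: measurable_funeM.
move=> x _; rewrite -EFinM lee_fin E.
have [xM|xM] := ltP M `|x + a|; first by rewrite fM// !mulr0.
apply: ler_wpM2r => //.
have xr : rho <= enorm x.
  apply: le_trans (norm_le_enorm x); rewrite -(lerD2r M); apply: (le_trans rhoa).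
  rewrite -[X in `|X|](addKr x) (le_trans (ler_normD _ _))// normrN lerD2l//.
have x0 := lt_le_trans rho0 xr.
by rewrite lef_pV2 ?posrE ?exprn_gt0// lerXn2r ?nnegrE ?(ltW rho0) ?(ltW x0).
Qed.

(** Where the translate is nonzero, |x| <= sqrt n (|a| + M) and |f| <= T, and both are raised to
    nonpositive powers, -beta and q - p. At q = p the two correction factors are 1. *)
Lemma translate_weighted_ge (f : 'rV[R]_n -> R) (a : 'rV[R]_n) (q M T : R) : 2 < q <= p -> test_function f ->
  (forall x, M < `|x| -> f x = 0) -> (forall x, `|f x| <= T) ->
  (((Num.sqrt n%:R * (`|a| + M)) `^ (- @hardy_exp R n q) * T `^ (q - p) * crit_integral f)%:E <=
   \int[mu]_x (enorm x `^ (- @hardy_exp R n q) * `|f (x + a)%R| `^ q)%:E)%E.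
Proof.
move=> qp tf fM fT; have q0 : 0 < q by case/andP : qp; lra.
set A := _ `^ _ * T `^ _.
have A0 : 0 <= A by rewrite mulr_ge0 ?powR_ge0.
have mf := test_measurable tf.
have mfa := test_measurable (test_translate a tf).
have mp : measurable_fun setT (fun x => (`|f x| `^ p)%:E).
  by apply/measurable_EFinP; exact: measurable_powR_norm.
have mpa : measurable_fun setT (fun x : 'rV[R]_n => (`|f (x + a)%R| `^ p)%:E).
  by apply/measurable_EFinP; exact: (measurable_powR_norm p mfa).
have p0E x : (0 <= (`|f x| `^ p)%:E)%E by rewrite lee_fin; exact: powR_ge0.
rewrite EFinM (etrans (esym (test_crit_integralE n5 tf)) (esym (ge0_integral_rV_translate a mp p0E))).
have pa0E x : (0 <= (`|f (x + a)| `^ p)%:E)%E by rewrite lee_fin; exact: powR_ge0.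
rewrite -(ge0_integralZlT mu mpa pa0E A0).
apply: ae_ge0_le_integral => //.
- by move=> x _; rewrite mule_ge0 ?lee_fin// powR_ge0.
- exact: measurable_funeM.
- by move=> x _; rewrite lee_fin mulr_ge0 ?powR_ge0.
- apply/measurable_EFinP; apply: measurable_funM; last exact: (measurable_powR_norm q mfa).
  exact: (measurableT_comp (@measurable_powR R _) measurable_enorm).
have := ae_enorm_gt0 n5 (R := R); apply: ae_imp => x x0 _.
rewrite -EFinM lee_fin.
have [fx|fx] := eqVneq (f (x + a)) 0.
  by rewrite fx normr0 !powR0 ?mulr0// ?gt_eqF.
have nf0 : 0 < `|f (x + a)| by rewrite normr_gt0.
have -> : `|f (x + a)| `^ q = `|f (x + a)| `^ (q - p) * `|f (x + a)| `^ p.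
  by rewrite -powRD ?subrK// (gt_eqF nf0) implybT.
rewrite mulrA; apply: ler_wpM2r; first exact: powR_ge0.
have b0 : 0 <= @hardy_exp R n q.
  have /andP[_ t1] := interp_itv n5 qp.
  by rewrite hardy_expE// mulr_ge0// subr_ge0.
apply: ler_pM; rewrite ?powR_ge0//; last first.
  by apply: le_powR_npos => //; case/andP : qp => _; rewrite subr_le0.
apply: le_powR_npos; rewrite ?oppr_le0//; apply: (le_trans (enorm_le_norm x)).
apply: ler_wpM2l; first exact: sqrtr_ge0.
have xM : `|x + a| <= M by rewrite leNgt; apply/negP => /fM h; rewrite h eqxx in fx.
by rewrite -[X in `|X|](addrK a) (le_trans (ler_normB _ _))// addrC lerD2l.
Qed.

End upper_bound.

(** * Comparison near the critical exponent *)

Section near_critical.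
Context {R : realType} {n : nat}.
Hypothesis n5 : (5 <= n)%N.
Local Notation mu := (lebesgue_rV R n).
Local Notation p := (crit_exp R n).
Variable lambda : R.
Hypothesis lambda_lt0 : lambda < 0.

Let n_gt0 : (0 < n)%N. Proof. exact: leq_trans n5. Qed.
Let n4_gt0 : 0 < n%:R - 4 :> R. Proof. by rewrite subr_gt0 ltr_nat. Qed.
Let p_gt2 : 2 < p. Proof. by have := crit_exp_gt2 (R := R) n5. Qed.
Let p_gt0 : 0 < p. Proof. exact: lt_trans p_gt2. Qed.
Let L_gt0 : 0 < - lambda. Proof. by rewrite oppr_gt0. Qed.

Lemma Sq_le_translate (f : 'rV[R]_n -> R) (a : 'rV[R]_n) (q M T rho : R) : 2 < q <= p -> test_function f -> 0 < crit_integral f ->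
  (forall x, M < `|x| -> f x = 0) -> (forall x, M < `|x| -> grad2 f x = 0) ->
  (forall x, `|f x| <= T) -> 0 < M -> 0 < T -> 0 < rho -> rho + M <= `|a| ->
  (Sq n q lambda <= ((\int[mu]_x (laplacian f x ^+ 2) - lambda * (rho ^- 2 * \int[mu]_x grad2 f x)) *
    ((Num.sqrt n%:R * (`|a| + M)) `^ (- @hardy_exp R n q) * T `^ (q - p) * crit_integral f) `^ (- (2 / q)))%:E)%E.
Proof.
move=> qp tf I0 fM gM fT M0 T0 rho0 rhoa.
have q0 : 0 < q by case/andP : qp; lra.
pose v x := f (x + a).
have tv : test_function v by exact: test_translate.
have W0 : 0 < Num.sqrt n%:R * (`|a| + M) by rewrite mulr_gt0 ?sqrtr_gt0 ?ltr0n// ltr_wpDl.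
set c := _ `^ _ * T `^ _ * _.
have c0 : 0 < c by rewrite !mulr_gt0 ?powR_gt0.
have vI := translate_weighted_ge n5 a qp tf fM fT; rewrite -/c in vI.
have D0 : 0 <= \int[mu]_x (laplacian f x ^+ 2).
  by apply: Rintegral_ge0 => x _; exact: sqr_ge0.
have g0 x : 0 <= grad2 f x by apply: sumr_ge0 => i _; exact: sqr_ge0.
have E0 : 0 <= \int[mu]_x grad2 f x by apply: Rintegral_ge0.
have r0 : 0 <= rho ^- 2 by rewrite invr_ge0 sqr_ge0.
(* Otherwise the denominator integral would be 0, against its positive lower bound. *)
have v0 : nonzero v.
  move=> vz; move: vI; apply/negP; rewrite -ltNge.
  rewrite (_ : (\int[mu]_x _ = 0)%E); first by rewrite lte_fin.
  rewrite -(integral0 mu setT); apply: ge0_ae_eq_integral => //.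
  - apply/measurable_EFinP; apply: measurable_funM.
      exact: (measurableT_comp (@measurable_powR R _) measurable_enorm).
    exact: (measurable_powR_norm q (test_measurable tv)).
  - by move=> x _; rewrite lee_fin mulr_ge0 ?powR_ge0.
  by apply: ae_imp vz => x vx _; rewrite -/(v x) vx normr0 powR0 ?mulr0// gt_eqF.
have qin : @quotients R n (fun=> True) q lambda
    (quotient q lambda v (fun i => pderiv i v) (laplacian v)).
  exists v, (fun i => pderiv i v), (laplacian v); split => //; split => //.
  - exact: test_D22.
  - exact: test_weak_grad.
  - exact: test_weak_laplacian.
apply: (le_trans (ereal_inf_lbound qin)); rewrite /quotient.
rewrite (translate_sqr_laplacian a tf).
have G1 := translate_gradient_le tf gM rho0 rhoa.
set G := (\int[mu]_x (enorm x ^- 2 * _)%:E)%E in G1 *.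
set I := (\int[mu]_x _)%E in vI *.
have NE : ((\int[mu]_x (laplacian f x ^+ 2))%:E - lambda%:E * G <=
    (\int[mu]_x (laplacian f x ^+ 2) - lambda * (rho ^- 2 * \int[mu]_x grad2 f x))%:E)%E.
  rewrite EFinB leeD2lE// EFinM -!mulNe -EFinN; apply: lee_wpmul2l => //.
  by rewrite lee_fin ltW.
set N := (_ - _)%E in NE *; set num := (_ - _)%R in NE *.
have num0 : 0 <= num by rewrite /num -mulNr addr_ge0// mulr_ge0 ?(ltW L_gt0)// mulr_ge0.
(* An infinite denominator makes the quotient 0, below the nonnegative bound. *)
have [Ioo|Ioo] := eqVneq I +oo%E.
  rewrite Ioo poweRyr ?gt_eqF ?divr_gt0// invey mule0 lee_fin.
  by rewrite mulr_ge0 ?powR_ge0.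
have I00 : (0 <= I)%E by apply: le_trans vI; rewrite lee_fin ltW.
have IE : I = (fine I)%:E by rewrite fineK// ge0_fin_numE// ltey.
have cI : c <= fine I by rewrite -lee_fin -IE.
have fI0 := lt_le_trans c0 cI.
rewrite IE poweR_EFin inver gt_eqF ?powR_gt0// -powRN EFinM.
apply: (@le_trans _ _ (num%:E * (fine I `^ (- (2 / q)))%:E)%E).
  by apply: lee_wpmul2r => //; rewrite lee_fin powR_ge0.
apply: lee_wpmul2l; rewrite lee_fin//; apply: le_powR_npos => //.
by rewrite oppr_le0 divr_ge0// ltW.
Qed.

(** The test function and its translate are fixed before [q], so the bound depends on [q] only
    through exponents of positive bases, hence continuously. *)
Lemma Sq_near_crit (e : R) : 0 < e -> exists F : R -> R,
  [/\ {for p, continuous F}, F p < @sobolev_cst R n + e &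
    forall q : R, 2 < q <= p -> (Sq n q lambda <= (F q)%:E)%E].
Proof.
move=> e0; have e20 : 0 < e / 2 by rewrite divr_gt0.
have hi : has_inf (@sobolev_quotients R n).
  split; first exact: sobolev_quotients_nonempty.
  by exists 0; exact: sobolev_quotients_ge0.
have [_ [f [tf I0 ->]] fS] := inf_adherent e20 hi.
have [M1 M10 fM1] := test_vanish tf.
have [M2 M20 fM2] := test_vanish (test_grad2 tf).
have [T T0 fT] := test_bounded tf.
set M := Num.max M1 M2.
have M0 : 0 < M by rewrite lt_max M10.
have fM x : M < `|x| -> f x = 0 by rewrite gt_max => /andP[+ _]; exact: fM1.
have gM x : M < `|x| -> grad2 f x = 0 by rewrite gt_max => /andP[_]; exact: fM2.
set I := crit_integral f in I0 fS; set D := \int[mu]_x _ in fS.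
set E := \int[mu]_x grad2 f x.
have E0 : 0 <= E by apply: Rintegral_ge0 => x _; apply: sumr_ge0 => i _; exact: sqr_ge0.
have J0 : 0 < I `^ (2 / p) by exact: powR_gt0.
(* As rho >= 1 gives rho^2 >= rho, this choice makes the Hardy term |lambda| E / rho^2 at most (e /
   2) I^(2 / p), the half of the margin that the almost optimal [f] leaves. *)
pose rho := 1 + (- lambda * E) / (e / 2 * I `^ (2 / p)).
have rho1 : 1 <= rho.
  by rewrite lerDl divr_ge0// ?mulr_ge0 ?(ltW L_gt0)// ?(ltW e20)// ltW.
have rho0 : 0 < rho by exact: lt_le_trans rho1.
pose a : 'rV[R]_n := const_mx (rho + M).
have ra : rho + M <= `|a|.
  apply: le_trans (ler_coord_norm a (Ordinal n_gt0)).
  by rewrite mxE ler_norm.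
set W := Num.sqrt n%:R * (`|a| + M).
have W0 : 0 < W by rewrite mulr_gt0 ?sqrtr_gt0 ?ltr0n// ltr_wpDl.
pose num := D - lambda * (rho ^- 2 * E).
exists (fun q => num * (W `^ (- @hardy_exp R n q * - (2 / q)) *
  T `^ ((q - p) * - (2 / q)) * I `^ (- (2 / q)))); split.
- have cq : {for p, continuous (fun q : R => q)} by exact: cvg_id.
  have c2 : {for p, continuous (fun q : R => - (2 / q))}.
    apply: continuousN; apply: continuousM; first exact: cst_continuous.
    by apply: continuousV => //; rewrite gt_eqF.
  have ch : {for p, continuous (fun q : R => - @hardy_exp R n q)}.
    apply: continuousN; apply: continuousB; first exact: cst_continuous.
    apply: continuousM; last exact: cst_continuous.
    by apply: continuousM => //; exact: cst_continuous.
  apply: continuousM; first exact: cst_continuous.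
  apply: continuousM; last exact: powR_continuous_exponent.
  apply: continuousM; apply: powR_continuous_exponent => //.
    exact: continuousM.
  by apply: continuousM => //; apply: continuousB => //; exact: cst_continuous.
- have p2 : p - 2 != 0 by rewrite subr_eq0 gt_eqF.
  (* At q = p the corrections for weight and height vanish; the Sobolev quotient of [f] and the
     small Hardy term remain. *)
  have -> : @hardy_exp R n p = 0 by rewrite hardy_expE// /interp divff// subrr mulr0.
  rewrite subrr oppr0 !mul0r !powRr0 !mul1r powRN ltr_pdivrMr//.
  have fS' : D < (@sobolev_cst R n + e / 2) * I `^ (2 / p) by rewrite -ltr_pdivrMr.
  suff h : - lambda * (rho ^- 2 * E) <= e / 2 * I `^ (2 / p).
    rewrite /num -mulNr (_ : e = e / 2 + e / 2); last by field.
    by rewrite addrA (mulrDl (_ + _)); exact: ltr_leD.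
  have -> : - lambda * (rho ^- 2 * E) = - lambda * E / rho ^+ 2 by ring.
  rewrite ler_pdivrMr ?exprn_gt0//.
  rewrite [leRHS]mulrC -ler_pdivrMr; last by rewrite mulr_gt0.
  apply: (@le_trans _ _ rho); first by rewrite /rho lerDr.
  by rewrite expr2 -[leLHS]mulr1 ler_pM2l.
move=> q qp; have := Sq_le_translate qp tf I0 fM gM fT M0 T0 rho0 ra.
rewrite -/W -/I -/D -/E -/num; set c := _ `^ (- (2 / q)) => h.
rewrite (_ : W `^ _ * _ * _ = c)//.
rewrite /c (powRM _ (mulr_ge0 (powR_ge0 _ _) (powR_ge0 _ _)) (ltW I0)).
by rewrite (powRM _ (powR_ge0 W _) (powR_ge0 T _)) (powRrM W) (powRrM T).
Qed.

Lemma Sq_lt_Sq_rad : exists2 q0 : R, 2 < q0 < p &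
  forall q : R, q0 < q <= p -> (Sq n q lambda < Sq_rad n q lambda)%E.
Proof.
(* The margin is the excess of the radial constant at q = p over the Sobolev constant. *)
have p2 := p_gt2; have e0 : 0 < - lambda * @gradient_cst R n by rewrite mulr_gt0// gradient_cst_gt0.
have [F [cF Fp FS]] := Sq_near_crit e0.
pose d q := @radial_bound R n lambda q - F q.
have cd : {for p, continuous d}.
  by apply: continuousB => //; exact: radial_bound_continuous.
have dp : 0 < d p by rewrite subr_gt0 radial_bound_crit// /radial_crit_cst -mulNr.
have /cvgrPdist_lt/(_ _ dp)[/= r r0 rd] := cd.
(* The first entry keeps [q] in the neighbourhood of [p] given by continuity, the midpoint keeps it
   above 2. *)
exists (Num.max (p - r / 2) ((2 + p) / 2)).
  rewrite lt_max gt_max; apply/andP; split; first by apply/orP; right; lra.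
  by apply/andP; split; lra.
move=> q /andP[]; rewrite gt_max => /andP[q1 q2] qp.
have q2p : 2 < q <= p by rewrite qp andbT; lra.
have dq : 0 < d q.
  have /rd : ball p r q by rewrite /ball/= ger0_norm ?subr_ge0//; lra.
  by rewrite /= ltr_norml => /andP[_]; lra.
apply: le_lt_trans (FS _ q2p) _; apply: lt_le_trans (Sq_rad_ge n5 lambda_lt0 q2p).
by rewrite lte_fin -subr_gt0.
Qed.

End near_critical.

Theorem theorem1p3 (R : realType) (n : nat) (hn : (5 <= n)%N)
    (lambda : R) (hlambda : lambda < 0) :
  exists q0 : R,
    [/\ 2 < q0 < crit_exp R n,
        forall q : R, q0 < q <= crit_exp R n ->
          (Sq n q lambda < Sq_rad n q lambda)%E &
        forall q : R, q0 < q < crit_exp R n ->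
          forall u : 'rV[R]_n -> R, is_ground_state q lambda u -> ~ radial u].
Proof.
have [q0 q0p h] := Sq_lt_Sq_rad hn hlambda; exists q0; split => // q /andP[q1 q2] u.
move=> [[Du _] u0 [g [l [wg wl uS]]]] ru.
have : (Sq n q lambda < Sq_rad n q lambda)%E by apply: h; rewrite q1 ltW.
(* A radial ground state would compete for [Sq_rad] with quotient [Sq], against the strict
   inequality. *)
apply/negP; rewrite -leNgt -uS; apply: ereal_inf_lbound.
by exists u, g, l.
Qed.
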